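(* Let $\mathbf{K}$ be an algebraically closed field, let $\mathcal{D}$ be a $\mathbf{K}$-linear idempotent complete algebraic triangulated category, let $\Phi : \mathcal{D} \to \mathcal{D}$ be an exact endofunctor, and let $(\mathcal{B},\mathcal{A},M)$ be an ST-triple inside $\mathcal{D}$ such that $M$ is basic. Let $S_1,\dots,S_n$ be a complete set of pairwise non-isomorphic simple objects of the heart $\mathcal{H}_{\mathfrak{a}}$ of the t-structure $\mathfrak{a}=(\mathcal{A}_M^{\leq 0},\mathcal{A}_M^{\geq 0})$ on $\mathcal{A}$, and put $S := S_1\oplus\cdots\oplus S_n$. Assume that $\Phi(\mathcal{A}) \subset \mathcal{A}$ and $\Phi(\mathcal{B}) \subset \mathcal{B}$, and that $(\Phi|_{\mathcal{A}})^N\not\cong0$ and $(\Phi|_{\mathcal{B}})^N\not\cong 0$ for every $N>0$. Let $t\in\mathbf{R}$. Then $$h_t(\Phi|_{\mathcal{A}}) = \lim_{N \to \infty} \frac{1}{N} \log \sum_{k \in \mathbf{Z}} \dim \mathrm{Hom}^{-k}(M,\Phi^N(G_{\mathcal{A}})) e^{kt},$$ $$h_t(\Phi|_{\mathcal{B}}) = \lim_{N \to \infty} \frac{1}{N} \log \sum_{k \in \mathbf{Z}} \dim \mathrm{Hom}^{-k}(\Phi^N(G_{\mathcal{B}}),S) e^{-kt}$$ for any split-generators $G_{\mathcal{A}}$ of $\mathcal{A}$ and $G_{\mathcal{B}}$ of $\mathcal{B}$. In particular, if $\Phi$ is an exact autoequivalence then $$h_t(\Phi|_{\mathcal{A}})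 = h_{-t}(\Phi|_{\mathcal{B}}^{-1}) = \lim_{N \to \infty} \frac{1}{N} \log \sum_{k \in \mathbf{Z}} \dim \mathrm{Hom}^{-k}(M,\Phi^N(S)) e^{kt}.$$
   Context: $\Sigma$ is the shift functor and $\mathrm{Hom}^k(E,F):=\mathrm{Hom}(E,\Sigma^kF)$. A triangulated category is algebraic if it admits a dg enhancement, i.e. it is exactly equivalent to $H^0$ of a pretriangulated dg category. A thick subcategory is a triangulated subcategory closed under direct summands. An object $G$ of a triangulated category $\mathcal{T}$ is a split-generator if the smallest thick subcategory containing $G$ is $\mathcal{T}$. Categorical entropy. Let $\mathcal{T}$ be a triangulated category with a split-generator and $\Psi:\mathcal{T}\to\mathcal{T}$ an exact endofunctor with $\Psi^N\not\cong0$ for all $N>0$. A filtration of $X\in\mathcal{T}$ with factors $X_1,\dots,X_m$ is a sequence $0=Y_0\to Y_1\to\cdots\to Y_m=X$ with exact triangles $Y_{i-1}\to Y_i\to X_i\to\Sigma Y_{i-1}$. For $E,F\in\mathcal{T}$, $t\in\mathbf{R}$, $\delta_t(E,F)$ is $0$ if $F\cong0$; otherwise it is the infimum of $\sum_{i=1}^m e^{k_it}$ over all filtrations of $F\oplus F'$ (for some $F'\in\mathcal{T}$) with factors $\Sigma^{k_1}E,\dots,\Sigma^{k_m}E$, $k_i\in\mathbf{Z}$. Then $h_t(\Psi)=\lim_{N\to\infty}\frac1N\log\delta_t(G,\Psi^N(G))$ for a split-generator $G$ of $\mathcal{T}$ (the limit exists and is independent of $G$). Here $h_t(\Phi|_{\mathcal{A}})$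 is computed in $\mathcal{A}$, and $h_t(\Phi|_{\mathcal{B}})$, $h_{-t}(\Phi|_{\mathcal{B}}^{-1})$ in $\mathcal{B}$. t-structures. A t-structure on $\mathcal{T}$ is a pair $(\mathcal{T}^{\le0},\mathcal{T}^{\ge0})$ of full additive subcategories with $\Sigma\mathcal{T}^{\le0}\subset\mathcal{T}^{\le0}$, $\Sigma^{-1}\mathcal{T}^{\ge0}\subset\mathcal{T}^{\ge0}$, $\mathrm{Hom}(\mathcal{T}^{\le0},\Sigma^{-1}\mathcal{T}^{\ge0})=0$, and such that every $E\in\mathcal{T}$ fits in an exact triangle $D\to E\to F\to\Sigma D$ with $D\in\mathcal{T}^{\le0}$, $F\in\Sigma^{-1}\mathcal{T}^{\ge0}$. It is bounded if $\mathcal{T}=\bigcup_{k\in\mathbf{Z}}\Sigma^k\mathcal{T}^{\le0}=\bigcup_{k\in\mathbf{Z}}\Sigma^k\mathcal{T}^{\ge0}$. Its heart is the abelian category $\mathcal{T}^{\le0}\cap\mathcal{T}^{\ge0}$. ST-triples. A silting object of a triangulated category is a split-generator $M$ with $\mathrm{Hom}(M,\Sigma^kM)=0$ for all $k>0$. For a full subcategory $\mathcal{C}\subset\mathcal{D}$ and $M\in\mathcal{D}$ put $\mathcal{C}_M^{\le0}=\{E\in\mathcal{C}\mid\mathrm{Hom}(M,\Sigma^kE)=0\ \forall k>0\}$ and $\mathcal{C}_M^{\ge0}=\{E\in\mathcal{C}\mid\mathrm{Hom}(M,\Sigma^kE)=0\ \forall k<0\}$. An ST-triple $(\mathcal{B},\mathcal{A},M)$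 inside $\mathcal{D}$ consists of thick subcategories $\mathcal{A},\mathcal{B}$ of $\mathcal{D}$ and a silting object $M$ of $\mathcal{B}$ such that: (1) $\mathrm{Hom}(M,E)$ is finite-dimensional for every $E\in\mathcal{D}$; (2) $(\mathcal{D}_M^{\le0},\mathcal{D}_M^{\ge0})$ is a t-structure on $\mathcal{D}$; (3) $\mathcal{D}_M^{\ge0}\subset\mathcal{A}$ and $\mathfrak{a}=(\mathcal{A}_M^{\le0},\mathcal{A}_M^{\ge0})$ is a bounded t-structure on $\mathcal{A}$. In this situation $\mathcal{B}$ is Krull–Schmidt, and $\mathcal{H}_{\mathfrak{a}}$ is a length category with finitely many isomorphism classes of simple objects. The object $M$ is basic if, in a decomposition $M\cong M_1\oplus\cdots\oplus M_n$ into indecomposables, $M_i\not\cong M_j$ for $i\ne j$. *)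

(* Defs.v *)
From mathcomp Require Import all_boot all_order all_algebra.
From mathcomp Require Import all_classical all_reals all_analysis.

Set Implicit Arguments.
Unset Strict Implicit.
Unset Printing Implicit Defensive.

Import Order.TTheory GRing.Theory Num.Theory.
Import numFieldNormedType.Exports.

Local Open Scope classical_set_scope.
Local Open Scope ring_scope.

Declare Scope cat_scope.
Delimit Scope cat_scope with cat.
Local Open Scope cat_scope.

(** * Finite dimension of abstract vector spaces *)

Definition has_dim (K : fieldType) (V : lmodType K) (n : nat) : Prop :=
  exists2 f : V -> 'rV[K]_n, linear f & bijective f.

Definition finite_dim (K : fieldType) (V : lmodType K) : Prop :=
  exists n, has_dim V n.

(* The dimension, with junk value 0 on infinite-dimensional spaces. *)
Definition dim (K : fieldType) (V : lmodType K) : nat :=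
  xget 0%N [set n | has_dim V n].

(** * K-linear categories *)

Record lincat (K : fieldType) := LinCat {
  obj :> Type;
  hom : obj -> obj -> lmodType K;
  idm : forall X, hom X X;
  comp : forall X Y Z, hom Y Z -> hom X Y -> hom X Z;
  comp_idl : forall X Y (f : hom X Y), comp (idm Y) f = f;
  comp_idr : forall X Y (f : hom X Y), comp f (idm X) = f;
  comp_assoc : forall X Y Z W (h : hom Z W) (g : hom Y Z) (f : hom X Y),
    comp h (comp g f) = comp (comp h g) f;
  comp_linl : forall X Y Z (g : hom Y Z), linear (fun f : hom X Y => comp g f);
  comp_linr : forall X Y Z (f : hom X Y), linear (fun g : hom Y Z => comp g f)
}.

Arguments hom {K l} X Y.
Arguments idm {K l} X.
Arguments comp {K l X Y Z} g f.

Notation "g \oc f" := (comp g f) (at level 40, left associativity) : cat_scope.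

Section Objects.
Variables (K : fieldType) (C : lincat K).
Implicit Types X Y Z : C.

Definition is_iso X Y (f : hom X Y) : Prop :=
  exists g : hom Y X, g \oc f = idm X /\ f \oc g = idm Y.

Definition isom X Y : Prop := exists f : hom X Y, is_iso f.

Definition is_zero X : Prop := idm X = 0.

(* Z is a direct sum of X and Y. *)
Definition is_sum2 X Y Z : Prop :=
  exists (i : hom X Z) (j : hom Y Z) (p : hom Z X) (q : hom Z Y),
    [/\ p \oc i = idm X, q \oc j = idm Y, p \oc j = 0, q \oc i = 0
      & i \oc p + j \oc q = idm Z].

(* Z is a direct sum of the finite family F. *)
Definition is_sum n (F : 'I_n -> C) Z : Prop :=
  exists (i : forall a, hom (F a) Z) (p : forall a, hom Z (F a)),
    [/\ forall a, p a \oc i a = idm (F a),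
        forall a b, a != b -> p a \oc i b = 0
      & \sum_a (i a \oc p a) = idm Z].

Definition indecomposable X : Prop :=
  ~ is_zero X /\ forall Y Z, is_sum2 Y Z X -> is_zero Y \/ is_zero Z.

Definition pairwise_nonisom n (F : 'I_n -> C) : Prop :=
  forall a b, a != b -> ~ isom (F a) (F b).

Definition basic X : Prop :=
  exists n (F : 'I_n -> C),
    [/\ is_sum F X, forall a, indecomposable (F a) & pairwise_nonisom F].

(* A full subcategory is given by its set of objects. *)
Definition additive_sub (P : set C) : Prop :=
  [/\ forall X, is_zero X -> P X
    & forall X Y Z, is_sum2 X Y Z -> P X -> P Y -> P Z].

Definition mono_in (H : set C) Y X (f : hom Y X) : Prop :=
  forall Z (g : hom Z Y), H Z -> f \oc g = 0 -> g = 0.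

(* Simple objects of the (abelian) full subcategory H: nonzero objects whose
   only subobjects are 0 and the object itself. *)
Definition simple_in (H : set C) X : Prop :=
  [/\ H X, ~ is_zero X
    & forall Y (f : hom Y X), H Y -> mono_in H f -> is_zero Y \/ is_iso f].

Definition complete_simples (H : set C) n (S_ : 'I_n -> C) : Prop :=
  [/\ forall a, simple_in H (S_ a), pairwise_nonisom S_
    & forall X, simple_in H X -> exists a, isom X (S_ a)].

Definition idempotent_complete : Prop :=
  forall X (e : hom X X), e \oc e = e ->
    exists Y (r : hom X Y) (s : hom Y X), s \oc r = e /\ r \oc s = idm Y.

End Objects.

(** * Additive functors *)

Record functor (K : fieldType) (C D : lincat K) := Functor {
  fobj :> C -> D;
  fmap : forall X Y, hom X Y -> hom (fobj X) (fobj Y);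
  fmapD : forall X Y (f g : hom X Y), fmap (f + g) = fmap f + fmap g;
  fmap_id : forall X, fmap (idm X) = idm (fobj X);
  fmap_comp : forall X Y Z (g : hom Y Z) (f : hom X Y),
    fmap (g \oc f) = fmap g \oc fmap f
}.

Arguments fmap {K C D} f {X Y} _ : rename.

Definition fid (K : fieldType) (C : lincat K) : functor C C :=
  @Functor K C C (fun X => X) (fun X Y f => f)
    (fun _ _ _ _ => erefl) (fun _ => erefl) (fun _ _ _ _ _ => erefl).

Definition fcomp (K : fieldType) (C D E : lincat K)
  (G : functor D E) (F : functor C D) : functor C E.
Proof.
refine (@Functor K C E (fun X => G (F X)) (fun X Y f => fmap G (fmap F f))
          _ _ _).
- by move=> X Y f g; rewrite !fmapD.
- by move=> X; rewrite !fmap_id.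
- by move=> X Y Z g f; rewrite !fmap_comp.
Defined.

Record natiso (K : fieldType) (C D : lincat K) (F G : functor C D) := NatIso {
  nt :> forall X, hom (F X) (G X);
  nt_iso : forall X, is_iso (nt X);
  nt_nat : forall X Y (f : hom X Y), nt Y \oc fmap F f = fmap G f \oc nt X
}.

Definition quasi_inverse (K : fieldType) (C D : lincat K)
    (F : functor C D) (G : functor D C) : Prop :=
  inhabited (natiso (fcomp G F) (fid C)) /\
  inhabited (natiso (fcomp F G) (fid D)).

(** * K-linear triangulated categories *)

(* The shift is an autoequivalence [sh] with a chosen quasi-inverse [shV], so
   that Hom^k makes sense for every integer k without assuming that the shift is
   bijective on objects. *)
Record tricat (K : fieldType) := TriCat {
  tcat :> lincat K;
  tzero : exists Z : tcat, is_zero Z;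
  tsum : forall X Y : tcat, exists Z, is_sum2 X Y Z;
  sh : functor tcat tcat;
  shV : functor tcat tcat;
  sh_linear : forall X Y : tcat, linear (fun f : hom X Y => fmap sh f);
  sh_counit : natiso (fcomp sh shV) (fid tcat);
  sh_unit : natiso (fcomp shV sh) (fid tcat);
  (* the exact triangles X -> Y -> Z -> sh X *)
  tri : forall X Y Z : tcat, hom X Y -> hom Y Z -> hom Z (sh X) -> Prop;
  tri_iso : forall X Y Z X' Y' Z' (f : hom X Y) (g : hom Y Z) (h : hom Z (sh X))
      (f' : hom X' Y') (g' : hom Y' Z') (h' : hom Z' (sh X'))
      (a : hom X X') (b : hom Y Y') (c : hom Z Z'),
    is_iso a -> is_iso b -> is_iso c ->
    b \oc f = f' \oc a -> c \oc g = g' \oc b -> fmap sh a \oc h = h' \oc c ->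
    tri f g h -> tri f' g' h';
  tri_id : forall X Z : tcat, is_zero Z ->
    tri (idm X) (0 : hom X Z) (0 : hom Z (sh X));
  tri_cone : forall (X Y : tcat) (f : hom X Y),
    exists Z (g : hom Y Z) (h : hom Z (sh X)), tri f g h;
  tri_rot : forall X Y Z (f : hom X Y) (g : hom Y Z) (h : hom Z (sh X)),
    tri f g h <-> tri g h (- fmap sh f);
  tri_fill : forall X Y Z X' Y' Z' (f : hom X Y) (g : hom Y Z) (h : hom Z (sh X))
      (f' : hom X' Y') (g' : hom Y' Z') (h' : hom Z' (sh X'))
      (a : hom X X') (b : hom Y Y'),
    tri f g h -> tri f' g' h' -> b \oc f = f' \oc a ->
    exists c : hom Z Z', c \oc g = g' \oc b /\ fmap sh a \oc h = h' \oc c;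
  tri_octa : forall X Y Z U V W (f : hom X Y) (g : hom Y Z)
      (i : hom Y U) (i' : hom U (sh X)) (j : hom Z W) (j' : hom W (sh Y))
      (k : hom Z V) (k' : hom V (sh X)),
    tri f i i' -> tri g j j' -> tri (g \oc f) k k' ->
    exists (u : hom U V) (v : hom V W),
      [/\ tri u v (fmap sh i \oc j'),
          u \oc i = k \oc g /\ k' \oc u = i',
          v \oc k = j & j' \oc v = fmap sh f \oc k']
}.

Arguments sh {K t}.
Arguments shV {K t}.
Arguments tri {K t X Y Z} f g h.

Definition shift (K : fieldType) (D : tricat K) (k : int) (X : D) : D :=
  match k with
  | Posz n => iter n sh X
  | Negz n => iter n.+1 shV X
  end.

(* Exact functors are only required to be additive, not K-linear. *)
Record exact_functor (K : fieldType) (D E : tricat K) := ExactFunctor {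
  efun :> functor D E;
  ef_sh : natiso (fcomp efun sh) (fcomp sh efun);
  ef_tri : forall (X Y Z : D) (f : hom X Y) (g : hom Y Z) (h : hom Z (sh X)),
    tri f g h -> tri (fmap efun f) (fmap efun g) (ef_sh X \oc fmap efun h)
}.

(** * Differential graded categories and enhancements *)

(* Degrees are related by equations, so that no transport along equalities of
   integers is needed to state the axioms. *)
Record dgcat (K : fieldType) := DGCat {
  dgobj :> Type;
  dghom : dgobj -> dgobj -> int -> lmodType K;
  dgd : forall X Y (m n : int), m + 1 = n -> dghom X Y m -> dghom X Y n;
  dgid : forall X, dghom X X 0;
  dgcomp : forall X Y Z (m n p : int), m + n = p ->
    dghom Y Z m -> dghom X Y n -> dghom X Z p;
  dgd_lin : forall X Y m n (e : m + 1 = n), linear (@dgd X Y m n e);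
  dgcomp_linl : forall X Y Z m n p (e : m + n = p) (g : dghom Y Z m),
    linear (fun f : dghom X Y n => dgcomp e g f);
  dgcomp_linr : forall X Y Z m n p (e : m + n = p) (f : dghom X Y n),
    linear (fun g : dghom Y Z m => dgcomp e g f);
  dgcomp_idl : forall X Y n (e : 0 + n = n) (f : dghom X Y n),
    dgcomp e (dgid Y) f = f;
  dgcomp_idr : forall X Y n (e : n + 0 = n) (f : dghom X Y n),
    dgcomp e f (dgid X) = f;
  dgcomp_assoc : forall X Y Z W (l m n lm mn p : int)
      (e1 : m + n = mn) (e2 : l + mn = p) (e3 : l + m = lm) (e4 : lm + n = p)
      (h : dghom Z W l) (g : dghom Y Z m) (f : dghom X Y n),
    dgcomp e2 h (dgcomp e1 g f) = dgcomp e4 (dgcomp e3 h g) f;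
  dgd_d : forall X Y (l m n : int) (e1 : l + 1 = m) (e2 : m + 1 = n)
      (f : dghom X Y l), dgd e2 (dgd e1 f) = 0;
  dgd_comp : forall X Y Z (m m1 n n1 p p1 : int)
      (em : m + 1 = m1) (en : n + 1 = n1) (ep : p + 1 = p1)
      (e : m + n = p) (e1 : m1 + n = p1) (e2 : m + n1 = p1)
      (g : dghom Y Z m) (f : dghom X Y n),
    dgd ep (dgcomp e g f) =
      dgcomp e1 (dgd em g) f + (-1 : K) ^ m *: dgcomp e2 g (dgd en f)
}.

Arguments dghom {K d} X Y n.
Arguments dgd {K d X Y m n} e f.
Arguments dgid {K d} X.
Arguments dgcomp {K d X Y Z m n p} e g f.

Section DG.
Variables (K : fieldType) (A : dgcat K).

Definition dgclosed (X Y : A) n (f : dghom X Y n) : Prop :=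
  dgd (erefl (n + 1)) f = 0.

(* X1 represents the shift X[1], through a closed invertible u of degree -1. *)
Definition is_dgshift (X X1 : A) (u : dghom X X1 (-1)) (v : dghom X1 X 1)
  : Prop :=
  [/\ dgclosed u, dgclosed v,
      dgcomp (erefl : 1 + (-1) = 0 :> int) v u = dgid X
    & dgcomp (erefl : (-1) + 1 = 0 :> int) u v = dgid X1].

(* C is the cone of the closed morphism f : X -> Y: as a graded object it is the
   direct sum of Y (via i, s) and X[1] (via j, p), with differential twisted
   by f. *)
Definition is_dgcone (X Y C : A) (f : dghom X Y 0)
    (i : dghom Y C 0) (s : dghom C Y 0) (j : dghom X C (-1)) (p : dghom C X 1)
  : Prop :=
  [/\ [/\ dgcomp (erefl : 1 + (-1) = 0 :> int) p j = dgid X,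
          dgcomp (erefl : 0 + 0 = 0 :> int) s i = dgid Y,
          dgcomp (erefl : 1 + 0 = 1 :> int) p i = 0,
          dgcomp (erefl : 0 + (-1) = -1 :> int) s j = 0
        & dgcomp (erefl : (-1) + 1 = 0 :> int) j p +
          dgcomp (erefl : 0 + 0 = 0 :> int) i s = dgid C],
      dgclosed i, dgclosed p,
      dgd (erefl : -1 + 1 = 0 :> int) j =
        dgcomp (erefl : 0 + 0 = 0 :> int) i f
    & dgd (erefl : 0 + 1 = 1 :> int) s =
        - dgcomp (erefl : 0 + 1 = 1 :> int) f p].

End DG.

(* A pretriangulated dg category: every object has a shift and a desuspension,
   and every closed morphism of degree 0 has a cone, up to closed isomorphism of
   degree 0.  Having them only up to homotopy equivalence yields the same
   categories H^0, since one may pass to the pretriangulated hull. *)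
Record pretridg (K : fieldType) := PreTriDG {
  pdg :> dgcat K;
  dgS : pdg -> pdg;
  dgSu : forall X, dghom X (dgS X) (-1);
  dgSv : forall X, dghom (dgS X) X 1;
  dgSP : forall X, is_dgshift (dgSu X) (dgSv X);
  dgSV : forall X : pdg, exists W (u : dghom W X (-1)) (v : dghom X W 1),
    is_dgshift u v;
  dgCone : forall (X Y : pdg) (f : dghom X Y 0), dgclosed f ->
    exists C (i : dghom Y C 0) (s : dghom C Y 0)
      (j : dghom X C (-1)) (p : dghom C X 1), is_dgcone f i s j p
}.

Arguments dgSu {K p} X : rename.
Arguments dgSv {K p} X : rename.

(* A K-linear exact equivalence H^0(A) -> D, where the morphisms of H^0(A) are
   the closed morphisms of degree 0 modulo the exact ones.  The action [de_map]
   on morphisms is given on representatives; its values on non-closed elements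
   are irrelevant.  The triangle attached to a cone is
   X -> Y -> C -> X[1]. *)
Record dg_enhancement (K : fieldType) (D : tricat K) := DGEnhancement {
  de_cat : pretridg K;
  de_obj : de_cat -> D;
  de_map : forall X Y : de_cat, dghom X Y 0 -> hom (de_obj X) (de_obj Y);
  de_lin : forall (X Y : de_cat) (a : K) (f g : dghom X Y 0),
    dgclosed f -> dgclosed g ->
    de_map (a *: f + g) = a *: de_map f + de_map g;
  de_id : forall X, de_map (dgid X) = idm (de_obj X);
  de_comp : forall (X Y Z : de_cat) (g : dghom Y Z 0) (f : dghom X Y 0),
    dgclosed g -> dgclosed f ->
    de_map (dgcomp (erefl : 0 + 0 = 0 :> int) g f) = de_map g \oc de_map f;
  (* well defined on H^0 and faithful *)
  de_faithful : forall (X Y : de_cat) (f : dghom X Y 0), dgclosed f ->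
    (de_map f = 0 <->
     exists h : dghom X Y (-1), dgd (erefl : -1 + 1 = 0 :> int) h = f);
  de_full : forall (X Y : de_cat) (g : hom (de_obj X) (de_obj Y)),
    exists2 f : dghom X Y 0, dgclosed f & de_map f = g;
  de_surj : forall E : D, exists X, isom (de_obj X) E;
  (* exactness *)
  de_sh : forall X : de_cat, hom (de_obj (dgS X)) (sh (de_obj X));
  de_sh_iso : forall X, is_iso (de_sh X);
  de_sh_nat : forall (X Y : de_cat) (f : dghom X Y 0), dgclosed f ->
    de_sh Y \oc de_map (dgcomp (erefl : (-1) + 1 = 0 :> int) (dgSu Y)
                          (dgcomp (erefl : 0 + 1 = 1 :> int) f (dgSv X)))
    = fmap sh (de_map f) \oc de_sh X;
  de_tri : forall (X Y C : de_cat) (f : dghom X Y 0) (i : dghom Y C 0)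
      (s : dghom C Y 0) (j : dghom X C (-1)) (p : dghom C X 1),
    dgclosed f -> is_dgcone f i s j p ->
    tri (de_map f) (de_map i)
      (de_sh X \oc de_map (dgcomp (erefl : (-1) + 1 = 0 :> int) (dgSu X) p))
}.

Definition algebraic (K : fieldType) (D : tricat K) : Prop :=
  inhabited (dg_enhancement D).

(** * Thick subcategories, t-structures, ST-triples

   A thick subcategory P of D is triangulated with the shift and the exact
   triangles of D, so the notions below are stated for a full subcategory P of
   the ambient D; the case of D itself is P = setT. *)

Section Triangulated.
Variables (K : fieldType) (D : tricat K).
Implicit Types (P L G A B : set D) (E F M X Y Z : D).

Definition thick P : Prop :=
  [/\ forall X, is_zero X -> P X,
      forall X, P X -> P (sh X) /\ P (shV X),
      forall X Y Z (f : hom X Y) (g : hom Y Z) (h : hom Z (sh X)),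
        tri f g h -> P X -> P Y -> P Z
    & forall X Y Z, is_sum2 X Y Z -> P Z -> P X].

Definition split_generator P E : Prop := smallest thick [set E] = P.

Definition silting P M : Prop :=
  split_generator P M /\
  forall (k : int) (f : hom M (shift k M)), 0 < k -> f = 0.

(* The essential image of L under the k-th power of the shift. *)
Definition shset (k : int) L : set D :=
  [set X | exists2 Y, L Y & isom X (shift k Y)].

Definition tstructure P L G : Prop :=
  [/\ [/\ L `<=` P, G `<=` P, additive_sub L & additive_sub G],
      forall X, L X -> L (sh X),
      forall X, G X -> G (shV X),
      forall X Y (f : hom X (shV Y)), L X -> G Y -> f = 0
    & forall E, P E -> exists X Y (f : hom X E) (g : hom E (shV Y))
        (h : hom (shV Y) (sh X)), [/\ L X, G Y & tri f g h]].

Definition bounded_tstructure P L G : Prop :=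
  [/\ tstructure P L G, P = \bigcup_(k in [set: int]) shset k L
    & P = \bigcup_(k in [set: int]) shset k G].

Definition heart L G : set D := L `&` G.

Definition aisle P M : set D :=
  [set E | P E /\ forall (k : int) (f : hom M (shift k E)), 0 < k -> f = 0].

Definition coaisle P M : set D :=
  [set E | P E /\ forall (k : int) (f : hom M (shift k E)), k < 0 -> f = 0].

Definition ST_triple B A M : Prop :=
  [/\ [/\ thick A, thick B & silting B M],
      forall E, finite_dim (hom M E),
      tstructure [set: D] (aisle [set: D] M) (coaisle [set: D] M),
      coaisle [set: D] M `<=` A
    & bounded_tstructure A (aisle A M) (coaisle A M)].

(* [filtration P s X]: X has a filtration inside P with factors s. *)
Inductive filtration P : seq D -> D -> Prop :=
| Filtration0 X : P X -> is_zero X -> filtration P [::] X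
| FiltrationS s Y X E (f : hom Y X) (g : hom X E) (h : hom E (sh Y)) :
    filtration P s Y -> P X -> P E -> tri f g h -> filtration P (rcons s E) X.

Definition preserves P (Phi : functor D D) : Prop := forall X, P X -> P (Phi X).

(* No positive power of the restriction of Phi to P is isomorphic to 0. *)
Definition non_nilpotent P (Phi : functor D D) : Prop :=
  forall N, (0 < N)%N -> exists2 X, P X & ~ is_zero (iter N Phi X).

End Triangulated.

(** * Categorical entropy *)

Section Entropy.
Variables (R : realType) (K : fieldType) (D : tricat K).
Local Open Scope ereal_scope.

(* The complexity of F relative to E, computed in the full subcategory P. *)
Definition delta (P : set D) (t : R) (E F : D) : \bar R :=
  if `[< is_zero F >] then 0 else
  ereal_inf [set (\sum_(k <- ks) expR (k%:~R * t))%R%:E | ks in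
    [set ks : seq int | exists F' X, [/\ P F', is_sum2 F F' X
       & filtration P [seq shift k E | k <- ks] X]]].

Definition log_growth (u : nat -> \bar R) : nat -> \bar R :=
  fun N => (N%:R^-1)%:E * lne (u N).

(* h is the entropy at t of the restriction of Phi to P: the defining limit
   exists and equals h for every split-generator (and there is one). *)
Definition is_entropy (P : set D) (Phi : functor D D) (t : R) (h : \bar R)
  : Prop :=
  (exists E, split_generator P E) /\
  forall E, split_generator P E ->
    log_growth (fun N => delta P t E (iter N Phi E)) @ \oo --> h.

(* Sum over all integers k of dim Hom^{-k}(E, F) e^{kt}. *)
Definition hom_sum (t : R) (E F : D) : \bar R :=
  \esum_(k in [set: int])
    ((dim (hom E (shift (- k)%R F)))%:R * expR (k%:~R * t))%R%:E.

End Entropy.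

(* Main.v *)
From Pilot Require Import Defs.
From HB Require Import structures.
From mathcomp Require Import all_boot all_order all_algebra.
From mathcomp Require Import all_classical all_reals all_analysis.
From mathcomp Require Import zify lra.
Import Pilot.Defs.

(* The complexity delta_t(E, F) is compared, up to constants independent of F,
   with a weighted sum of dimensions of Hom spaces.

   For F in A: the function sum_k dim Hom(M, F[-k]) e^(kt) is subadditive on
   triangles, hence at most a constant times delta_t(S, F).  Conversely, F is
   filtered by shifts of simple objects of the heart, and the number of factors
   in degree k is at most dim Hom(M, F[-k]), since Hom(M, -) is exact and faithful
   on the heart.

   For F in B: dim Hom(F, S[k]) plays the same role.  The lower bound comes from
   a minimal resolution of F by shifts of summands of M; such a summand X has
   dim Hom(X, S) = 1 because End(X) is local and K is algebraically closed.

   Submultiplicativity of delta_t and Fekete's lemma give the existence of the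
   entropies.  For an equivalence, Hom(Psi^N M, S[k]) = Hom(M, Phi^N S[k]) then
   relates the two restrictions; Psi preserves B since the resolution above exists
   for every object of D with bounded Hom(M, F[k]) above and Hom(F, S[k]) on both
   sides. *)

Set Implicit Arguments.
Unset Strict Implicit.
Unset Printing Implicit Defensive.
Import Order.TTheory GRing.Theory Num.Theory.
Import numFieldNormedType.Exports.
Local Open Scope classical_set_scope.
Local Open Scope ring_scope.
Local Open Scope cat_scope.

(** * Linear algebra *)

(** The weights e^(kt) can be arbitrarily large or small, so bounding the length of a filtration is
    not enough: factors have to be counted degree by degree. This shapes the peeling lemmas, in
    which one factor is removed so that a Hom dimension drops in the degree of that factor and rises
    in no degree. On the silting side this forces the covers to be minimal. The heart is never built
    as an abelian category. Kernels, images and cohomology objects appear as truncations of fibres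
    and cones, and maps are tested by applying Hom(M, -). Since [delta] allows an extra summand, the
    estimates are made for retracts of filtered objects, and these must survive gluing along
    triangles. Exact functors are only additive, so moving a quasi-inverse across Hom gives a
    bijection of groups; equality of dimensions then needs a separate argument about two commuting
    scalar actions. *)

Lemma nat_min (P : nat -> Prop) : (exists n, P n) ->
  exists2 n, P n & forall m, P m -> (n <= m)%N.
Proof.
move=> [n0 Pn0].
have ex : exists n, `[< P n >] by exists n0; apply/asboolP.
by case: (ex_minnP ex) => n /asboolP Pn nmin; exists n => // m Pm; apply/nmin/asboolP.
Qed.

Lemma nat_max (P : nat -> Prop) b : (exists n, P n) ->
  (forall n, P n -> (n <= b)%N) ->
  exists2 n, P n & forall m, P m -> (m <= n)%N.
Proof.
move=> [n0 Pn0] Pb.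
have ex : exists n, `[< P n >] by exists n0; apply/asboolP.
have bd n : `[< P n >] -> (n <= b)%N by move/asboolP/Pb.
by case: (ex_maxnP ex bd) => n /asboolP Pn nmax; exists n => // m Pm; apply/nmax/asboolP.
Qed.

Section LinearAlgebra.
Variable K : fieldType.
Implicit Types U V W : lmodType K.

Lemma linear_raddf V W (f : V -> W) : linear f ->
  [/\ f 0 = 0, forall u v, f (u + v) = f u + f v, forall u, f (- u) = - f u
    & forall a u, f (a *: u) = a *: f u].
Proof.
move=> lf.
pose g : {linear V -> W} := HB.pack f (GRing.isLinear.Build _ _ _ _ f lf).
have g0 : f 0 = 0 by exact: (raddf0 g).
split=> // [||a u]; [exact: (raddfD g)|exact: (raddfN g)|].
by rewrite -[a *: u]addr0 lf g0 addr0.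
Qed.

Lemma linear_can V W (f : V -> W) g : linear f -> cancel f g -> cancel g f ->
  linear g.
Proof.
by move=> lf fK gK a u v; apply: (can_inj fK); rewrite lf !gK.
Qed.

Lemma linear_comp U V W (f : V -> W) (g : U -> V) : linear f -> linear g ->
  linear (f \o g).
Proof. by move=> lf lg a u v /=; rewrite lg lf. Qed.

Definition lin_iso V W : Prop := exists2 f : V -> W, linear f & bijective f.

Lemma lin_iso_sym V W : lin_iso V W -> lin_iso W V.
Proof.
case=> f lf [g fK gK]; exists g; first exact: linear_can fK gK.
by exists f.
Qed.

Lemma lin_iso_trans U V W : lin_iso U V -> lin_iso V W -> lin_iso U W.
Proof.
case=> f lf bf [g lg bg]; exists (g \o f); first exact: linear_comp.
exact: bij_comp.
Qed.

Lemma linear_mx n m (f : 'rV[K]_n -> 'rV[K]_m) : linear f ->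
  exists A, forall u, f u = u *m A.
Proof.
move=> lf.
pose g : {linear 'rV[K]_n -> 'rV[K]_m} :=
  HB.pack f (GRing.isLinear.Build _ _ _ _ f lf).
by exists (lin1_mx g) => u; rewrite mul_rV_lin1.
Qed.

Lemma linear_inj_leq n m (f : 'rV[K]_n -> 'rV[K]_m) : linear f -> injective f ->
  (n <= m)%N.
Proof.
move=> /linear_mx[A fA] injf.
have : row_free A.
  by apply/inj_row_free => v; rewrite -fA => fv; apply: injf; rewrite fv fA mul0mx.
by rewrite /row_free => /eqP <-; exact: rank_leq_col.
Qed.

(** Among matrices with row space inside [P], one of maximal rank absorbs every vector of [P], since
    adjoining a new one would raise the rank. *)
Lemma subspace_mx m (P : set 'rV[K]_m) : P 0 ->
  (forall a u v, P u -> P v -> P (a *: u + v)) ->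
  exists n (A : 'M[K]_(n, m)), row_free A /\ forall v, P v <-> (v <= A)%MS.
Proof.
move=> P0 Plin.
pose Q r := exists2 A : 'M[K]_m, \rank A = r & forall v : 'rV_m, (v <= A)%MS -> P v.
have [||r [A rA AP] rmax] := @nat_max Q m.
- by exists 0%N, 0; rewrite ?mxrank0// => v; rewrite submx0 => /eqP ->.
- by move=> n [A <- _]; exact: rank_leq_col.
exists (\rank A), (row_base A); split; first exact: row_base_free.
move=> v; rewrite eq_row_base; split=> [Pv|/AP//].
have /rmax : Q (\rank (A + v)%MS).
  exists (A + v)%MS => // w /sub_addsmxP[[a b] ->] /=.
  rewrite addrC [b]mx11_scalar mul_scalar_mx; apply: Plin => //.
  by apply: AP; exact: submxMl.
move=> le; have : (A == A + v)%MS.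
  by rewrite -mxrank_leqif_eq ?addsmxSl// eqn_leq mxrankS ?addsmxSl// rA.
by move/eqmxP => e; rewrite e addsmxSr.
Qed.

Lemma has_dim_iso V W n : lin_iso V W -> has_dim W n -> has_dim V n.
Proof. exact: lin_iso_trans. Qed.

Lemma has_dim_uniq V m n : has_dim V m -> has_dim V n -> m = n.
Proof.
move=> Vm Vn; apply/eqP; rewrite eqn_leq.
have [f lf /bij_inj fi] := lin_iso_trans (lin_iso_sym Vm) Vn.
have [g lg /bij_inj gi] := lin_iso_trans (lin_iso_sym Vn) Vm.
by rewrite (linear_inj_leq lf fi) (linear_inj_leq lg gi).
Qed.

Lemma has_dimE V n : has_dim V n -> dim V = n.
Proof.
move=> Vn; rewrite /dim; case: xgetP => [m _ /= Vm|/(_ n)//].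
exact: has_dim_uniq Vm Vn.
Qed.

Lemma finite_dimP V : finite_dim V -> has_dim V (dim V).
Proof. by move=> [n Vn]; rewrite (has_dimE Vn). Qed.

Lemma lin_iso_dim V W : lin_iso V W -> finite_dim V -> finite_dim W /\ dim W = dim V.
Proof.
move=> /lin_iso_sym VW [n Vn]; have Wn := has_dim_iso VW Vn.
by rewrite (has_dimE Vn) (has_dimE Wn); split => //; exists n.
Qed.

Lemma has_dim_inj V W (f : V -> W) m : linear f -> injective f -> has_dim W m ->
  exists2 n, has_dim V n & (n <= m)%N /\
    ((exists w, forall v, f v <> w) -> (n < m)%N).
Proof.
move=> lf fi [phi lphi bphi]; have phii := bij_inj bphi.
have lg := linear_comp lphi lf; have [g0 gD gN gZ] := linear_raddf lg.
have [||n [A [Af AP]]] := @subspace_mx m (range (phi \o f)).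
- by exists 0.
- by move=> a _ _ [u _ <-] [v _ <-]; exists (a *: u + v) => //; rewrite lg.
have VA v : (phi (f v) <= A)%MS by apply/AP; exists v.
have nm : (n <= m)%N by move: Af; rewrite /row_free => /eqP <-; exact: rank_leq_col.
exists n.
  exists (fun v => phi (f v) *m pinvmx A).
    by move=> a u v /=; rewrite lf lphi mulmxDl scalemxAl.
  have ex (r : 'rV_n) : exists v, phi (f v) = r *m A.
    by have /AP[v _ <-] := submxMl r A; exists v.
  exists (fun r => projT1 (cid (ex r))) => [v|r].
    apply/fi/phii; case: cid => /= v' ->; exact: mulmxKpV.
  by case: cid => /= v' ->; exact: mulmxKp.
(* If [n = m], the row space of [A] is everything and [w] lies in the image. *)
split=> // -[w wf]; rewrite ltn_neqAle nm andbT; apply/negP => /eqP nE.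
have : (phi w <= A)%MS.
  by apply: submx_full; move: Af; rewrite /row_free /row_full => /eqP ->; apply/eqP.
by move=> /AP[v _ /phii]; exact: wf.
Qed.

Lemma dim_inj V W (f : V -> W) : linear f -> injective f -> finite_dim W ->
  finite_dim V /\ (dim V <= dim W)%N.
Proof.
move=> lf fi [m Wm]; have [n Vn [nm _]] := has_dim_inj lf fi Wm.
by rewrite (has_dimE Wm) (has_dimE Vn); split => //; exists n.
Qed.

Lemma dim_inj_lt V W (f : V -> W) : linear f -> injective f -> finite_dim W ->
  (exists w, forall v, f v <> w) -> (dim V < dim W)%N.
Proof.
move=> lf fi [m Wm] nsurj; have [n Vn [_ nm]] := has_dim_inj lf fi Wm.
by rewrite (has_dimE Wm) (has_dimE Vn) nm.
Qed.

(** The complement [A^C] of the kernel maps bijectively onto [W], so the dimension of [W] is [m]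
    minus the rank of the kernel; a nonzero kernel vector makes the inequality strict. *)
Lemma has_dim_surj V W (f : V -> W) m : linear f -> (forall w, exists v, f v = w) ->
  has_dim V m -> exists2 n, has_dim W n & (n <= m)%N /\
    ((exists2 v, v != 0 & f v = 0) -> (n < m)%N).
Proof.
move=> lf fs [phi lphi [psi phiK psiK]].
have lpsi := linear_can lphi phiK psiK.
have lg := linear_comp lf lpsi; have [g0 gD gN gZ] := linear_raddf lg.
set g := f \o psi in g0 gD gN gZ lg.
have [||k [A [Af AP]]] := @subspace_mx m [set u | g u = 0].
- exact: g0.
- by move=> a u v /= gu gv; rewrite gD gZ gu gv scaler0 addr0.
pose B := row_base (A^C)%MS.
have gB (r : 'rV_(\rank (A^C)%MS)) : g (r *m B) = 0 -> r = 0.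
  move=> /AP rA.
  have : (r *m B <= A :&: A^C)%MS.
    by rewrite sub_capmx rA (submx_trans (submxMl _ _))// eq_row_base.
  rewrite capmx_compl submx0 => /eqP rB.
  by apply: (row_free_inj (row_base_free (A^C)%MS)); rewrite rB mul0mx.
have gBs w : exists r : 'rV_(\rank (A^C)%MS), g (r *m B) = w.
  have [v <-] := fs w.
  have : (phi v <= A + A^C)%MS by apply: submx_full; exact: addsmx_compl_full.
  move=> /sub_addsmxP[[a b] /= e].
  have bB : (b *m A^C <= B)%MS by rewrite /B eq_row_base; exact: submxMl.
  have [r rE] := submxP bB.
  exists r; rewrite -rE.
  have -> : v = psi (phi v) by rewrite phiK.
  rewrite -[f _]/(g _) e gD.
  by have /AP -> := submxMl a A; rewrite add0r.
exists (\rank (A^C)%MS).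
  apply: lin_iso_sym; exists (fun r => g (r *m B)).
    by move=> a u v; rewrite mulmxDl -scalemxAl gD gZ.
  exists (fun w => projT1 (cid (gBs w))) => [r|w]; last by case: cid.
  case: cid => /= r' e; apply/subr0_eq/gB.
  by rewrite mulmxBl gD gN e subrr.
rewrite mxrank_compl leq_subr; split=> // -[v v0 fv].
have : (phi v <= A)%MS by apply/AP; rewrite /g /= phiK.
have [p0 _ _ _] := linear_raddf lphi.
have phiv0 : phi v != 0 by rewrite -p0 (inj_eq (can_inj phiK)).
move=> /mxrankS; rewrite rank_rV phiv0 => A0.
by rewrite -subn_gt0 subKn ?rank_leq_col// (leq_trans A0).
Qed.

Lemma dim_surj_lt V W (f : V -> W) : linear f -> (forall w, exists v, f v = w) ->
  finite_dim V -> (exists2 v, v != 0 & f v = 0) -> (dim W < dim V)%N.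
Proof.
move=> lf fs [m Vm] nz; have [n Wn [_ nm]] := has_dim_surj lf fs Vm.
by rewrite (has_dimE Vm) (has_dimE Wn) nm.
Qed.

(** [V] is spanned by the image of [f] and lifts of a basis of the image of [g]. Finiteness of [V]
    is a conclusion because the middle term of a long exact sequence of Hom spaces may not be known
    to be finite-dimensional beforehand. *)
Lemma dim_exact U V W (f : U -> V) (g : V -> W) : linear f -> linear g ->
  (forall v, g v = 0 -> exists u, f u = v) -> finite_dim U -> finite_dim W ->
  finite_dim V /\ (dim V <= dim U + dim W)%N.
Proof.
move=> lf lg ex /finite_dimP[phi lphi [psi phiK psiK]] /finite_dimP[chi lchi bchi].
have lpsi := linear_can lphi phiK psiK.
have lc := linear_comp lchi lg; have [c0 cD cN cZ] := linear_raddf lc.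
have [g0 gD gN gZ] := linear_raddf lg.
have [||n [A [Af AP]]] := @subspace_mx (dim W) (range (chi \o g)).
- by exists 0.
- by move=> a _ _ [u _ <-] [v _ <-]; exists (a *: u + v) => //; rewrite lc.
have nW : (n <= dim W)%N by move: Af; rewrite /row_free => /eqP <-; exact: rank_leq_col.
have ex' (i : 'I_n) : exists v, chi (g v) = row i A.
  by have /AP[v _ <-] := row_sub i A; exists v.
pose w i := projT1 (cid (ex' i)).
have wE i : chi (g (w i)) = row i A by rewrite /w; case: cid.
pose F (r : 'rV[K]_(dim U + n)) : V :=
  f (psi (lsubmx r)) + \sum_i rsubmx r ord0 i *: w i.
have lF : linear F.
  move=> a r s; rewrite /F.
  have -> : lsubmx (a *: r + s) = a *: lsubmx r + lsubmx s by apply/rowP => i; rewrite !mxE.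
  rewrite lpsi lf scalerDr -!addrA; congr (_ + _); rewrite addrCA; congr (_ + _).
  rewrite scaler_sumr -big_split; apply: eq_bigr => i _ /=.
  by rewrite !mxE scalerDl scalerA.
have FS v : exists r, F r = v.
  have : (chi (g v) <= A)%MS by apply/AP; exists v.
  move=> /submxP[r rE].
  have [|u uE] := ex (v - \sum_i r ord0 i *: w i).
    apply: (bij_inj bchi); rewrite -[LHS]/((chi \o g) _) -[RHS]/(chi 0).
    have -> : chi 0 = 0 by have [] := linear_raddf lchi.
    rewrite cD cN /= rE mulmx_sum_row.
    pose cc : {linear V -> 'rV[K]_(dim W)} :=
      HB.pack (chi \o g) (GRing.isLinear.Build _ _ _ _ (chi \o g) lc).
    have -> : chi (g (\sum_i r ord0 i *: w i)) = cc (\sum_i r ord0 i *: w i) by [].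
    rewrite linear_sum; apply/eqP; rewrite subr_eq0; apply/eqP/eq_bigr => i _.
    by rewrite linearZ /= wE.
  exists (row_mx (phi u) r); rewrite /F row_mxKl row_mxKr phiK uE.
  by rewrite subrK.
have [|m Vm [le _]] := @has_dim_surj _ _ F (dim U + n) lF FS.
  by exists id => //; exists id.
by rewrite (has_dimE Vm); split; [exists m|rewrite (leq_trans le)// leq_add2l].
Qed.

Lemma has_dim0P V : has_dim V 0 <-> forall v : V, v = 0.
Proof.
split=> [[f lf bf] v|V0].
  by apply: (bij_inj bf); rewrite !thinmx0.
exists (fun=> 0) => [a u v|]; first by rewrite scaler0 addr0.
by exists (fun=> 0) => [v|r]; [rewrite [RHS]V0|rewrite thinmx0].
Qed.

Lemma dim_eq0 V : finite_dim V -> dim V = 0%N -> forall v : V, v = 0.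
Proof. by move=> /finite_dimP + e; rewrite e => /has_dim0P. Qed.

Lemma zero_dim V : (forall v : V, v = 0) -> finite_dim V /\ dim V = 0%N.
Proof. by move=> /has_dim0P V0; split; [exists 0%N|exact: has_dimE]. Qed.

Lemma dim_gt0 V (v : V) : finite_dim V -> v != 0 -> (0 < dim V)%N.
Proof.
by move=> fV; rewrite lt0n; apply: contraNneq => d0; apply/eqP; exact: dim_eq0.
Qed.

(** Choose [n > 0] with the n-th power of minimal rank: powers n and 2n then have the same image and
    the same kernel, so [V] is the direct sum of the two. *)
Lemma fitting V (T : V -> V) : linear T -> finite_dim V ->
  exists n, [/\ (0 < n)%N,
    forall v, exists z, iter n T (v - iter n T z) = 0
    & forall z, iter n T (iter n T z) = 0 -> iter n T z = 0].
Proof.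
move=> lT /finite_dimP; set m := dim V => -[phi lphi [psi phiK psiK]].
have lpsi := linear_can lphi phiK psiK.
have [A AE] := linear_mx (linear_comp lphi (linear_comp lT lpsi)).
have iterE n v : phi (iter n T v) = phi v *m A ^+ n.
  elim: n v => [|n IH] v; first by rewrite expr0 mulmx1.
  by rewrite iterSr IH exprS -mulmxE mulmxA -AE /= phiK.
have [|r [n n0 rn] rmin] := @nat_min (fun r => exists2 n, (0 < n)%N & \rank (A ^+ n) = r).
  by exists (\rank (A ^+ 1)), 1%N.
have le2 : (A ^+ (n + n) <= A ^+ n)%MS by rewrite exprD submxMl.
have rk : \rank (A ^+ (n + n)) = \rank (A ^+ n).
  apply/eqP; rewrite eqn_leq mxrankS//= rn; apply: rmin.
  by exists (n + n)%N => //; rewrite addn_gt0 n0.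
exists n; split=> // [v|z].
- have : (A ^+ n <= A ^+ (n + n))%MS.
    by rewrite -(geq_leqif (mxrank_leqif_sup le2)) rk.
  move=> /submxP[C CE]; exists (psi (phi v *m C)).
  apply: (can_inj phiK); have [p0 pD pN _] := linear_raddf lphi.
  rewrite iterE pD pN iterE psiK mulmxBl {1}CE p0 exprD -!mulmxA mulmxE.
  by rewrite subrr.
- move=> /(congr1 phi); have [p0 _ _ _] := linear_raddf lphi.
  rewrite !iterE p0 -mulmxA -[A ^+ n *m _]exprD => z0.
  apply: (can_inj phiK); rewrite iterE p0; apply/sub_kermxP.
  have : (kermx (A ^+ n) == kermx (A ^+ (n + n)))%MS.
    rewrite -mxrank_leqif_eq ?mxrank_ker ?rk//.
    by apply/sub_kermxP; rewrite exprD mulmxE mulrA -mulmxE mulmx_ker mul0mx.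
  by move=> /eqmxP ->; apply/sub_kermxP.
Qed.

End LinearAlgebra.

(** * Invariant subspaces of commuting matrices over an algebraically closed field *)

Lemma prod_char_poly_roots (K : closedFieldType) m (B : 'M[K]_m) :
  exists s : seq K, foldr (fun l P => (B - l%:M) *m P) 1%:M s = 0.
Proof.
case: m B => [|m] B; first by exists [::]; rewrite /= thinmx0.
have [s sE] := closed_field_poly_normal (char_poly B).
exists s; have := Cayley_Hamilton B.
rewrite sE (monicP (char_poly_monic B)) scale1r rmorph_prod => <-.
elim: s {sE} => [|l s IH] /=; first by rewrite big_nil.
by rewrite big_cons IH rmorphB /= horner_mx_X horner_mx_C mulmxE.
Qed.

Section CommutingFamily.
Variables (K : closedFieldType) (m : nat) (I : Type) (B : I -> 'M[K]_m).
Hypothesis BC : forall i j, B i *m B j = B j *m B i.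

Let inv (U : 'M[K]_m) := forall i, (U *m B i <= U)%MS.

(** Otherwise the inclusions for all [l], composed over the roots of the characteristic polynomial,
    put [U] inside [U'] by Cayley-Hamilton. For invariant [U] the conclusion says that [B i] has an
    eigenvalue on [U / U']. *)
Lemma shift_sub_proper (U U' : 'M[K]_m) i : inv U' -> ~ (U <= U')%MS ->
  exists l, ~ (U <= U *m (B i - l%:M) + U')%MS.
Proof.
move=> iU' nUU'; apply: contrapT => /forallNP al.
have {}al l : (U <= U *m (B i - l%:M) + U')%MS by apply: contrapT; exact: al.
apply: nUU'.
have [s s0] := prod_char_poly_roots (B i).
have [UP U'P] : (U <= U *m foldr (fun l P => (B i - l%:M) *m P) 1%:M s + U')%MS /\
  (U' *m foldr (fun l P => (B i - l%:M) *m P) 1%:M s <= U')%MS.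
  elim: s {s0} => [|l s [IH IH']] /=; first by rewrite !mulmx1 addsmxSl.
  set P := foldr _ _ _ in IH IH' *.
  have U'l : (U' *m ((B i - l%:M) *m P) <= U')%MS.
    rewrite mulmxA mulmxBr mulmxBl mul_mx_scalar -scalemxAl.
    rewrite addmx_sub ?eqmx_opp ?scalemx_sub//.
    exact: (submx_trans (submxMr _ (iU' i))).
  split=> //; apply: (submx_trans IH); rewrite addsmx_sub addsmxSr andbT.
  apply: (submx_trans (submxMr P (al l))); rewrite addsmxMr -mulmxA.
  exact: addsmxS.
by move: UP; rewrite s0 mulmx0 => /submx_trans; apply; rewrite addsmx_sub sub0mx submx_refl.
Qed.

(** Take [U'] invariant of maximal rank at most [r]. If that rank were below [r], every [B i] would
    act on [U / U'] by a scalar, and any line of the quotient would give a larger invariant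
    subspace. *)
Lemma inv_hyperplane (U : 'M[K]_m) r : inv U -> \rank U = r.+1 ->
  exists U', [/\ (U' <= U)%MS, inv U' & \rank U' = r].
Proof.
move=> iU rU.
pose Q k := exists U' : 'M[K]_m, [/\ (U' <= U)%MS, inv U', \rank U' = k & (k <= r)%N].
have [||k [U' [sU' iU' rU' kr]] kmax] := @nat_max Q r.
- exists 0%N, 0; split; rewrite ?sub0mx ?mxrank0// => i.
  by rewrite mul0mx sub0mx.
- by move=> n [? []].
exists U'; split=> //; apply/eqP; rewrite rU' eqn_leq kr leqNgt; apply/negP => lt.
have nUU' : ~ (U <= U')%MS.
  by move=> /mxrankS; rewrite rU rU' => rk; rewrite leqNgt ltnS kr in rk.
(* [U *m (B i - l%:M)] plus [U'] is invariant because the family commutes, and proper in [U] by the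
   choice of [l]; maximality makes it equal to [U']. *)
have scal i : exists l, (U *m (B i - l%:M) <= U')%MS.
  have [l nl] := shift_sub_proper i iU' nUU'; exists l.
  set U1 := (_ + _)%MS in nl.
  have sU1 : (U1 <= U)%MS.
    rewrite addsmx_sub sU' andbT mulmxBr mul_mx_scalar.
    by rewrite addmx_sub ?eqmx_opp ?scalemx_sub.
  have rU1 : (\rank U1 <= r)%N.
    rewrite -ltnS -rU ltn_neqAle mxrankS// andbT; apply/negP => /eqP e.
    by apply: nl; rewrite -(geq_leqif (mxrank_leqif_sup sU1)) e.
  have iU1 j : (U1 *m B j <= U1)%MS.
    rewrite addsmxMr addsmxS// -mulmxA.
    have -> : (B i - l%:M) *m B j = B j *m (B i - l%:M).
      by rewrite mulmxBl mulmxBr BC mul_scalar_mx mul_mx_scalar.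
    by rewrite mulmxA submxMr.
  have s1 : (U' <= U1)%MS by exact: addsmxSr.
  have : (U1 <= U')%MS.
    rewrite -(geq_leqif (mxrank_leqif_sup s1)) rU'; apply: kmax.
    by exists U1.
  by apply: submx_trans; exact: addsmxSl.
have /row_subPn[a na] : ~~ (U <= U')%MS by exact/negP.
set v := row a U in na; pose U2 := (U' + v)%MS.
have sU2 : (U2 <= U)%MS by rewrite addsmx_sub sU' row_sub.
have : (\rank U2 <= k)%N.
  apply: kmax; exists U2; split=> //.
    move=> i; have [l lP] := scal i.
    rewrite addsmxMr addsmx_sub (submx_trans (iU' i)) ?addsmxSl//=.
    have -> : v *m B i = v *m (B i - l%:M) + l *: v.
      by rewrite mulmxBr mul_mx_scalar subrK.
    rewrite addmx_sub ?scalemx_sub ?addsmxSr//.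
    apply: (submx_trans _ (addsmxSl _ _)); apply: submx_trans lP.
    by rewrite submxMr ?row_sub.
  apply: leq_trans lt; apply: (leq_trans (mxrank_adds_leqif _ _)).
  by rewrite rU' -[X in (_ <= X)%N]addn1 leq_add2l rank_leq_row.
have s2 : (U' <= U2)%MS by exact: addsmxSl.
rewrite -rU' (geq_leqif (mxrank_leqif_sup s2)) addsmx_sub => /andP[_].
exact/negP.
Qed.

End CommutingFamily.

(* V = W carries two commuting K-structures.  A maximal chain of W-subspaces
   stable under both has steps of W-dimension one, because commuting operators
   over an algebraically closed field are simultaneously triangularizable; its
   length is therefore dim W, and it bounds dim V from below. *)
Lemma dim_bimodule_leq (K : closedFieldType) (V W : lmodType K)
    (th : V -> W) (ht : W -> V) :
  (forall u v, th (u + v) = th u + th v) -> cancel th ht -> cancel ht th ->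
  (forall a b v, th (b *: ht (a *: th v)) = a *: th (b *: v)) ->
  finite_dim V -> finite_dim W -> (dim W <= dim V)%N.
Proof.
move=> thD thK htK thC fV /finite_dimP; set m := dim W => -[phi lphi [psi phiK psiK]].
have lpsi := linear_can lphi phiK psiK.
have th0 : th 0 = 0 by apply: (addrI (th 0)); rewrite -thD !addr0.
have [phi0 phiD phiN phiZ] := linear_raddf lphi.
(* Multiplication by [b] in [V], transported to [W], is linear for the structure of [W] by [thC],
   hence given by a matrix. *)
have ex b : exists A : 'M[K]_m, forall w, phi (th (b *: ht w)) = phi w *m A.
  have [|A AE] := @linear_mx _ m m (fun r => phi (th (b *: ht (psi r)))).
    move=> a u v; rewrite lpsi.
    have -> : a *: psi u + psi v = th (ht (a *: th (ht (psi u))) + ht (psi v)).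
      by rewrite thD !htK.
    by rewrite thK scalerDr thD thC phiD phiZ.
  by exists A => w; rewrite -AE phiK.
pose B b := projT1 (cid (ex b)).
have BE b w : phi (th (b *: ht w)) = phi w *m B b by rewrite /B; case: cid.
have BC b c : B b *m B c = B c *m B b.
  apply/row_matrixP => i; rewrite !rowE !mulmxA -[delta_mx _ _]psiK.
  by rewrite -!BE !thK !scalerA mulrC.
(* Each step of the chain of stable [W]-subspaces contributes one vector, independent of the earlier
   ones for the structure of [V]. *)
have chain r : forall U : 'M[K]_m, (forall b, (U *m B b <= U)%MS) -> \rank U = r ->
    exists j : 'rV[K]_r -> V, [/\ linear j, injective j &
      forall x, (phi (th (j x)) <= U)%MS].
  elim: r => [|r IH] U iU rU.
    exists (fun=> 0); split=> [a u v|u v _|_]; rewrite ?scaler0 ?addr0//.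
      by rewrite thinmx0 [RHS]thinmx0.
    by rewrite th0 phi0 sub0mx.
  have [U' [sU' iU' rU']] := inv_hyperplane BC iU rU.
  have [j [lj ij jU']] := IH _ iU' rU'.
  have /row_subPn[a na] : ~~ (U <= U')%MS.
    by apply/negP => /mxrankS; rewrite rU rU' ltnn.
  pose v := ht (psi (row a U)).
  have vE : phi (th v) = row a U by rewrite htK psiK.
  have stab U1 b w : (forall b, (U1 *m B b <= U1)%MS) -> (phi (th w) <= U1)%MS ->
      (phi (th (b *: w)) <= U1)%MS.
    move=> iU1 wU1; rewrite -[w]thK BE.
    exact: (submx_trans (submxMr _ wU1)).
  exists (fun x : 'rV_(1 + r) => lsubmx x 0 0 *: v + j (rsubmx x)).
  have [j0 jD jN jZ] := linear_raddf lj.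
  have lj' : linear (fun x : 'rV_(1 + r) => lsubmx x 0 0 *: v + j (rsubmx x)).
    move=> b x y; have -> : rsubmx (b *: x + y) = b *: rsubmx x + rsubmx y.
      by apply/rowP => i; rewrite !mxE.
    by rewrite lj !mxE scalerDl scalerDr scalerA !addrA; congr (_ + _); rewrite addrAC.
  split=> // [x y|x].
  - move=> e; apply/subr0_eq; pose z : 'rV[K]_(1 + r) := x - y; change (z = 0).
    have [_ gD gN _] := @linear_raddf K ('rV[K]_(1 + r)) V _ lj'.
    have {e} : lsubmx z 0 0 *: v + j (rsubmx z) = 0 by rewrite gD gN e subrr.
    have [z0 |z0 e] := eqVneq (lsubmx z 0 0) 0.
      rewrite z0 scale0r add0r => jz.
      rewrite -[z]hsubmxK [lsubmx z]mx11_scalar z0 raddf0.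
      by rewrite (ij _ 0 (etrans jz (esym j0))) row_mx0.
    (* A nonzero coefficient would put [v] in [U'], which is stable under the scalars of [V]. *)
    exfalso; move/negP: na; apply; rewrite -vE.
    have -> : v = - (lsubmx z 0 0)^-1 *: j (rsubmx z).
      have -> : j (rsubmx z) = - (lsubmx z 0 0 *: v) by apply/eqP; rewrite -addr_eq0 addrC e.
      by rewrite scalerN scaleNr opprK scalerA mulVf ?scale1r.
    exact: stab.
  - rewrite thD phiD addmx_sub//; last exact: submx_trans sU'.
    by apply: stab => //; rewrite vE row_sub.
have [b||j [lj ij _]] := chain m 1%:M; rewrite ?submx1 ?mxrank1//.
by have [_] := dim_inj lj ij fV; rewrite (has_dimE (_ : has_dim 'rV[K]_m m))//;
  exists id => //; exists id.
Qed.

(** * Linear and triangulated categories *)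

Lemma int_ind_step (P : int -> Prop) : P 0 -> (forall k, P k -> P (k + 1)) ->
  (forall k, P (k + 1) -> P k) -> forall k, P k.
Proof.
move=> P0 Pp Pm; case=> n.
  by elim: n => // n /Pp; rewrite -addn1 PoszD.
elim: n => [|n IH]; apply: Pm; first by rewrite NegzE addNr.
suff -> : Negz n.+1 + 1 = Negz n by [].
by rewrite !NegzE -[n.+2]addn1 PoszD opprD addrNK.
Qed.

Section Categories.
Variables (K : fieldType) (C : lincat K).
Implicit Types X Y Z : C.

Lemma compDr X Y Z (g : hom Y Z) (f f' : hom X Y) :
  g \oc (f + f') = g \oc f + g \oc f'.
Proof. by have [_ + _ _] := linear_raddf (comp_linl g (X := X)); apply. Qed.

Lemma compDl X Y Z (g g' : hom Y Z) (f : hom X Y) :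
  (g + g') \oc f = g \oc f + g' \oc f.
Proof. by have [_ + _ _] := linear_raddf (comp_linr f (Z := Z)); apply. Qed.

Lemma compNr X Y Z (g : hom Y Z) (f : hom X Y) : g \oc (- f) = - (g \oc f).
Proof. by have [_ _ + _] := linear_raddf (comp_linl g (X := X)); apply. Qed.

Lemma compNl X Y Z (g : hom Y Z) (f : hom X Y) : (- g) \oc f = - (g \oc f).
Proof. by have [_ _ + _] := linear_raddf (comp_linr f (Z := Z)); apply. Qed.

Lemma compBr X Y Z (g : hom Y Z) (f f' : hom X Y) :
  g \oc (f - f') = g \oc f - g \oc f'.
Proof. by rewrite compDr compNr. Qed.

Lemma compBl X Y Z (g g' : hom Y Z) (f : hom X Y) :
  (g - g') \oc f = g \oc f - g' \oc f.
Proof. by rewrite compDl compNl. Qed.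

Lemma comp0r X Y Z (g : hom Y Z) : g \oc (0 : hom X Y) = 0.
Proof. by have [+ _ _ _] := linear_raddf (comp_linl g (X := X)); apply. Qed.

Lemma comp0l X Y Z (f : hom X Y) : (0 : hom Y Z) \oc f = 0.
Proof. by have [+ _ _ _] := linear_raddf (comp_linr f (Z := Z)); apply. Qed.

Lemma compZr X Y Z (g : hom Y Z) a (f : hom X Y) : g \oc (a *: f) = a *: (g \oc f).
Proof. by have [_ _ _ +] := linear_raddf (comp_linl g (X := X)); apply. Qed.

Lemma compZl X Y Z a (g : hom Y Z) (f : hom X Y) : (a *: g) \oc f = a *: (g \oc f).
Proof. by have [_ _ _ +] := linear_raddf (comp_linr f (Z := Z)); apply. Qed.

Lemma is_iso_id X : is_iso (idm X).
Proof. by exists (idm X); rewrite comp_idl. Qed.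

Lemma is_iso_comp X Y Z (g : hom Y Z) (f : hom X Y) :
  is_iso g -> is_iso f -> is_iso (g \oc f).
Proof.
move=> [g' [g'g gg']] [f' [f'f ff']]; exists (f' \oc g'); split.
  by rewrite -comp_assoc (comp_assoc g') g'g comp_idl f'f.
by rewrite -comp_assoc (comp_assoc f) ff' comp_idl gg'.
Qed.

Lemma is_iso_right X Y (f : hom X Y) (g h : hom Y X) :
  f \oc g = idm Y -> h \oc f = idm X -> is_iso f.
Proof.
move=> fg hf; exists g; split=> //.
by rewrite -hf -{1}[g]comp_idl -hf -(comp_assoc h) fg comp_idr.
Qed.

Lemma isom_refl X : isom X X.
Proof. by exists (idm X); exact: is_iso_id. Qed.

Lemma isom_sym X Y : isom X Y -> isom Y X.
Proof. by move=> [f [g [gf fg]]]; exists g, f. Qed.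

Lemma isom_trans Y X Z : isom X Y -> isom Y Z -> isom X Z.
Proof. by move=> [f fi] [g gi]; exists (g \oc f); exact: is_iso_comp. Qed.

Lemma zero_from X Y (f : hom X Y) : is_zero X -> f = 0.
Proof. by move=> X0; rewrite -[f]comp_idr X0 comp0r. Qed.

Lemma zero_to X Y (f : hom X Y) : is_zero Y -> f = 0.
Proof. by move=> X0; rewrite -[f]comp_idl X0 comp0l. Qed.

Lemma isom_zero X Y : isom X Y -> is_zero X -> is_zero Y.
Proof. by move=> [f [g [_ fg]]] X0; rewrite /is_zero -fg (zero_to g X0) comp0r. Qed.

Definition retract X Y : Prop :=
  exists (i : hom X Y) (p : hom Y X), p \oc i = idm X.

Lemma retract_trans Y X Z : retract X Y -> retract Y Z -> retract X Z.
Proof.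
move=> [i [p pi]] [j [q qj]]; exists (j \oc i), (p \oc q).
by rewrite -comp_assoc (comp_assoc q) qj comp_idl pi.
Qed.

Lemma isom_retract X Y : isom X Y -> retract X Y.
Proof. by move=> [f [g [gf _]]]; exists f, g. Qed.

Lemma retract_refl X : retract X X.
Proof. exact: isom_retract (isom_refl X). Qed.

Lemma is_sum2_retract X Y Z : is_sum2 X Y Z -> retract X Z.
Proof. by move=> [i [_ [p [_ [pi _ _ _ _]]]]]; exists i, p. Qed.

Lemma is_sum2C X Y Z : is_sum2 X Y Z -> is_sum2 Y X Z.
Proof.
move=> [i [j [p [q [pi qj pj qi e]]]]]; exists j, i, q, p.
by split=> //; rewrite addrC.
Qed.

Lemma is_sum2_0 X Y Z : is_zero Z -> isom X Y -> is_sum2 X Z Y.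
Proof.
move=> Z0 [f [g [gf fg]]]; exists f, 0, g, 0.
by split; rewrite ?comp0l ?comp0r ?addr0// Z0.
Qed.

Lemma is_sum_retract n (F : 'I_n -> C) Z a : is_sum F Z -> retract (F a) Z.
Proof. by move=> [i [p [pi _ _]]]; exists (i a), (p a). Qed.

Lemma hom_isom X X' Y Y' : isom X X' -> isom Y Y' ->
  lin_iso (hom X Y) (hom X' Y').
Proof.
move=> [f [f' [f'f ff']]] [g [g' [g'g gg']]].
exists (fun h => g \oc h \oc f').
  by move=> a u v; rewrite compDr compDl compZr compZl.
exists (fun h => g' \oc h \oc f) => h.
  by rewrite !comp_assoc g'g comp_idl -comp_assoc f'f comp_idr.
by rewrite !comp_assoc gg' comp_idl -comp_assoc ff' comp_idr.
Qed.

Lemma hom_vanish_isom X X' Y Y' : isom X X' -> isom Y Y' ->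
  (forall f : hom X Y, f = 0) -> forall f : hom X' Y', f = 0.
Proof.
move=> eX eY XY f; have [phi lphi bphi] := hom_isom (isom_sym eX) (isom_sym eY).
by apply: (bij_inj bphi); rewrite (XY (phi f)) (XY (phi 0)).
Qed.

End Categories.

(** * Additive functors and quasi-inverses *)

Section Functors.
Variables (K : fieldType) (C D : lincat K) (F : functor C D).
Implicit Types X Y Z : C.

Lemma fmap0 X Y : fmap F (0 : hom X Y) = 0.
Proof. by apply: (addrI (fmap F 0)); rewrite -fmapD !addr0. Qed.

Lemma fmapN X Y (f : hom X Y) : fmap F (- f) = - fmap F f.
Proof. by apply: (addrI (fmap F f)); rewrite -fmapD !subrr fmap0. Qed.

Lemma fmap_iso X Y (f : hom X Y) : is_iso f -> is_iso (fmap F f).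
Proof.
move=> [g [gf fg]]; exists (fmap F g).
by rewrite -!fmap_comp gf fg !fmap_id.
Qed.

Lemma functor_isom X Y : isom X Y -> isom (F X) (F Y).
Proof. by move=> [f fi]; exists (fmap F f); exact: fmap_iso. Qed.

Lemma functor_zero X : is_zero X -> is_zero (F X).
Proof. by move=> X0; rewrite /is_zero -fmap_id X0 fmap0. Qed.

Lemma functor_retract X Y : retract X Y -> retract (F X) (F Y).
Proof.
by move=> [i [p pi]]; exists (fmap F i), (fmap F p); rewrite -fmap_comp pi fmap_id.
Qed.

End Functors.

Lemma iter_functor_isom (K : fieldType) (C : lincat K) (F : functor C C) n X Y :
  isom X Y -> isom (iter n F X) (iter n F Y).
Proof. by move=> XY; elim: n => //= n; exact: functor_isom. Qed.

Lemma iter_functor_retract (K : fieldType) (C : lincat K) (F : functor C C) n X Y :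
  retract X Y -> retract (iter n F X) (iter n F Y).
Proof. by move=> XY; elim: n => //= n; exact: functor_retract. Qed.

Lemma iter_functor_zero (K : fieldType) (C : lincat K) (F : functor C C) n X :
  is_zero X -> is_zero (iter n F X).
Proof. by move=> X0; elim: n => //= n; exact: functor_zero. Qed.

Lemma natiso_nat (K : fieldType) (C D : lincat K) (F G : functor C D)
    (e : natiso F G) X Y (f : hom X Y) (e' : hom (G X) (F X)) :
  e X \oc e' = idm _ -> fmap G f = e Y \oc fmap F f \oc e'.
Proof. by move=> ee'; rewrite (nt_nat e) -comp_assoc ee' comp_idr. Qed.

Section QuasiInverse.
Variables (K : fieldType) (C D : lincat K) (F : functor C D) (G : functor D C).

Lemma quasi_inverse_sym : quasi_inverse F G -> quasi_inverse G F.
Proof. by case. Qed.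

Lemma quasi_inverse_isom X : quasi_inverse F G -> isom (G (F X)) X.
Proof. by move=> [[e] _]; exists (e X); exact: (nt_iso e X). Qed.

Lemma quasi_inverse_faithful X Y (f g : hom X Y) : quasi_inverse F G ->
  fmap F f = fmap F g -> f = g.
Proof.
move=> [[e] _] Ffg; have [e' [e'e ee']] := nt_iso e X.
have := natiso_nat f ee'; have := natiso_nat g ee' => /=.
by rewrite Ffg => <- ->.
Qed.

End QuasiInverse.

(** The preimage is [fmap G g] conjugated by the natural isomorphism from G F to the identity; as
    [G] is faithful, the equation may be checked after applying [G]. *)
Lemma quasi_inverse_full (K : fieldType) (C D : lincat K) (F : functor C D)
    (G : functor D C) X Y (g : hom (F X) (F Y)) : quasi_inverse F G ->
  exists f : hom X Y, fmap F f = g.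
Proof.
move=> FG; have [[e] _] := FG.
have [e'X [e'eX ee'X]] := nt_iso e X; have [e'Y [e'eY ee'Y]] := nt_iso e Y.
exists (e Y \oc fmap G g \oc e'X).
apply: (quasi_inverse_faithful (quasi_inverse_sym FG)).
set f := _ \oc _ \oc _.
have /= := nt_nat e f; rewrite /f -(comp_assoc _ e'X) e'eX comp_idr.
move=> /(congr1 (fun x => e'Y \oc x)).
by rewrite !comp_assoc e'eY !comp_idl.
Qed.

Lemma quasi_inverse_reflect (K : fieldType) (C D : lincat K) (F : functor C D)
    (G : functor D C) X Y : quasi_inverse F G -> isom (F X) (F Y) -> isom X Y.
Proof.
move=> FG /(functor_isom G) e.
apply: isom_trans (isom_sym (quasi_inverse_isom X FG)) _.
exact: isom_trans e (quasi_inverse_isom Y FG).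
Qed.

(** * Exact triangles, shifts and thick subcategories *)

Section Triangles.
Variables (K : fieldType) (D : tricat K).
Implicit Types (P : set D) (X Y Z E F T : D).

Lemma sh_quasi : quasi_inverse (@sh K D) shV.
Proof. by split; constructor; [exact: sh_unit|exact: sh_counit]. Qed.

Lemma sh_inj X Y (f g : hom X Y) : fmap sh f = fmap sh g -> f = g.
Proof. exact: quasi_inverse_faithful sh_quasi. Qed.

Lemma sh_full X Y (g : hom (sh X) (sh Y)) : exists f, fmap sh f = g.
Proof. exact: quasi_inverse_full sh_quasi. Qed.

Lemma sh_reflect X Y : isom (sh X) (sh Y) -> isom X Y.
Proof. exact: quasi_inverse_reflect sh_quasi. Qed.

Lemma shVK X : isom (sh (shV X)) X.
Proof. exact: quasi_inverse_isom (quasi_inverse_sym sh_quasi). Qed.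

Lemma hom_sh X Y : lin_iso (hom X Y) (hom (sh X) (sh Y)).
Proof.
exists (fun f => fmap sh f); first exact: sh_linear.
have ex (g : hom (sh X) (sh Y)) := sh_full g.
exists (fun g => projT1 (cid (ex g))) => [f|g]; case: cid => //= f'.
exact: sh_inj.
Qed.

Lemma tri_comp0 X Y Z (f : hom X Y) (g : hom Y Z) h : tri f g h -> g \oc f = 0.
Proof.
move=> t; have [W W0] := tzero D.
have [|c [<- _]] := tri_fill (a := idm X) (b := f) (tri_id X W0) t.
  by [].
by rewrite comp0r.
Qed.

(** The rotated trivial triangle on [T] maps to the rotated given one with first component [u]; the
    filled arrow is the shift of the factorization, recovered by fullness of [sh]. *)
Lemma tri_exact_hom X Y Z (f : hom X Y) (g : hom Y Z) h T (u : hom T Y) :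
  tri f g h -> g \oc u = 0 -> exists v, f \oc v = u.
Proof.
move=> t gu; have [W W0] := tzero D.
have tT := tri_id T W0.
have [|c [_ ce]] := tri_fill (a := u) (b := 0) ((tri_rot _ _ _).1 tT) ((tri_rot _ _ _).1 t).
  by rewrite comp0l gu.
have [v vE] := sh_full c; exists v; apply: sh_inj.
move: ce; rewrite -vE fmap_id compNr comp_idr compNl fmap_comp => /oppr_inj ->.
by [].
Qed.

Lemma tri_exact_cohom X Y Z (f : hom X Y) (g : hom Y Z) h T (u : hom Y T) :
  tri f g h -> u \oc f = 0 -> exists v, v \oc g = u.
Proof.
move=> t uf; have [W W0] := tzero D.
have W1 : is_zero (sh W) by exact: functor_zero.
have tT : tri (0 : hom W T) (idm T) (0 : hom T (sh W)).
  by apply/tri_rot; rewrite fmap0 oppr0; exact: tri_id.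
have [|c [ce _]] := tri_fill (a := 0) (b := u) t tT.
  by rewrite uf comp0l.
by exists c; rewrite ce comp_idl.
Qed.

Lemma tri_comp0' X Y Z (f : hom X Y) (g : hom Y Z) h : tri f g h -> h \oc g = 0.
Proof. by move/tri_rot/tri_comp0. Qed.

Lemma tri_exact_hom' X Y Z (f : hom X Y) (g : hom Y Z) h T (u : hom T Z) :
  tri f g h -> h \oc u = 0 -> exists v, g \oc v = u.
Proof. by move=> /tri_rot; exact: tri_exact_hom. Qed.

Lemma tri_exact_cohom' X Y Z (f : hom X Y) (g : hom Y Z) h T (u : hom Z T) :
  tri f g h -> u \oc g = 0 -> exists v, v \oc h = u.
Proof. by move=> /tri_rot; exact: tri_exact_cohom. Qed.

(** Exactness at [X], stated after one shift so that no desuspension of [h] has to be chosen. *)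
Lemma tri_exact_hom_sh X Y Z (f : hom X Y) (g : hom Y Z) h T (u : hom T X) :
  tri f g h -> f \oc u = 0 -> exists v : hom (sh T) Z, h \oc v = fmap sh u.
Proof.
move=> /tri_rot/tri_rot t fu; apply: (tri_exact_hom t).
by rewrite compNl -fmap_comp fu fmap0 oppr0.
Qed.

(** The difference [c - idm Y] factors through [g] and is killed by [g], so its square is zero. *)
Lemma tri_endo_iso X Y Z (f : hom X Y) (g : hom Y Z) h (c : hom Y Y) :
  tri f g h -> c \oc f = f -> g \oc c = g -> is_iso c.
Proof.
move=> t cf gc; pose e := c - idm Y.
have [|u uE] := tri_exact_cohom (u := e) t; first by rewrite compBl cf comp_idl subrr.
have ee : e \oc e = 0.
  by rewrite -{1}uE -comp_assoc compBr gc comp_idr subrr comp0r.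
have cE : c = idm Y + e by rewrite addrC subrK.
move: (e) ee cE => {u uE}e ee ->.
exists (idm Y - e); split.
  by rewrite compBl !compDr !comp_idl comp_idr ee addr0 addrK.
by rewrite compDl !compBr !comp_idl comp_idr ee subr0 subrK.
Qed.

(** Fillers in the two directions need not be mutually inverse, but their composites fix the two
    maps adjacent to the third vertex, so [tri_endo_iso] makes them invertible. *)
Lemma tri_cone_iso X Y Z (f : hom X Y) (g : hom Y Z) h
    X' Y' Z' (f' : hom X' Y') (g' : hom Y' Z') h' (a : hom X X') (b : hom Y Y') :
  tri f g h -> tri f' g' h' -> is_iso a -> is_iso b -> b \oc f = f' \oc a ->
  isom Z Z'.
Proof.
move=> t t' [a' [a'a aa']] [b' [b'b bb']] e.
have [c [cg hc]] := tri_fill t t' e.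
have e' : b' \oc f' = f \oc a'.
  by rewrite -[f']comp_idr -aa' (comp_assoc f') -e !comp_assoc b'b comp_idl.
have [c' [c'g' hc']] := tri_fill t' t e'.
have [d dcc'] : is_iso (c' \oc c).
  apply: (tri_endo_iso ((tri_rot _ _ _).1 t)).
    by rewrite -comp_assoc cg comp_assoc c'g' -comp_assoc b'b comp_idr.
  by rewrite comp_assoc -hc' -comp_assoc -hc comp_assoc -fmap_comp a'a fmap_id comp_idl.
have [d' dc'c] : is_iso (c \oc c').
  apply: (tri_endo_iso ((tri_rot _ _ _).1 t')).
    by rewrite -comp_assoc c'g' comp_assoc cg -comp_assoc bb' comp_idr.
  by rewrite comp_assoc -hc -comp_assoc -hc' comp_assoc -fmap_comp aa' fmap_id comp_idl.
exists c; apply: (is_iso_right (g := c' \oc d') (h := d \oc c')).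
  by rewrite comp_assoc dc'c.2.
by rewrite -comp_assoc dcc'.1.
Qed.

(** The cone of [g] is desuspended through [shVK]; the sign on [f] compensates the one in
    [tri_rot]. *)
Lemma tri_fibre Y Z (g : hom Y Z) : exists X (f : hom X Y) h, tri f g h.
Proof.
have [W [k [l t]]] := tri_cone g.
have [u [v [vu uv]]] := isom_sym (shVK W).
have [f fE] := sh_full (l \oc v).
exists (shV W), (- f), (u \oc k); apply/tri_rot.
apply: (tri_iso (a := idm Y) (b := idm Z) (c := u) _ _ _ _ _ _ t).
- exact: is_iso_id.
- exact: is_iso_id.
- by exists v.
- by rewrite comp_idl comp_idr.
- by rewrite comp_idr.
- by rewrite fmap_id comp_idl fmapN opprK fE -comp_assoc vu comp_idr.
Qed.

(** Forgetting the maps makes triangles invariant under isomorphism of each vertex, so rotations and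
    shifts require no coherence between [sh] and [shV]. *)
Definition dist X Y Z : Prop := exists f g h, @tri K D X Y Z f g h.

Lemma dist_isom X Y Z X' Y' Z' : isom X X' -> isom Y Y' -> isom Z Z' ->
  dist X Y Z -> dist X' Y' Z'.
Proof.
move=> [a ai] [b bi] [c ci] [f [g [h t]]].
have [a' [a'a aa']] := ai; have [b' [b'b bb']] := bi; have [c' [c'c cc']] := ci.
exists (b \oc f \oc a'), (c \oc g \oc b'), (fmap sh a \oc h \oc c').
apply: (tri_iso ai bi ci _ _ _ t).
- by rewrite -(comp_assoc _ a') a'a comp_idr.
- by rewrite -(comp_assoc _ b') b'b comp_idr.
- by rewrite -(comp_assoc _ c') c'c comp_idr.
Qed.

Lemma dist_rot X Y Z : dist X Y Z <-> dist Y Z (sh X).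
Proof.
split=> [[f [g [h /tri_rot t]]]|[g [h [k t]]]]; first by do 3 eexists; exact: t.
have [f fE] := sh_full (- k); exists f, g, h; apply/tri_rot.
by rewrite fE opprK.
Qed.

Lemma dist_rotV X Y Z : dist X Y Z -> dist (shV Z) X Y.
Proof.
move=> t; apply/dist_rot; apply: dist_isom t; try exact: isom_refl.
exact/isom_sym/shVK.
Qed.

Lemma dist_sh X Y Z : dist X Y Z <-> dist (sh X) (sh Y) (sh Z).
Proof. by rewrite dist_rot dist_rot dist_rot. Qed.

Lemma dist_zero_id X Z : is_zero Z -> dist X X Z.
Proof. by move=> Z0; do 3 eexists; exact: tri_id Z0. Qed.

Lemma dist_zeroV Y Z X : is_zero X -> isom Y Z -> dist X Y Z.
Proof.
move=> X0 YZ; apply/dist_rot.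
apply: (dist_isom (isom_refl _) YZ (isom_refl _)).
by apply: dist_zero_id; exact: functor_zero.
Qed.

Lemma tri_zero_isom X Y Z (f : hom X Y) (g : hom Y Z) h :
  tri f g h -> is_zero Z -> is_iso f.
Proof.
move=> t Z0; have [|v fv] := tri_exact_hom (u := idm Y) t; first exact: zero_to.
have [|w wf] := tri_exact_hom_sh (u := v \oc f - idm X) t.
  by rewrite compBr comp_assoc fv comp_idl comp_idr subrr.
apply: (is_iso_right fv (h := v)); apply/subr0_eq/sh_inj.
by rewrite -wf (zero_to w Z0) comp0r fmap0.
Qed.

Lemma tri_iso_zero X Y Z (f : hom X Y) (g : hom Y Z) h :
  tri f g h -> is_iso f -> is_zero Z.
Proof.
move=> t [f' [f'f ff']].
have g0 : g = 0 by rewrite -[g]comp_idr -ff' comp_assoc (tri_comp0 t) comp0l.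
have [|v vh] := tri_exact_cohom' (u := idm Z) t; first by rewrite comp_idl.
have h0 : h = 0.
  have := tri_comp0 ((tri_rot _ _ _).1 ((tri_rot _ _ _).1 t)).
  move=> /(congr1 (fun x => fmap sh f' \oc x)).
  rewrite compNl compNr comp_assoc -fmap_comp f'f fmap_id comp_idl comp0r.
  by move/eqP; rewrite oppr_eq0 => /eqP.
by rewrite /is_zero -vh h0 comp0r.
Qed.

(* Exactness up to the choice of the last two maps of a triangle; unlike full
   exactness, it passes to a quasi-inverse without choosing compatible natural
   isomorphisms. *)
Definition tri_functor (F : functor D D) : Prop :=
  (forall X Y Z (f : hom X Y) (g : hom Y Z) h, tri f g h ->
    exists (g' : hom (F Y) (F Z)) h', tri (fmap F f) g' h') /\
  (forall X, isom (F (sh X)) (sh (F X))).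

Lemma tri_functor_dist (F : functor D D) X Y Z : tri_functor F ->
  dist X Y Z -> dist (F X) (F Y) (F Z).
Proof.
move=> [Ft _] [f [g [h t]]]; have [g' [h' t']] := Ft _ _ _ _ _ _ t.
by exists (fmap F f), g', h'.
Qed.

Lemma exact_tri_functor (F : exact_functor D D) : tri_functor F.
Proof.
split=> [X Y Z f g h /(ef_tri F) t|X]; first by do 2 eexists; exact: t.
by exists (ef_sh F X); exact: (nt_iso (ef_sh F) X).
Qed.

(** [F] sends the cone of [fmap G f] to a cone of an arrow isomorphic to [f], so this cone is
    isomorphic to [G Z]. *)
Lemma quasi_inverse_tri_functor (F G : functor D D) :
  tri_functor F -> quasi_inverse F G -> tri_functor G.
Proof.
move=> [Ft Fs] FG; have [_ [e]] := FG; split=> [X Y Z f g h t|X].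
  have [W [g' [h' t']]] := tri_cone (fmap G f).
  have [g'' [h'' t'']] := Ft _ _ _ _ _ _ t'.
  have WZ : isom (F W) Z.
    exact: (tri_cone_iso t'' t (nt_iso e X) (nt_iso e Y) (nt_nat e f)).
  have [w wi] : isom W (G Z).
    apply: isom_trans (functor_isom G WZ).
    exact/isom_sym/(quasi_inverse_isom W FG).
  have [w' [w'w ww']] := wi.
  exists (w \oc g'), (h' \oc w').
  apply: (tri_iso (a := idm _) (b := idm _) (c := w) _ _ _ _ _ _ t').
  - exact: is_iso_id.
  - exact: is_iso_id.
  - exact: wi.
  - by rewrite comp_idl comp_idr.
  - by rewrite comp_idr.
  - by rewrite fmap_id comp_idl -comp_assoc w'w comp_idr.
apply: isom_trans (quasi_inverse_isom (sh (G X)) FG).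
apply: functor_isom; apply/isom_sym; apply: isom_trans (Fs _) _.
exact: (functor_isom sh (quasi_inverse_isom X (quasi_inverse_sym FG))).
Qed.

Lemma shift_functor_isom k X Y : isom X Y -> isom (shift k X) (shift k Y).
Proof. by case: k => n; exact: iter_functor_isom. Qed.

Lemma shiftS k X : isom (shift (k + 1) X) (sh (shift k X)).
Proof.
case: k => [n|[|n]].
- by rewrite -PoszD addn1; exact: isom_refl.
- by rewrite NegzE addNr; exact/isom_sym/shVK.
- have -> : Negz n.+1 + 1 = Negz n by rewrite !NegzE -[n.+2]addn1 PoszD opprD addrNK.
  exact/isom_sym/shVK.
Qed.

Lemma shift_pred k X : isom (shift (k - 1) X) (shV (shift k X)).
Proof.
apply: sh_reflect; apply: isom_trans (isom_sym (shVK _)).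
by apply: isom_trans (isom_sym (shiftS _ _)) _; rewrite subrK; exact: isom_refl.
Qed.

Lemma shiftD k l X : isom (shift (k + l) X) (shift k (shift l X)).
Proof.
elim/int_ind_step: k => [|k IH|k IH]; first by rewrite add0r; exact: isom_refl.
  rewrite addrAC; apply: isom_trans (shiftS _ _) _.
  by apply: isom_trans (isom_sym (shiftS _ _)); exact: functor_isom.
apply: sh_reflect; apply: isom_trans (isom_sym (shiftS _ _)) _.
by rewrite addrAC; apply: isom_trans IH (shiftS _ _).
Qed.

Lemma shift_shKV k X : isom (shift (- k) (shift k X)) X.
Proof. by apply: isom_trans (isom_sym (shiftD _ _ _)) _; rewrite addNr; exact: isom_refl. Qed.

Lemma tri_functor_shift (F : functor D D) k X : tri_functor F ->
  isom (F (shift k X)) (shift k (F X)).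
Proof.
move=> [_ Fs]; elim/int_ind_step: k => [|k IH|k IH]; first exact: isom_refl.
  apply: isom_trans (functor_isom F (shiftS _ _)) _.
  apply: isom_trans (Fs _) _; apply: isom_trans (isom_sym (shiftS _ _)).
  exact: functor_isom.
apply: sh_reflect; apply: isom_trans (isom_sym (Fs _)) _.
apply: isom_trans (functor_isom F (isom_sym (shiftS _ _))) _.
exact: isom_trans IH (shiftS _ _).
Qed.

Lemma dist_shift k X Y Z : dist X Y Z -> dist (shift k X) (shift k Y) (shift k Z).
Proof.
move=> t; elim/int_ind_step: k => [//|k IH|k IH].
  by apply: dist_isom ((dist_sh _ _ _).1 IH); exact/isom_sym/shiftS.
by apply/dist_sh; apply: dist_isom IH; exact: shiftS.
Qed.

Lemma retract_shift k X Y : retract X Y -> retract (shift k X) (shift k Y).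
Proof. by case: k => n; exact: iter_functor_retract. Qed.

Lemma shift_zero k X : is_zero X -> is_zero (shift k X).
Proof.
by case: k => n; exact: iter_functor_zero.
Qed.

Lemma hom_shift j k X Y : lin_iso (hom (shift j X) (shift k Y)) (hom X (shift (k - j) Y)).
Proof.
elim/int_ind_step: j k => [|j IH|j IH] k.
- by rewrite subr0; exists id => //; exists id.
- apply: lin_iso_trans (hom_isom (shiftS _ _) (isom_refl _)) _.
  have e : isom (shift k Y) (sh (shift (k - 1) Y)).
    by apply: isom_trans (shiftS _ _); rewrite subrK; exact: isom_refl.
  apply: lin_iso_trans (hom_isom (isom_refl _) e) _.
  apply: lin_iso_trans (lin_iso_sym (hom_sh _ _)) _.
  by rewrite [j + 1]addrC opprD addrA; exact: IH.
- apply: lin_iso_trans (hom_sh _ _) _.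
  apply: lin_iso_trans (hom_isom (isom_sym (shiftS _ _)) (isom_sym (shiftS _ _))) _.
  have -> : k - j = (k + 1) - (j + 1) by rewrite opprD addrACA subrr addr0.
  exact: IH.
Qed.

Lemma hom_shift_vanish j k X Y : (forall f : hom X (shift (k - j) Y), f = 0) ->
  forall f : hom (shift j X) (shift k Y), f = 0.
Proof.
have [phi lphi bphi] := hom_shift j k X Y.
by move=> h f; apply: (bij_inj bphi); rewrite (h (phi f)) (h (phi 0)).
Qed.

(** The complement is the cone of the split monomorphism [i], whose connecting map vanishes because
    [fmap sh p] splits [fmap sh i]. *)
Lemma retract_sum2 X Y : retract X Y -> exists Z, is_sum2 X Z Y.
Proof.
move=> [i [p pi]]; have [Z [q [h t]]] := tri_cone i.
have sh0 := tri_comp0 ((tri_rot _ _ _).1 ((tri_rot _ _ _).1 t)).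
have h0 : h = 0.
  have := congr1 (fun x => fmap sh p \oc x) sh0.
  rewrite compNl compNr comp_assoc -fmap_comp pi fmap_id comp_idl comp0r.
  by move/eqP; rewrite oppr_eq0 => /eqP.
have [|j0 qj0] := tri_exact_hom' (u := idm Z) t; first by rewrite h0 comp0l.
have qi := tri_comp0 t.
(* The section of [q] is corrected so that [p] kills it. *)
pose j := j0 - i \oc p \oc j0.
have qj : q \oc j = idm Z by rewrite compBr !comp_assoc qi !comp0l subr0 qj0.
have pj : p \oc j = 0 by rewrite compBr !comp_assoc pi comp_idl subrr.
exists Z, i, j, p, q; split=> //.
have [|v vE] := tri_exact_hom (u := idm Y - i \oc p - j \oc q) t.
  by rewrite !compBr !comp_assoc qi comp0l subr0 qj comp_idl comp_idr subrr.
have : v = 0.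
  rewrite -[v]comp_idl -pi -comp_assoc vE !compBr !comp_assoc pi pj comp0l.
  by rewrite comp_idl comp_idr subr0 subrr.
move=> v0; move: vE; rewrite v0 comp0r => /esym/eqP.
by rewrite subr_eq0 subr_eq addrC => /eqP <-.
Qed.

Lemma thick_isom P X Y : thick P -> isom X Y -> P X -> P Y.
Proof.
move=> [_ _ _ Ps] XY PX; have [W W0] := tzero D.
exact: Ps (is_sum2_0 W0 (isom_sym XY)) PX.
Qed.

Lemma thick_retract P X Y : thick P -> retract X Y -> P Y -> P X.
Proof. by move=> [_ _ _ Ps] /retract_sum2[Z /Ps]. Qed.

Lemma thick_shift P k X : thick P -> P X -> P (shift k X).
Proof.
move=> [_ Psh _ _] PX; case: k => n; first by elim: n => //= n /Psh[].
by elim: n => [|n IH]; [have [] := Psh _ PX|have [] := Psh _ IH].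
Qed.

Lemma thick_dist P X Y Z : thick P -> dist X Y Z -> P X -> P Z -> P Y.
Proof.
move=> tP /dist_rotV [f [g [h t]]] PX PZ; have [_ Psh Pt _] := tP.
by apply: Pt t _ PX; exact: (Psh _ _).2.
Qed.

Lemma thick_dist3 P X Y Z : thick P -> dist X Y Z -> P X -> P Y -> P Z.
Proof. by move=> [_ _ Pt _] [f [g [h t]]]; exact: Pt t. Qed.

Lemma smallest_thick (G : set D) : thick (smallest (@thick K D) G).
Proof.
split=> [X X0|X PX|X Y Z f g h t PX PY|X Y Z s PZ].
- by move=> P [[Pz _ _ _] _]; exact: Pz.
- by split=> P [tP GP]; have [_ Psh _ _] := tP; have [] := Psh _ (PX _ (conj tP GP)).
- by move=> P [tP GP]; have [_ _ Pt _] := tP; apply: Pt t _ _; [exact: PX|exact: PY].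
- by move=> P [tP GP]; have [_ _ _ Ps] := tP; apply: Ps s _; exact: PZ.
Qed.

Lemma split_generatorP P E : split_generator P E <->
  [/\ thick P, P E & forall Q, thick Q -> Q E -> P `<=` Q].
Proof.
split=> [<-|[tP PE minP]].
  split; first exact: smallest_thick.
    by move=> Q [_]; apply.
  by move=> Q tQ QE X; apply; split=> // _ ->.
apply/seteqP; split=> X; first by apply; split=> // _ ->.
by move=> PX Q [tQ QE]; apply: minP PX => //; exact: QE.
Qed.

End Triangles.

(** * Filtrations and complexity *)

Section Filtrations.
Variables (K : fieldType) (D : tricat K).
Implicit Types (P : set D) (X Y Z E F G : D).

(** [Y'] is the preimage in [Y] of the step [Z'] of a filtration of [Z]; it comes from the
    octahedron on [Y -> Z -> E]. *)
Lemma dist_octa X Y Z Z' E : dist X Y Z -> dist Z' Z E ->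
  exists2 Y', dist Y' Y E & dist X Y' Z'.
Proof.
move=> [f [g [h t]]] [d [e [c t']]].
have [V [k [k' t'']]] := tri_cone (e \oc g).
have [u [v [tV _ _ _]]] := tri_octa ((tri_rot _ _ _).1 t) ((tri_rot _ _ _).1 t') t''.
exists (shV V); first by apply: dist_rotV; do 3 eexists; exact: t''.
apply/dist_sh; apply: (dist_isom (isom_refl _) (isom_sym (shVK V)) (isom_refl _)).
by do 3 eexists; exact: tV.
Qed.

(** Two rotations reduce this to [tri_fill]; the filled arrow is then desuspended and the signs
    cancel. *)
Lemma tri_fill2 X Y Z (f : hom X Y) (g : hom Y Z) h
    X' Y' Z' (f' : hom X' Y') (g' : hom Y' Z') h' (a : hom X X') (c : hom Z Z') :
  tri f g h -> tri f' g' h' -> fmap sh a \oc h = h' \oc c ->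
  exists b, b \oc f = f' \oc a /\ g' \oc b = c \oc g.
Proof.
move=> /tri_rot/tri_rot t /tri_rot/tri_rot t' e.
have [b' [b'f cg]] := tri_fill t t' e.
have [b bE] := sh_full b'; exists b; rewrite -bE in b'f cg.
split; apply: sh_inj; rewrite !fmap_comp.
  by move: b'f; rewrite compNr compNl => /oppr_inj.
by move: cg; rewrite compNr compNl => /oppr_inj.
Qed.

(* Bordering the connecting map by the two retractions gives a triangle over
   X', Z' having the given one as a retract: the induced endomorphism of Y
   restricts to the identity of X and Z, so it is the identity plus a nilpotent
   endomorphism. *)
Lemma dist_retract X Y Z X' Z' : dist X Y Z -> retract X X' -> retract Z Z' ->
  exists2 Y', dist X' Y' Z' & retract Y Y'.
Proof.
move=> [f [g [h t]]] [i [p pi]] [j [q qj]].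
have [Y' [g' [v t']]] := tri_fibre (fmap sh i \oc h \oc q).
have [f' fE] := sh_full (- v).
have {v t' fE}t' : tri f' g' (fmap sh i \oc h \oc q).
  by apply/tri_rot; rewrite fE opprK.
exists Y'; first by do 3 eexists; exact: t'.
have [|b [bf gb]] := tri_fill2 (a := i) (c := j) t t'.
  by rewrite -!comp_assoc qj comp_idr.
have [|b' [bf' gb']] := tri_fill2 (a := p) (c := q) t' t.
  by rewrite !comp_assoc -fmap_comp pi fmap_id comp_idl.
have [c [cb _]] : is_iso (b' \oc b).
  apply: (tri_endo_iso t).
    by rewrite -comp_assoc bf comp_assoc bf' -comp_assoc pi comp_idr.
  by rewrite comp_assoc gb' -comp_assoc gb comp_assoc qj comp_idl.
by exists b, (c \oc b'); rewrite -comp_assoc.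
Qed.

Lemma filtration_inv P s X : filtration P s X ->
  [/\ s = [::], P X & is_zero X] \/ exists s' E Y,
  [/\ s = rcons s' E, filtration P s' Y, dist Y X E, P X & P E].
Proof.
case=> [{}X PX X0|{}s Y {}X E f g h fs PX PE t]; first by left.
by right; exists s, E, Y; split=> //; exists f, g, h.
Qed.

Lemma filtration_nil P X : filtration P [::] X -> P X /\ is_zero X.
Proof. by case/filtration_inv=> [[]//|[[|? ?] [? [? [+ _ _ _ _]]]]]. Qed.

Lemma filtration_rcons P s E X : filtration P (rcons s E) X ->
  exists Y, [/\ filtration P s Y, dist Y X E, P X & P E].
Proof.
case/filtration_inv=> [[+ _ _]|[s' [E' [Y [e fs t PX PE]]]]]; first by case: s.
by move: e fs t PE => /rcons_inj[-> ->]; exists Y.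
Qed.

Lemma filtration_step P s Y X E : filtration P s Y -> dist Y X E -> P X -> P E ->
  filtration P (rcons s E) X.
Proof. by move=> fs [f [g [h t]]] PX PE; exact: FiltrationS t. Qed.

Lemma filtration_in P s X : filtration P s X -> P X.
Proof. by case. Qed.

Lemma filtration_isom P s X Y : thick P -> isom X Y -> filtration P s X ->
  filtration P s Y.
Proof.
move=> tP XY; case/lastP: s => [|s E].
  move=> /filtration_nil[PX X0]; apply: Filtration0; last exact: isom_zero X0.
  exact: thick_isom PX.
move=> /filtration_rcons[W [fs t PX PE]].
apply: (filtration_step fs) => //; last exact: thick_isom PX.
exact: dist_isom (isom_refl _) XY (isom_refl _) t.
Qed.

(** The filtration of [Z] is pulled back to [Y] step by step with [dist_octa] and placed on top of
    that of [X]. *)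
Lemma filtration_cat P s s' X Y Z : thick P -> dist X Y Z -> filtration P s X ->
  filtration P s' Z -> filtration P (s ++ s') Y.
Proof.
move=> tP + fX fZ; elim/last_ind: s' Z Y fZ => [|s' E IH] Z Y.
  move=> /filtration_nil[_ Z0] [f [g [h t]]]; rewrite cats0.
  by apply: filtration_isom fX => //; exists f; exact: tri_zero_isom t Z0.
move=> /filtration_rcons[Z' [fs t' PZ PE]] t.
have [Y' tY tY'] := dist_octa t t'.
rewrite -rcons_cat; apply: (filtration_step (IH _ _ fs tY')) => //.
exact: thick_dist t (filtration_in fX) PZ.
Qed.

Lemma filtration_map P (F : D -> D) s X : (forall X, P X -> P (F X)) ->
  (forall X, is_zero X -> is_zero (F X)) ->
  (forall X Y Z, dist X Y Z -> dist (F X) (F Y) (F Z)) ->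
  filtration P s X -> filtration P (map F s) (F X).
Proof.
move=> PF F0 Fd; elim/last_ind: s X => [|s E IH] X.
  by move=> /filtration_nil[PX X0]; apply: Filtration0; [exact: PF|exact: F0].
move=> /filtration_rcons[Y [fs t PX PE]]; rewrite map_rcons.
by apply: (filtration_step (IH _ fs)); [exact: Fd|exact: PF|exact: PF].
Qed.

Lemma filtration_isoms P (I : Type) (e e' : I -> D) s X : thick P ->
  (forall i, isom (e i) (e' i)) ->
  filtration P (map e s) X -> filtration P (map e' s) X.
Proof.
move=> tP ee'; elim/last_ind: s X => [//|s i IH] X; rewrite !map_rcons.
move=> /filtration_rcons[Y [fs t PX PE]].
apply: (filtration_step (IH _ fs)) => //; last exact: thick_isom (ee' i) PE.
exact: dist_isom (isom_refl _) (isom_refl _) (ee' i) t.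
Qed.

Definition cost P E (ks : seq int) F : Prop :=
  exists2 X, retract F X & filtration P [seq shift k E | k <- ks] X.

Lemma cost_in P E ks F : thick P -> cost P E ks F -> P F.
Proof. by move=> tP [X FX /filtration_in]; exact: thick_retract. Qed.

Lemma cost_zero P E F : thick P -> is_zero F -> cost P E [::] F.
Proof.
move=> tP F0; exists F; first exact: retract_refl.
by apply: Filtration0 => //; have [Pz _ _ _] := tP; exact: Pz.
Qed.

Lemma cost_retract P E ks F G : retract F G -> cost P E ks G -> cost P E ks F.
Proof. by move=> FG [X GX fX]; exists X => //; exact: retract_trans GX. Qed.

Lemma cost_base P E k : thick P -> P E -> cost P E [:: k] (shift k E).
Proof.
move=> tP PE; exists (shift k E); first exact: retract_refl.
have [W W0] := tzero D; have PS := thick_shift k tP PE.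
have [Pz _ _ _] := tP.
apply: (filtration_step (Filtration0 (Pz _ W0) W0) (s := [::]) _ PS PS).
exact: dist_zeroV W0 (isom_refl _).
Qed.

Lemma cost_cat P E s s' X Y Z : thick P -> dist X Y Z -> cost P E s X ->
  cost P E s' Z -> cost P E (s ++ s') Y.
Proof.
move=> tP t [X' XX' fX] [Z' ZZ' fZ].
have [Y' t' YY'] := dist_retract t XX' ZZ'.
by exists Y' => //; rewrite map_cat; exact: filtration_cat t' fX fZ.
Qed.

Lemma cost_shift P E ks F j : thick P -> cost P E ks F ->
  cost P E [seq j + k | k <- ks] (shift j F).
Proof.
move=> tP [X FX fX]; exists (shift j X); first exact: retract_shift.
rewrite -map_comp.
apply: (filtration_isoms (e := fun k => shift j (shift k E))) => //.
  by move=> k /=; exact/isom_sym/shiftD.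
rewrite (map_comp (shift j) (fun k => shift k E)).
apply: filtration_map fX => [Y|Y|Y Z W].
- exact: thick_shift.
- exact: shift_zero.
- exact: dist_shift.
Qed.

Lemma cost_functor P E ks F (H : functor D D) : thick P -> tri_functor H ->
  preserves P H -> cost P E ks F -> cost P (H E) ks (H F).
Proof.
move=> tP tH PH [X FX fX]; exists (H X); first exact: functor_retract.
apply: (filtration_isoms (e := fun k => H (shift k E))) => //.
  by move=> k; exact: tri_functor_shift.
rewrite (map_comp H (fun k => shift k E)).
apply: filtration_map fX => // [Y|Y Z W]; first exact: functor_zero.
exact: tri_functor_dist.
Qed.

Lemma cost_iter P E ks F (H : functor D D) n : thick P -> tri_functor H ->
  preserves P H -> cost P E ks F -> cost P (iter n H E) ks (iter n H F).
Proof. by move=> tP tH PH c; elim: n => //= n; exact: cost_functor. Qed.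

(** Each factor [shift k F] is, up to retract, filtered by the shifts [k + l] of [E]. Gluing these
    is the source of the submultiplicativity of [delta]. *)
Lemma cost_trans P E F G ls ks : thick P -> cost P E ls F -> cost P F ks G ->
  cost P E [seq k + l | k <- ks, l <- ls] G.
Proof.
move=> tP cF [X GX fX]; apply: (cost_retract GX) => {GX}.
elim/last_ind: ks X fX => [|ks k IH] X.
  by move=> /filtration_nil[PX X0]; exact: cost_zero.
rewrite map_rcons => /filtration_rcons[Y [fs t PX PE]].
rewrite -cats1 map_cat flatten_cat /= cats0.
by apply: (cost_cat tP t); [exact: IH|exact: cost_shift].
Qed.

(** Objects admitting a cost form a thick subcategory containing [E]. *)
Lemma split_generator_cost P E F : split_generator P E -> P F ->
  exists ks, cost P E ks F.
Proof.
move=> /split_generatorP[tP PE minP] PF.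
have : [set F | exists ks, cost P E ks F] F; last by [].
apply: minP PF => //; last by exists [:: 0]; exact: (cost_base 0 tP PE).
have shc j X : (exists ks, cost P E ks X) -> exists ks, cost P E ks (shift j X).
  by move=> [ks c]; eexists; exact: cost_shift c.
split=> [X X0|X cX|X Y Z f g h t cX [s' cY]|X Y Z s [ks c]].
- by exists [::]; exact: cost_zero.
- by split; [exact: (shc 1)|exact: (shc (-1))].
- have [s c] := shc 1 _ cX; exists (s' ++ s).
  apply: cost_cat cY c => //; apply: (dist_rot X Y Z).1.
  by exists f, g, h.
- by exists ks; apply: cost_retract c; exact: is_sum2_retract s.
Qed.

Lemma cost_split_generator P E : thick P -> P E ->
  (forall F, P F -> exists ks, cost P E ks F) -> split_generator P E.
Proof.
move=> tP PE gen; apply/split_generatorP; split=> // Q tQ QE F /gen[ks [X FX]].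
move=> fX; apply: (thick_retract tQ FX) => {FX F}.
elim/last_ind: ks X fX => [|ks k IH] X.
  by move=> /filtration_nil[_ X0]; have [Qz _ _ _] := tQ; exact: Qz.
rewrite map_rcons => /filtration_rcons[Y [fs t _ _]].
by apply: (thick_dist tQ t); [exact: IH|exact: thick_shift].
Qed.

End Filtrations.

(** * The complexity as an infimum of weights *)

Section Complexity.
Variables (R : realType) (K : fieldType) (D : tricat K).
Variable (P : set D) (t : R).
Hypothesis tP : thick P.
Implicit Types (X Y Z E F G : D) (ks ls : seq int).

Definition weight ks : R := \sum_(k <- ks) expR (k%:~R * t).

Lemma weight_ge0 ks : 0 <= weight ks.
Proof. by apply: sumr_ge0 => k _; exact: expR_ge0. Qed.

Lemma weight_pairs ks ls :
  weight [seq k + l | k <- ks, l <- ls] = weight ls * weight ks.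
Proof.
rewrite /weight big_allpairs_dep /= big_distrr /=; apply: eq_bigr => k _.
rewrite mulrC big_distrr /=; apply: eq_bigr => l _.
by rewrite intrD mulrDl expRD.
Qed.

Lemma deltaE E F : delta P t E F =
  ereal_inf [set (weight ks)%:E | ks in [set ks | cost P E ks F]].
Proof.
(* The value 0 imposed on zero objects agrees with the infimum, thanks to the empty filtration. *)
rewrite /delta; case: asboolP => [F0|nF0].
  apply/eqP; rewrite eq_le; apply/andP; split.
    by apply/ereal_infP => _ [ks _ <-]; rewrite lee_fin weight_ge0.
  apply: ereal_inf_lbound; exists [::]; first exact: cost_zero.
  by rewrite /weight big_nil.
congr (ereal_inf (_ @` _)); apply/seteqP; split=> ks /=.
  by move=> [F' [X [PF' s fX]]]; exists X => //; exact: is_sum2_retract s.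
move=> [X FX fX]; have [F' s] := retract_sum2 FX; exists F', X; split=> //.
by have [_ _ _ Ps] := tP; apply: (Ps _ _ _ (is_sum2C s)); exact: filtration_in fX.
Qed.

Lemma delta_ge0 E F : (0 <= delta P t E F)%E.
Proof.
by rewrite deltaE; apply/ereal_infP => _ [ks _ <-]; rewrite lee_fin weight_ge0.
Qed.

Lemma delta_le E F ks : cost P E ks F -> (delta P t E F <= (weight ks)%:E)%E.
Proof. by move=> c; rewrite deltaE; apply: ereal_inf_lbound; exists ks. Qed.

Lemma delta_fin E F : split_generator P E -> P F -> delta P t E F \is a fin_num.
Proof.
move=> gE /(split_generator_cost gE)[ks c].
rewrite ge0_fin_numE ?delta_ge0//; exact: le_lt_trans (delta_le c) (ltry _).
Qed.

(** The bound passes through the infimum after division by [a]; for [a = 0] the given cost yields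
    [x <= 0] directly. *)
Lemma le_mul_delta E F (a : R) (x : \bar R) : 0 <= a -> (exists ks, cost P E ks F) ->
  (forall ks, cost P E ks F -> x <= (a * weight ks)%:E)%E ->
  (x <= a%:E * delta P t E F)%E.
Proof.
rewrite le_eqVlt => /predU1P[<-|a0] [ks0 c0] xle.
  by rewrite mul0e; have := xle _ c0; rewrite mul0r.
rewrite -lee_pdivrMl// deltaE; apply/ereal_infP => _ [ks c <-].
by rewrite lee_pdivrMl// -EFinM; exact: xle.
Qed.

Lemma delta_mul E F G : split_generator P E -> P F -> (exists ks, cost P F ks G) ->
  (delta P t E G <= delta P t E F * delta P t F G)%E.
Proof.
move=> gE PF cG; have /fineK dE := delta_fin gE PF.
rewrite -dE; apply: le_mul_delta => //; first by rewrite fine_ge0// delta_ge0.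
move=> ks c; rewrite mulrC EFinM dE; apply: le_mul_delta.
- exact: weight_ge0.
- exact: split_generator_cost.
- move=> ls c'; rewrite mulrC -weight_pairs.
  exact: delta_le (cost_trans tP c' c).
Qed.

Lemma delta_iter E F (H : functor D D) n : split_generator P E -> P F ->
  tri_functor H -> preserves P H ->
  (delta P t (iter n H E) (iter n H F) <= delta P t E F)%E.
Proof.
move=> gE PF tH PH; rewrite [leRHS]deltaE; apply/ereal_infP => _ [ks c <-].
exact/delta_le/cost_iter.
Qed.

(** The upper bound common to both sides: [h] will be each of the two graded sums of Hom
    dimensions. *)
Lemma cost_le E F ks (h : D -> \bar R) : P E -> (forall X, 0 <= h X)%E ->
  (forall X, is_zero X -> h X = 0)%E ->
  (forall X Y Z, P X -> P Y -> P Z -> dist X Y Z -> h Y <= h X + h Z)%E ->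
  (forall X Y, P X -> P Y -> retract X Y -> h X <= h Y)%E ->
  (forall k, h (shift k E) <= (expR (k%:~R * t))%:E * h E)%E ->
  cost P E ks F -> (h F <= (weight ks)%:E * h E)%E.
Proof.
move=> PE h0 hz hD hr hs c; have PF := cost_in tP c; case: c => X FX fX.
apply: (le_trans (hr _ _ PF (filtration_in fX) FX)) => {FX PF F}.
elim/last_ind: ks X fX => [|ks k IH] X.
  by move=> /filtration_nil[_ X0]; rewrite hz// mule_ge0// lee_fin weight_ge0.
rewrite map_rcons => /filtration_rcons[Y [fs d PX PEk]].
apply: le_trans (hD _ _ _ (filtration_in fs) PX PEk d) _.
rewrite /weight -cats1 big_cat big_seq1 EFinD ge0_muleDl ?lee_fin ?weight_ge0 ?expR_ge0//.
by apply: leeD; [exact: IH|exact: hs].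
Qed.

End Complexity.

(** * Exponential growth rates *)

Section Growth.
Variable R : realType.
Implicit Types (u v w : nat -> \bar R) (a : nat -> R).

Definition dominated u v : Prop :=
  exists2 C : R, 0 < C & forall N, (u N <= C%:E * v N)%E.

Lemma dominated_trans v u w : dominated u v -> dominated v w -> dominated u w.
Proof.
move=> [C C0 uv] [B B0 vw]; exists (C * B); first exact: mulr_gt0.
move=> N; apply: le_trans (uv N) _; rewrite EFinM -muleA.
by rewrite lee_pmul2l.
Qed.

Lemma dominated_le u v : (forall N, u N <= v N)%E -> dominated u v.
Proof. by move=> uv; exists 1 => // N; rewrite mul1e. Qed.

Lemma dominated_growth u v : (forall N, 0 <= v N)%E -> dominated u v ->
  exists2 c : R, 0 <= c &
    forall N, (log_growth u N <= log_growth v N + (N%:R^-1 * c)%:E)%E.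
Proof.
move=> v0 [C C0 uv]; exists `|ln C| => // N.
have lnle : (lne (u N) <= lne (v N) + `|ln C|%:E)%E.
  (* Where [u N] vanishes its logarithm is -oo and nothing has to be bounded. *)
  have [uN|uN] := leP (u N) 0%E; first by rewrite le0_lneNy// leNye.
  have vN : (0 < v N)%E.
    rewrite lt_neqAle v0 andbT; apply: contraTneq (uv N) => <-.
    by rewrite mule0 -ltNge.
  have Cv : (0 < C%:E * v N)%E by rewrite mule_gt0.
  apply: (@le_trans _ _ (lne (C%:E * v N))%E).
    by rewrite lee_lne ?in_itv/= ?leey ?andbT// ltW.
  have -> : lne (C%:E * v N) = ((ln C)%:E + lne (v N))%E.
    rewrite -lne_EFin//; apply: lneM; rewrite in_itv/= leey andbT// lte_fin.
  by rewrite addeC leeD2l// lee_fin ler_norm.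
rewrite /log_growth EFinM -muleDr//; last exact: fin_num_adde_defl.
by apply: lee_wpmul2l => //; rewrite lee_fin invr_ge0.
Qed.

(** The errors c/N are finite and tend to 0, so the squeeze also works for an infinite limit. *)
Lemma log_growth_cvg u v (h : \bar R) : (forall N, 0 <= u N)%E -> (forall N, 0 <= v N)%E ->
  dominated u v -> dominated v u -> log_growth v @ \oo --> h ->
  log_growth u @ \oo --> h.
Proof.
move=> u0 v0 /(dominated_growth v0)[c c0 uv] /(dominated_growth u0)[b b0 vu] vh.
have small (d : R) : (fun N => (N%:R^-1 * d)%:E) @ \oo --> (0 : \bar R).
  apply: cvg_EFin; first by near=> N.
  have pos : \forall N \near \oo, (0 : R) < N%:R.
    by near=> N; rewrite ltr0n; near: N; exact: nbhs_infty_gt.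
  have inv0 : (fun N : nat => (N%:R : R)^-1) @ \oo --> (0 : R).
    exact: ((gtr0_cvgV0 pos).2 cvgr_idn).
  by rewrite -(mul0r d); apply: cvgM => //; exact: cvg_cst.
apply: (@squeeze_cvge _ _ _ _ (fun N => log_growth v N + (N%:R^-1 * - b)%:E)%E
   _ (fun N => log_growth v N + (N%:R^-1 * c)%:E)%E).
- near=> N; rewrite uv andbT mulrN EFinN leeBlDr//; exact: vu.
- rewrite -[h]adde0; apply: cvgeD => //; exact: fin_num_adde_defl.
- rewrite -[h]adde0; apply: cvgeD => //; exact: fin_num_adde_defl.
Unshelve. all: by end_near. Qed.

Lemma subadd_mul a m q r : (forall m n, a (m + n)%N <= a m + a n) ->
  a (q * m + r)%N <= q%:R * a m + a r.
Proof.
move=> sub; elim: q => [|q IH]; first by rewrite mul0n mul0r add0r.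
rewrite mulSn -addnA; apply: le_trans (sub _ _) _.
by rewrite -natr1 mulrDl mul1r addrAC [leRHS]addrC lerD2l.
Qed.

Lemma fekete_upper a m l : (forall m n, a (m + n)%N <= a m + a n) ->
  (0 < m)%N -> m%:R^-1 * a m < l -> \forall n \near \oo, n%:R^-1 * a n <= l.
Proof.
move=> sub m0 aml.
(* For a remainder [r = n %% m], the sum bounds [a r] and the last term bounds the missing fraction
   [r / m] of [a m]. *)
pose b := \sum_(r < m) `|a r| + `|a m|.
have m0' : (0 : R) < m%:R by rewrite ltr0n.
have bound n : a n <= n%:R * (m%:R^-1 * a m) + b.
  rewrite {1}(divn_eq n m); apply: le_trans (subadd_mul _ _ _ sub) _.
  have rm : (n %% m < m)%N by rewrite ltn_mod.
  have -> : n%:R = (n %/ m)%:R * m%:R + (n %% m)%:R :> R.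
    by rewrite -natrM -natrD -divn_eq.
  rewrite mulrDl -mulrA (mulrA m%:R) divff ?gt_eqF// mul1r -addrA lerD2l.
  have : a (n %% m)%N <= \sum_(r < m) `|a r|.
    apply: le_trans (ler_norm _) _.
    by rewrite (bigD1 (Ordinal rm))//= lerDl sumr_ge0.
  have : 0 <= (n %% m)%:R * (m%:R^-1 * a m) + `|a m|.
    rewrite mulrA -lerBlDr sub0r.
    apply: (@le_trans _ _ (- `|(n %% m)%:R / m%:R * a m|)); last exact: lerNnormlW.
    rewrite lerN2 normrM ler_piMl// ger0_norm ?divr_ge0// ler_pdivrMr// mul1r.
    by rewrite ler_nat ltnW.
  by rewrite /b; lra.
near=> n.
have n0 : (0 : R) < n%:R by rewrite ltr0n; near: n; exact: nbhs_infty_gt.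
rewrite ler_pdivrMl//.
apply: le_trans (bound n) _; rewrite -lerBrDl -mulrBr.
rewrite -ler_pdivrMr ?subr_gt0//.
by near: n; exact: nbhs_infty_ger.
Unshelve. all: by end_near. Qed.

(** The limit is the infimum of [a n / n] over [n > 0]; it may be -oo, as [a] has no lower bound. *)
Lemma fekete a : (forall m n, a (m + n)%N <= a m + a n) ->
  exists h : \bar R, (fun n => (n%:R^-1 * a n)%:E) @ \oo --> h.
Proof.
move=> sub.
pose S := [set (n%:R^-1 * a n)%:E | n in [set n | (0 < n)%N]].
have upper l : (ereal_inf S < l%:E)%E -> \forall n \near \oo, n%:R^-1 * a n <= l.
  move=> /ereal_inf_lt[_ [m m0 <-]]; rewrite lte_fin => ml.
  exact: fekete_upper ml.
have lower n : (0 < n)%N -> (ereal_inf S <= (n%:R^-1 * a n)%:E)%E.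
  by move=> n0; apply: ereal_inf_lbound; exists n.
exists (ereal_inf S).
case E : (ereal_inf S) upper lower => [r| |] upper lower.
- apply: cvg_EFin; first by near=> n.
  apply/cvgrPdist_le => e e0; near=> n.
  rewrite ler_distlC; apply/andP; split.
    have /lower : (0 < n)%N by near: n; exact: nbhs_infty_gt.
    by rewrite lee_fin; apply: le_trans; rewrite gerBl ltW.
  by near: n; apply: upper; rewrite lte_fin ltrDl.
- have := lower 1%N isT; rewrite leye_eq => /eqP. by [].
- apply/cvgeNyPle => A; near=> n; rewrite lee_fin.
  by near: n; apply: upper; exact: ltNyr.
Unshelve. all: by end_near. Qed.

Lemma log_growth_submul u : (forall N, 0 <= u N)%E -> (forall N, u N \is a fin_num) ->
  (forall m n, u (m + n)%N <= u m * u n)%E ->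
  exists h : \bar R, log_growth u @ \oo --> h.
Proof.
move=> u0 ufin sub.
(* A zero value forces all later values to vanish and the limit to be -oo; otherwise the logarithms
   form a real subadditive sequence. *)
have [[m um]|/forallNP nz] := pselect (exists m, u m = 0%E).
  exists -oo%E; apply: cvg_near_cst; near=> N.
  have uN : u N = 0%E.
    apply/eqP; rewrite eq_le u0 andbT.
    have mN : (m <= N)%N by near: N; exact: nbhs_infty_ge.
    by rewrite -(subnKC mN) (le_trans (sub _ _))// um mul0e.
  rewrite /log_growth uN le0_lneNy// gt0_muleNy// lte_fin invr_gt0 ltr0n.
  by near: N; exact: nbhs_infty_gt.
have upos N : 0 < fine (u N).
  rewrite fine_gt0// ltey_eq ufin andbT lt_neqAle u0 andbT.
  by apply/eqP => /esym; exact: nz.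
have [|h hP] := @fekete (fun N => ln (fine (u N))).
  move=> m n; rewrite -lnM ?posrE// ler_ln ?posrE ?mulr_gt0//.
  by rewrite -lee_fin EFinM !fineK.
exists h; apply: cvg_trans hP; apply: near_eq_cvg; near=> N.
by rewrite /log_growth -[u N]fineK// lne_EFin// EFinM.
Unshelve. all: by end_near. Qed.

End Growth.

(** * Existence of the entropy and independence of the generator *)

Section Entropies.
Variables (R : realType) (K : fieldType) (D : tricat K).
Variables (P : set D) (t : R) (H : functor D D).
Hypotheses (tH : tri_functor H) (PH : preserves P H).
Implicit Types (E F G : D).

Lemma preserves_iter E n : P E -> P (iter n H E).
Proof. by move=> PE; elim: n => //= n; exact: PH. Qed.

(** Inserting [iter m H E] between [E] and [iter (m + n) H E], and transporting filtrations by the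
    m-th iterate of [H], gives submultiplicativity. *)
Lemma entropy_cvg E : split_generator P E ->
  exists h : \bar R, log_growth (fun N => delta P t E (iter N H E)) @ \oo --> h.
Proof.
move=> gE; have [tP PE _] := (split_generatorP _ _).1 gE.
apply: log_growth_submul => [N|N|m n].
- exact: delta_ge0.
- by apply: delta_fin => //; exact: preserves_iter.
- have [ks c] := split_generator_cost gE (preserves_iter n PE).
  rewrite iterD; apply: le_trans (delta_mul t tP gE (preserves_iter m PE) _) _.
    by exists ks; exact: cost_iter.
  apply: lee_wpmul2l; first exact: delta_ge0.
  by apply: delta_iter => //; exact: preserves_iter.
Qed.

Lemma delta_dominated_l E G (X : nat -> D) : split_generator P E ->
  split_generator P G -> (forall N, P (X N)) ->
  dominated (fun N => delta P t E (X N)) (fun N => delta P t G (X N)).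
Proof.
move=> gE gG PX; have [tP PE _] := (split_generatorP _ _).1 gE.
have [_ PG _] := (split_generatorP _ _).1 gG.
(* The added 1 keeps the constant positive, as [dominated] requires. *)
exists (fine (delta P t E G) + 1); first by rewrite ltr_wpDl// fine_ge0// delta_ge0.
move=> N /=; apply: le_trans (delta_mul t tP gE PG (split_generator_cost gG (PX N))) _.
apply: lee_wpmul2r; first exact: delta_ge0.
by rewrite -[leLHS]fineK ?delta_fin// lee_fin lerDl.
Qed.

Lemma delta_dominated_r E F G : split_generator P E -> split_generator P F ->
  P G -> dominated (fun N => delta P t E (iter N H G)) (fun N => delta P t E (iter N H F)).
Proof.
move=> gE gF PG; have [tP PE _] := (split_generatorP _ _).1 gE.
have [_ PF _] := (split_generatorP _ _).1 gF.
exists (fine (delta P t F G) + 1); first by rewrite ltr_wpDl// fine_ge0// delta_ge0.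
move=> N /=; have [ks c] := split_generator_cost gF PG.
apply: le_trans (delta_mul t tP gE (preserves_iter N PF) _) _.
  by exists ks; exact: cost_iter.
rewrite muleC; apply: lee_wpmul2r; first exact: delta_ge0.
apply: (@le_trans _ _ (delta P t F G)); first exact: delta_iter.
by rewrite -[leLHS]fineK ?delta_fin// lee_fin lerDl.
Qed.

Lemma is_entropyP E (h : \bar R) : split_generator P E ->
  log_growth (fun N => delta P t E (iter N H E)) @ \oo --> h -> is_entropy P H t h.
Proof.
move=> gE hE; split=> [|G gG]; first by exists E.
have [tP PE _] := (split_generatorP _ _).1 gE.
have [_ PG _] := (split_generatorP _ _).1 gG.
apply: log_growth_cvg hE => [N|N||]; do ?exact: delta_ge0.
- apply: (dominated_trans (v := fun N => delta P t E (iter N H G))).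
    by apply: delta_dominated_l => // N; exact: preserves_iter.
  exact: delta_dominated_r.
- apply: (dominated_trans (v := fun N => delta P t G (iter N H E))).
    by apply: delta_dominated_l => // N; exact: preserves_iter.
  exact: delta_dominated_r.
Qed.

Lemma log_growth_entropy E G (h : \bar R) (u : nat -> \bar R) : split_generator P E ->
  split_generator P G -> is_entropy P H t h -> (forall N, 0 <= u N)%E ->
  dominated u (fun N => delta P t E (iter N H G)) ->
  dominated (fun N => delta P t E (iter N H G)) u ->
  log_growth u @ \oo --> h.
Proof.
move=> gE gG [_ hP] u0 ud du.
have [tP PE _] := (split_generatorP _ _).1 gE.
have [_ PG _] := (split_generatorP _ _).1 gG.
apply: log_growth_cvg (hP E gE) => //; first by move=> N; exact: delta_ge0.
- by apply: (dominated_trans ud); exact: delta_dominated_r.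
- by apply: dominated_trans du; exact: delta_dominated_r.
Qed.

End Entropies.

(** * Hearts and silting objects *)

Lemma exists_eigenvector (K : closedFieldType) (V : lmodType K) (T : V -> V) (v0 : V) :
  linear T -> finite_dim V -> v0 != 0 -> exists a v, v != 0 /\ T v = a *: v.
Proof.
move=> lT fV v0n; have := dim_gt0 fV v0n.
case: (finite_dimP fV); set m := dim V => phi lphi [psi phiK psiK] m0.
have lpsi := linear_can lphi phiK psiK.
have [A AE] := linear_mx (linear_comp lphi (linear_comp lT lpsi)).
have [|a] := closed_rootP (char_poly A) _; first by rewrite size_char_poly; lia.
rewrite -eigenvalue_root_char => /eigenvalueP[r rA r0].
have [p0 _ _ _] := linear_raddf lpsi; have [_ _ _ phiZ] := linear_raddf lphi.
exists a, (psi r); split; first by rewrite -p0 (inj_eq (can_inj psiK)).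
by apply: (can_inj phiK); rewrite phiZ psiK -[LHS]/((phi \o (T \o psi)) r) AE.
Qed.

(* In End(X) = Im (e^n) + Ker (e^n) the identity splits as x + y with x
   idempotent, so x = 0 or y = 0. *)
Lemma indecomposable_endo (K : fieldType) (C : lincat K) (X : C) (e : hom X X) :
  idempotent_complete C -> indecomposable X -> finite_dim (hom X X) ->
  exists2 n, (0 < n)%N & iter n (fun u => e \oc u) (idm X) = 0 \/
    exists z, iter n (fun u => e \oc u) z = idm X.
Proof.
move=> ic [_ ind] fd.
have [n [n0 /(_ (idm X))[z] + inj]] := fitting (comp_linl e (X := X)) fd.
set T := fun u : hom X X => e \oc u in inj *.
have TC (u v : hom X X) : iter n T (u \oc v) = iter n T u \oc v.
  by elim: (n) => //= m ->; rewrite /T comp_assoc.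
set x := iter n T z => Ty; set y := idm X - x in Ty.
have xy : x \oc y = y \oc x by rewrite compBr compBl comp_idl comp_idr.
have xy0 : x \oc y = 0.
  rewrite -TC; apply: inj; rewrite TC -/x xy TC Ty; exact: comp0l.
have xx : x \oc x = x.
  by move: xy0; rewrite compBr comp_idr => /subr0_eq.
have yy : y \oc y = y by rewrite {1}/y compBl comp_idl xy0 subr0.
have [Y [r [s [sr rs]]]] := ic _ _ xx; have [Y' [r' [s' [sr' rs']]]] := ic _ _ yy.
have rs'0 : r \oc s' = 0.
  rewrite -[s']comp_idr -rs' (comp_assoc s') sr' -[r]comp_idl -rs -(comp_assoc r) sr.
  by rewrite -(comp_assoc r) (comp_assoc x) xy0 comp0l comp0r.
have r's0 : r' \oc s = 0.
  rewrite -[s]comp_idr -rs (comp_assoc s) sr -[r']comp_idl -rs' -(comp_assoc r') sr'.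
  by rewrite -(comp_assoc r') (comp_assoc y) -xy xy0 comp0l comp0r.
have : is_sum2 Y Y' X.
  by exists s, s', r, r'; split=> //; rewrite sr sr' addrC subrK.
exists n => //; case: (ind _ _ H) => [Y0|Y0].
  left; have x0 : x = 0 by rewrite -sr (zero_from s Y0) comp0l.
  by move: Ty; rewrite /y x0 subr0.
right; exists z; apply/esym/subr0_eq.
by rewrite -/y -sr' (zero_from s' Y0) comp0l.
Qed.

(** * Cohomology, simple objects and resolutions detected by Hom(M, -) *)

Section Heart.
Variables (K : closedFieldType) (D : tricat K) (M : D).
Implicit Types (X Y Z E F T C : D) (k : int).

(** For the t-structure attached to [M], this is the vanishing of the cohomology of [E] in degree
    [k]. *)
Definition van E k : Prop := forall f : hom M (shift k E), f = 0.

Hypothesis fdM : forall E, finite_dim (hom M E).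
Hypothesis orth : forall X Y (f : hom X (shV Y)), (forall k, 0 < k -> van X k) ->
  (forall k, k < 0 -> van Y k) -> f = 0.
Hypothesis trunc : forall E, exists X Y,
  [/\ forall k, 0 < k -> van X k, forall k, k < 0 -> van Y k & dist X E (shV Y)].

Lemma van_isom E F k : isom E F -> van E k -> van F k.
Proof.
move=> EF; apply: hom_vanish_isom; first exact: isom_refl.
exact: shift_functor_isom.
Qed.

Lemma van_shift E j k : van (shift j E) k <-> van E (k + j).
Proof.
split; apply: hom_vanish_isom; try exact: isom_refl.
  exact/isom_sym/shiftD.
exact: shiftD.
Qed.

Lemma van_sh E k : van (sh E) k <-> van E (k + 1).
Proof. exact: (van_shift E 1 k). Qed.

Lemma van_shV E k : van (shV E) k <-> van E (k - 1).
Proof. exact: (van_shift E (-1) k). Qed.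

Lemma van_hom_shM E : (forall f : hom (sh M) E, f = 0) <-> van E (-1).
Proof.
have [phi lphi bphi] := hom_shift 1 0 M E.
have [phi0 _ _ _] := linear_raddf lphi.
split=> h f.
  by have [psi phiK psiK] := bphi; rewrite -[f]psiK (h (psi f)) phi0.
by apply: (bij_inj bphi); rewrite (h (phi f)) (h (phi 0)).
Qed.

Lemma van_dist X Y Z k : dist X Y Z -> van X k -> van Z k -> van Y k.
Proof.
move=> /(dist_shift k)[f [g [h t]]] vX vZ u.
have [|v <-] := tri_exact_hom (u := u) t; first exact: vZ.
by rewrite (vX v) comp0r.
Qed.

Lemma van_dist3 X Y Z k : dist X Y Z -> van Y k -> van X (k + 1) -> van Z k.
Proof. by move=> /dist_rot t vY vX; apply: van_dist t vY _; apply/van_sh. Qed.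

Lemma van_dist1 X Y Z k : dist X Y Z -> van Y k -> van Z (k - 1) -> van X k.
Proof. by move=> /dist_rotV t vY vZ; apply: van_dist t _ vY; apply/van_shV. Qed.

Lemma van_retract E F k : retract E F -> van F k -> van E k.
Proof.
move=> /(retract_shift k)[i [p pi]] vF f.
by rewrite -[f]comp_idl -pi -comp_assoc (vF (i \oc f)) comp0r.
Qed.

Lemma trunc_at E j : exists X Y,
  [/\ forall k, j <= k -> van X k, forall k, k < j -> van Y k & dist X E Y].
Proof.
have [X [Y [vX vY t]]] := trunc (shift (j - 1) E).
exists (shift (1 - j) X), (shift (1 - j) (shV Y)); split=> [k jk|k kj|].
- by apply/van_shift/vX; lia.
- by apply/van_shift/van_shV/vY; lia.
- apply: dist_isom (dist_shift (1 - j) t); try exact: isom_refl.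
  by rewrite -opprB; exact: shift_shKV.
Qed.

Lemma orth_hom X Y j (f : hom X Y) : (forall k, j <= k -> van X k) ->
  (forall k, k < j -> van Y k) -> f = 0.
Proof.
move=> vX vY; move: f.
have o : forall g : hom (shift (j - 1) X) (shV (shift j Y)), g = 0.
  move=> g; apply: orth => k hk; apply/van_shift; [apply: vX|apply: vY]; lia.
have : forall g : hom (shift (j - 1) X) (shift (j - 1) Y), g = 0.
  apply: hom_vanish_isom o; first exact: isom_refl.
  exact/isom_sym/shift_pred.
move=> o' f; have [phi lphi bphi] := lin_iso_sym (hom_shift (j - 1) (j - 1) X Y).
have [psi phiK psiK] := bphi; have {}psiK := can_inj phiK.
have e : (j - 1) - (j - 1) = 0 by rewrite subrr.
move: phi lphi bphi psi phiK psiK; rewrite e => phi lphi bphi psi phiK inj.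
by apply: inj; rewrite (o' (phi f)) (o' (phi 0)).
Qed.

Lemma van_zero E : (forall k, van E k) -> is_zero E.
Proof. by move=> vE; apply: (@orth_hom E E 0). Qed.

Definition in_heart E : Prop := forall k, k != 0 -> van E k.

Lemma heart_zero E : in_heart E -> van E 0 -> is_zero E.
Proof.
by move=> hE vE; apply: van_zero => k; have [->|/hE] := eqVneq k 0.
Qed.

(** Together with [hom_surj], this replaces monomorphisms and epimorphisms of the heart, so that
    kernels and cokernels need not be constructed in general. *)
Definition hom_inj X Y (f : hom X Y) : Prop := forall u : hom M X, f \oc u = 0 -> u = 0.
Definition hom_surj X Y (f : hom X Y) : Prop :=
  forall v : hom M Y, exists u : hom M X, f \oc u = v.

Lemma hom_surj_cone X Y Z (f : hom X Y) (g : hom Y Z) h : tri f g h ->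
  van Z 0 -> hom_surj f.
Proof. by move=> t vZ v; apply: (tri_exact_hom t); exact: (vZ (g \oc v)). Qed.

Lemma hom_surj_cone2 X Y Z (f : hom X Y) (g : hom Y Z) h : tri f g h ->
  van X 1 -> hom_surj g.
Proof. by move=> /tri_rot t vX; apply: (hom_surj_cone t); apply/van_sh. Qed.

Lemma hom_inj_cone X Y Z (f : hom X Y) (g : hom Y Z) h : tri f g h ->
  van Z (-1) -> hom_inj f.
Proof.
move=> t /van_hom_shM vZ u /(tri_exact_hom_sh t)[v vE].
by apply: sh_inj; rewrite -vE (vZ v) comp0r fmap0.
Qed.

Lemma hom_inj_van_cone X Y Z (f : hom X Y) (g : hom Y Z) h : tri f g h ->
  hom_inj f -> van Y (-1) -> van Z (-1).
Proof.
move=> t inj /van_hom_shM vY; apply/van_hom_shM => u.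
have [v vE] := sh_full (h \oc u).
have v0 : v = 0.
  apply/inj/sh_inj; rewrite fmap_comp vE comp_assoc.
  have := tri_comp0 ((tri_rot _ _ _).1 ((tri_rot _ _ _).1 t)).
  rewrite compNl => /eqP; rewrite oppr_eq0 => /eqP ->.
  by rewrite comp0l fmap0.
have [|w <-] := tri_exact_hom' (u := u) t; first by rewrite -vE v0 fmap0.
by rewrite (vY w) comp0r.
Qed.

(** The cone has cohomology at most in degrees -1 and 0, where it is the kernel and the cokernel of
    [f]. *)
Lemma heart_iso Y X (f : hom Y X) : in_heart Y -> in_heart X -> hom_inj f ->
  hom_surj f -> is_iso f.
Proof.
move=> hY hX inj surj; have [C [g [h t]]] := tri_cone f.
apply: (tri_zero_isom t); apply: van_zero => k.
have d : dist Y X C by exists f, g, h.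
have [->|km1] := eqVneq k (-1).
  by apply: (hom_inj_van_cone t inj); exact: hX.
have [->|k0] := eqVneq k 0; last first.
  by apply: (van_dist3 d); [exact: hX|apply: hY; lia].
move=> u; have [|v <-] := tri_exact_hom' (u := u) t.
  by have /van_sh : van Y (0 + 1) by [apply: hY]; apply.
by have [w <-] := surj v; rewrite comp_assoc (tri_comp0 t) comp0l.
Qed.

Variable H : set D.
Hypothesis HE : forall E, H E <-> in_heart E.

(** [mono_in] only tests maps out of objects of the heart, so the kernel is produced there: it is
    the truncation [N] of the fibre of [f], through which every [u] killed by [f] factors. *)
Lemma mono_hom_inj Y X (f : hom Y X) : in_heart Y -> in_heart X -> mono_in H f ->
  hom_inj f.
Proof.
move=> hY hX mono u fu.
have [C [c [h t]]] := tri_fibre f.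
have d : dist C Y X by exists c, f, h.
have [N [Q [vN vQ [a [b [b' t']]]]]] := trunc_at C 1.
have hN : in_heart N.
  move=> k k0; have [k1|k1] := ltP k 1; last exact: vN.
  apply: (van_dist1 (Y := C) (Z := Q)); first by exists a, b, b'.
    by apply: (van_dist1 d); [exact: hY|apply: hX; lia].
  by apply: vQ; lia.
have ca0 : c \oc a = 0.
  by apply: mono; [exact/HE|rewrite comp_assoc (tri_comp0 t) comp0l].
have [v vE] := tri_exact_hom t fu.
have [|w wE] := tri_exact_hom (u := v) t'; first exact: (vQ 0).
by rewrite -vE -wE comp_assoc ca0 comp0l.
Qed.

(* The image of f is the fibre of T -> H^0(cone f), a subobject of T. *)
Lemma simple_cone F T C (f : hom F T) (g : hom T C) h : simple_in H T ->
  (forall k, 0 < k -> van F k) -> f != 0 -> tri f g h -> forall k, 0 <= k -> van C k.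
Proof.
move=> [/HE hT nT sT] vF f0 t.
have d : dist F T C by exists f, g, h.
have vC k : 0 < k -> van C k.
  by move=> k0; apply: (van_dist3 d); [apply: hT|apply: vF]; lia.
have [C1 [C2 [vC1 vC2 [p [q [r t']]]]]] := trunc_at C 0.
have d' : dist C1 C C2 by exists p, q, r.
have hC2 : in_heart C2.
  move=> k k0; have [kn|kp] := ltP k 0; first exact: vC2.
  by apply: (van_dist3 d'); [apply: vC|apply: vC1]; lia.
have [I [i [j ti]]] := tri_fibre (q \oc g).
have di : dist I T C2 by exists i, (q \oc g), j.
have hI : in_heart I.
  move=> k k0; have [->|k1] := eqVneq k 1; last first.
    by apply: (van_dist1 di); [exact: hT|apply: hC2; lia].
  (* Degree 1 vanishes because Hom(M, T) maps onto Hom(M, C2): a map to [C2] lifts to [C], then to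
     [T]. *)
  move=> x; have [|y yE] := tri_exact_hom (u := x) ((tri_rot _ _ _).1 ((tri_rot _ _ _).1 ti)).
    by rewrite compNl (_ : fmap sh i \oc x = 0) ?oppr0//; exact: (hT 1).
  have [z zE] := hom_surj_cone2 t' (vC1 1 isT) y.
  have [w wE] := hom_surj_cone2 t (vF 1 isT) z.
  by rewrite -yE -zE -wE (comp_assoc q) comp_assoc (tri_comp0' ti) comp0l.
have mi : mono_in H i.
  move=> Z z /HE hZ /(tri_exact_hom_sh ti)[v vE]; apply: sh_inj.
  rewrite -vE fmap0 (orth_hom (j := 0) v) ?comp0r// => k k0.
  by apply/van_sh/hZ; lia.
(* If [I] is zero then so is [f], which factors through [i]; if [i] is invertible then [C2] is
   zero. *)
case: (sT _ i ((HE _).2 hI) mi) => [I0|ii].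
  have [|w wE] := tri_exact_hom (u := f) ti.
    by rewrite -comp_assoc (tri_comp0 t) comp0r.
  by move/eqP: f0; rewrite -wE (zero_from i I0) comp0l.
have C20 := tri_iso_zero ti ii.
move=> k k0; apply: (van_dist d'); first exact: vC1.
by move=> u; apply: zero_to; exact: shift_zero.
Qed.

Lemma simple_surj F T (f : hom F T) : simple_in H T ->
  (forall k, 0 < k -> van F k) -> f != 0 -> hom_surj f.
Proof.
move=> sT vF f0; have [C [g [h t]]] := tri_cone f.
exact: (hom_surj_cone t (simple_cone sT vF f0 t (lexx 0))).
Qed.

(** Degree 1 is the delicate one: there the fibre could inherit cohomology from degree 0 of the
    cone, which [simple_cone] excludes. *)
Lemma simple_fibre W F T (w : hom W F) (f : hom F T) h : simple_in H T ->
  (forall k, 0 < k -> van F k) -> f != 0 -> tri w f h -> forall k, 0 < k -> van W k.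
Proof.
move=> sT vF f0 /tri_rot t k k0.
by rewrite -(subrK 1 k); apply/van_sh/(simple_cone sT vF f0 t); lia.
Qed.

(** By [simple_fibre] the fibre [W] of [c] lies in the heart and is its kernel. Simplicity of [T]
    leaves two cases, and [w] invertible would give [c = 0]. *)
Lemma simple_schur T T' (c : hom T T') : simple_in H T -> simple_in H T' ->
  c != 0 -> is_iso c.
Proof.
move=> sT sT' c0; have [/HE hT _ subT] := sT; have [/HE hT' _ _] := sT'.
have vT k : 0 < k -> van T k by move=> k0; apply: hT; lia.
have [W [w [h t]]] := tri_fibre c.
have vW := simple_fibre sT' vT c0 t.
have hW : in_heart W.
  move=> k k0; have [kp|kn] := ltP 0 k; first exact: vW.
  apply: (van_dist1 (Y := T) (Z := T')); first by exists w, c, h.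
    exact: hT.
  by apply: hT'; lia.
have mw : mono_in H w.
  move=> Z z /HE hZ /(tri_exact_hom_sh t)[v vE]; apply: sh_inj.
  rewrite -vE fmap0 (orth_hom (j := 0) v) ?comp0r// => k k0.
    by apply/van_sh/hZ; lia.
  by apply: hT'; lia.
case: (subT _ w ((HE _).2 hW) mw) => [W0|[w' [_ ww']]].
  by apply: (tri_zero_isom ((tri_rot _ _ _).1 t)); exact: functor_zero.
by move/eqP: c0; rewrite -[c]comp_idr -ww' comp_assoc (tri_comp0 t) comp0l.
Qed.

Lemma simple_hom_neq0 T : simple_in H T -> exists u : hom M T, u != 0.
Proof.
move=> [/HE hT nT _]; apply: contrapT => /forallNP no; apply: nT.
apply: heart_zero => // u; apply/eqP/negP => u0.
by apply: (no u); apply/negP.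
Qed.

(** An eigenvector of [c] is found in Hom(M, T), whose dimension is finite; [c - a *: idm T] kills
    it, so it is not invertible and vanishes by Schur's lemma. *)
Lemma simple_endo T (c : hom T T) : simple_in H T -> exists a, c = a *: idm T.
Proof.
move=> sT; have [u0 u0n] := simple_hom_neq0 sT.
have [a [u [un cu]]] := exists_eigenvector (comp_linl c (X := M)) (fdM T) u0n.
exists a; apply/eqP; rewrite -subr_eq0; apply: contraT => n0.
have [c' [c'c _]] := simple_schur sT sT n0.
move/eqP: un => []; rewrite -[u]comp_idl -c'c -comp_assoc compBl cu compZl.
by rewrite comp_idl subrr comp0r.
Qed.

(* A subobject of H^0(E) of minimal nonzero dimension of Hom(M, -) is simple. *)
Lemma simple_sub E : (forall k, k < 0 -> van E k) -> ~ van E 0 ->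
  exists T (f : hom T E), simple_in H T /\ hom_inj f.
Proof.
move=> vE nE.
have [|n [T [f [hT inj dT n0]]] nmin] := @nat_min (fun n => exists T (f : hom T E),
    [/\ in_heart T, hom_inj f, dim (hom M T) = n & (0 < n)%N]).
  have [X [Y [vX vY [f [g [h t]]]]]] := trunc_at E 1.
  have d : dist X E Y by exists f, g, h.
  exists (dim (hom M X)), X, f; split=> //.
  - move=> k k0; have [kp|kn] := ltP 0 k; first exact: vX.
    by apply: (van_dist1 d); [apply: vE|apply: vY]; lia.
  - by apply: (hom_inj_cone t); apply: vY.
  - rewrite lt0n; apply/eqP => /(dim_eq0 (fdM X)) X0; apply: nE.
    by apply: (van_dist d); [exact: X0|exact: (vY 0)].
have nT : ~ is_zero T.
  move=> T0; have [_] := @zero_dim _ (hom M T) (fun u => zero_to u T0).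
  by rewrite dT => e; rewrite e in n0.
exists T, f; split=> //; split=> //; first exact/HE.
move=> Y y /HE hY my; have yinj := mono_hom_inj hY hT my.
have [Y0|Y1] := posnP (dim (hom M Y)).
  by left; apply: heart_zero => //; exact: (dim_eq0 (fdM Y)).
right; apply: heart_iso => //; apply: contrapT => /existsNP[v /forallNP nv].
have : (dim (hom M Y) < n)%N.
  rewrite -dT; apply: (dim_inj_lt (comp_linl y (X := M))) => //; last by exists v.
  move=> a b e; apply/subr0_eq/yinj; rewrite compBr; apply/eqP; rewrite subr_eq0.
  exact/eqP.
rewrite ltnNge nmin//; exists Y, (f \oc y); split=> // u.
by rewrite -comp_assoc => /inj/yinj.
Qed.

(** Dual to [simple_sub]: a quotient of the degree 0 cohomology with Hom(M, -) of minimal nonzero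
    dimension is simple, since the cokernel of a proper nonzero subobject would be smaller. *)
Lemma simple_quotient F : (forall k, 0 < k -> van F k) -> ~ van F 0 ->
  exists T (f : hom F T), simple_in H T /\ hom_surj f.
Proof.
move=> vF nF.
have [|n [T [f [hT surj dT n0]]] nmin] := @nat_min (fun n => exists T (f : hom F T),
    [/\ in_heart T, hom_surj f, dim (hom M T) = n & (0 < n)%N]).
  have [X [Y [vX vY [f [g [h t]]]]]] := trunc_at F 0.
  have d : dist X F Y by exists f, g, h.
  exists (dim (hom M Y)), Y, g; split=> //.
  - move=> k k0; have [kp|kn] := leP 0 k; last exact: vY.
    by apply: (van_dist3 d); [apply: vF|apply: vX]; lia.
  - by apply: (hom_surj_cone2 t); apply: vX.
  - rewrite lt0n; apply/eqP => /(dim_eq0 (fdM Y)) Y0; apply: nF.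
    by apply: (van_dist d); [exact: (vX 0)|exact: Y0].
have nT : ~ is_zero T.
  move=> T0; have [_] := @zero_dim _ (hom M T) (fun u => zero_to u T0).
  by rewrite dT => e; rewrite e in n0.
exists T, f; split=> //; split=> //; first exact/HE.
move=> Y y /HE hY my; have yinj := mono_hom_inj hY hT my.
have [Y0|[u0 u0n]] : van Y 0 \/ exists u : hom M Y, u != 0.
  have [|] := pselect (exists u : hom M Y, u != 0); first by right.
  move=> /forallNP no; left=> u; apply/eqP/negP => un.
  by apply: (no u); apply/negP.
  by left; exact: heart_zero.
right; have [C [g [h t]]] := tri_cone y.
have d : dist Y T C by exists y, g, h.
have hC : in_heart C.
  move=> k k0; have [->|k1] := eqVneq k (-1).
    by apply: (hom_inj_van_cone t yinj); exact: hT.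
  by apply: (van_dist3 d); [exact: hT|apply: hY; lia].
have gsurj : hom_surj g by apply: (hom_surj_cone2 t); exact: hY.
have : (dim (hom M C) < n)%N.
  rewrite -dT; apply: (dim_surj_lt (comp_linl g (X := M))) => //.
  exists (y \oc u0); last by rewrite comp_assoc (tri_comp0 t) comp0l.
  by apply: contra_neq u0n; exact: yinj.
have [C0 _|C1] := posnP (dim (hom M C)).
  apply: (tri_zero_isom t); apply: heart_zero => //.
  exact: (dim_eq0 (fdM C)).
rewrite ltnNge nmin//; exists C, (g \oc f); split=> // v.
have [w <-] := gsurj v; have [u <-] := surj w; exists u.
by rewrite comp_assoc.
Qed.

Lemma retract_lift X F T (f : hom F T) (v : hom X T) : retract X M -> hom_surj f ->
  exists p, f \oc p = v.
Proof.
move=> [i [q qi]] surj; have [w wE] := surj (v \oc q).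
by exists (w \oc i); rewrite comp_assoc wE -comp_assoc qi comp_idr.
Qed.

Hypothesis silt : forall k, 0 < k -> van M k.
Hypothesis ic : idempotent_complete D.

(** If [v'] is nonzero on the fibre [W] of [v], it lifts through [W] and yields [e] with
    [v \oc e = 0] and [v' \oc e = v']. Such an [e] is neither nilpotent nor right invertible, which
    [indecomposable_endo] forbids. *)
Lemma top_unique X T T' (v : hom X T) (v' : hom X T') : retract X M ->
  indecomposable X -> simple_in H T -> simple_in H T' -> v != 0 -> v' != 0 ->
  exists c, v' = c \oc v.
Proof.
move=> XM indX sT sT' v0 v'0.
have vX k : 0 < k -> van X k by move=> k0; apply: van_retract XM _; exact: silt.
have [W [w [h t]]] := tri_fibre v.
have vW := simple_fibre sT vX v0 t.
have [v'w|v'w] := eqVneq (v' \oc w) 0.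
  by have [c <-] := tri_exact_cohom t v'w; exists c.
exfalso.
have [s sE] := retract_lift v' XM (simple_surj sT' vW v'w).
pose e := w \oc s.
have ve : v \oc e = 0 by rewrite comp_assoc (tri_comp0 t) comp0l.
have v'e : v' \oc e = v' by rewrite comp_assoc sE.
have fdX : finite_dim (hom X X).
  have [i [p pi]] := XM.
  apply: (dim_inj (comp_linr p (Z := X)) _ (fdM X)).1 => a b /(congr1 (fun x => x \oc i)).
  by rewrite -!comp_assoc pi !comp_idr.
have [[//|n] _ [nil|[z zE]]] := indecomposable_endo e ic indX fdX.
- move/eqP: v'0; apply.
  have it m : v' \oc iter m (fun u => e \oc u) (idm X) = v'.
    by elim: m => [|m IH]; rewrite /= ?comp_idr// comp_assoc v'e.
  by rewrite -(it n.+1) nil comp0r.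
- by move/eqP: v0; apply; rewrite -[v]comp_idr -zE /= comp_assoc ve comp0l.
Qed.

Variables (n : nat) (S_ : 'I_n -> D) (S : D).
Hypothesis hS_ : complete_simples H S_.
Hypothesis hS : is_sum S_ S.

Lemma sum_in_heart : in_heart S.
Proof.
move=> k k0; have [i [p [_ _ e]]] := hS; have [sS _ _] := hS_.
(* The shift is moved to the source, so that [idm S] can be expanded over the summands without
   shifting the decomposition. *)
have v0 a : forall f : hom (shift (- k) M) (S_ a), f = 0.
  move=> f; apply: (@hom_shift_vanish _ _ (- k) 0); rewrite sub0r opprK.
  by have [/HE + _ _] := sS a; apply.
have vS : forall f : hom (shift (- k) M) S, f = 0.
  move=> f; rewrite -[f]comp_idl -e.
  pose F : {linear hom S S -> hom (shift (- k) M) S} :=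
    HB.pack (fun g => g \oc f) (GRing.isLinear.Build _ _ _ _ _ (comp_linr f (Z := S))).
  rewrite -[LHS]/(F _) linear_sum big1// => a _ /=.
  by rewrite -comp_assoc (v0 a (p a \oc f)) comp0r.
move=> f; have [phi lphi [psi phiK psiK]] := hom_shift (- k) 0 M S.
have [p0 _ _ _] := linear_raddf lphi.
move: phi lphi psi phiK psiK p0; rewrite sub0r opprK => phi lphi psi phiK psiK p0.
by rewrite -(psiK f) (vS (psi f)) p0.
Qed.

Lemma simple_retract T : simple_in H T -> retract T S.
Proof.
move=> sT; have [_ _ /(_ _ sT)[a Ta]] := hS_.
exact: retract_trans (isom_retract Ta) (is_sum_retract a hS).
Qed.

(** A nonzero component of [h] in another [S_ b] would factor through [v] and identify [S_ a] with
    [S_ b]; the component in [S_ a] is a multiple of [v] because endomorphisms of [S_ a] are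
    scalars. *)
Lemma top_dim1 X a (v : hom X (S_ a)) (i : forall a, hom (S_ a) S) p :
  (forall a, p a \oc i a = idm (S_ a)) -> \sum_a (i a \oc p a) = idm S ->
  retract X M -> indecomposable X -> v != 0 ->
  forall h : hom X S, exists c, h = c *: (i a \oc v).
Proof.
move=> pi e XM indX v0 h; have [sS nS _] := hS_.
have comp_h b : p b \oc h = 0 \/ b = a.
  have [|ph] := eqVneq (p b \oc h) 0; first by left.
  have [c cE] := top_unique XM indX (sS a) (sS b) v0 ph.
  have c0 : c != 0.
    by apply: contra_neq ph => c0; rewrite cE c0 comp0l.
  right; apply/eqP; apply: contraT => ba.
  case: (nS a b); first by rewrite eq_sym.
  by exists c; exact: simple_schur c0.
have [c cE] : exists c, p a \oc h = c *: v.
  have [->|ph] := eqVneq (p a \oc h) 0; first by exists 0; rewrite scale0r.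
  have [d dE] := top_unique XM indX (sS a) (sS a) v0 ph.
  have [c cE] := simple_endo d (sS a).
  by exists c; rewrite dE cE compZl comp_idl.
exists c; rewrite -compZr -cE -[h in LHS]comp_idl -e.
pose F : {linear hom S S -> hom X S} :=
  HB.pack (fun g => g \oc h) (GRing.isLinear.Build _ _ _ _ _ (comp_linr h (Z := S))).
rewrite -[LHS]/(F _) linear_sum (bigD1 a)//= big1 ?addr0 ?comp_assoc// => b ba.
by have [ph|e'] := comp_h b; [rewrite -comp_assoc ph comp0r|rewrite e' eqxx in ba].
Qed.

Lemma van_dim E k : van E k <-> dim (hom M (shift k E)) = 0%N.
Proof.
split=> [/(zero_dim (V := hom M (shift k E)))[]//|].
exact: (dim_eq0 (fdM (shift k E))).
Qed.

Lemma dim_hom_shift j k E :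
  dim (hom M (shift k (shift j E))) = dim (hom M (shift (k + j) E)).
Proof.
have e := hom_isom (isom_refl M) (isom_sym (shiftD k j E)).
by have [_ ->] := lin_iso_dim e (fdM _).
Qed.

Lemma dim_hom_dist X Y Z k : dist X Y Z ->
  (dim (hom M (shift k Y)) <= dim (hom M (shift k X)) + dim (hom M (shift k Z)))%N.
Proof.
move=> /(dist_shift k)[f [g [h t]]].
apply: (dim_exact (comp_linl f (X := M)) (comp_linl g (X := M)) _ (fdM _) (fdM _)).2.
by move=> v; exact: tri_exact_hom t.
Qed.

(** Passing to the cone could raise a dimension only through Hom(M, T[k+1]), that is for k = -1,
    where injectivity of Hom(M, f) makes the cohomology of the cone vanish. *)
Lemma peel_sub E : (forall k, k < 0 -> van E k) -> ~ van E 0 -> exists T C,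
  [/\ simple_in H T, dist T E C,
      forall k, (dim (hom M (shift k C)) <= dim (hom M (shift k E)))%N
    & (dim (hom M C) < dim (hom M E))%N].
Proof.
move=> vE nE; have [T [f [sT inj]]] := simple_sub vE nE.
have [C [g [h t]]] := tri_cone f; have d : dist T E C by exists f, g, h.
have [/HE hT _ _] := sT.
exists T, C; split=> // [k|].
  have [->|k1] := eqVneq k (-1).
    by rewrite ((van_dim _ _).1 (hom_inj_van_cone t inj (vE (-1) isT))).
  apply: leq_trans (dim_hom_dist k ((dist_rot _ _ _).1 d)) _.
  have /van_sh/van_dim -> : van T (k + 1) by apply: hT; lia.
  by rewrite addn0.
have [u un] := simple_hom_neq0 sT.
apply: (dim_surj_lt (comp_linl g (X := M))) => //.
  by apply: (hom_surj_cone2 t); exact: hT.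
exists (f \oc u); last by rewrite comp_assoc (tri_comp0 t) comp0l.
by apply: contra_neq un; exact: inj.
Qed.

Lemma sum_lt_term m (d d' : nat -> nat) i : (i < m)%N ->
  (forall j, (d' j <= d j)%N) -> (d' i < d i)%N ->
  (\sum_(j < m) d' j < \sum_(j < m) d j)%N.
Proof.
move=> im le lt; rewrite (bigD1 (Ordinal im))//= [ltnRHS](bigD1 (Ordinal im))//=.
by rewrite -addSn leq_add// leq_sum.
Qed.

Lemma cost_simple (P : set D) T k : thick P -> P S -> simple_in H T ->
  cost P S [:: k] (shift k T).
Proof.
move=> tP PS /simple_retract TS.
by apply: cost_retract (cost_base k tP PS); exact: retract_shift.
Qed.

(* Peel off a simple subobject of the lowest cohomology of E, for as long as E is
   nonzero. *)
Lemma resolve_simples (P : set D) N E (a : int) m : thick P -> P S ->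
  (forall k, k < a \/ a + m%:Z <= k -> van E k) ->
  (\sum_(i < m) dim (hom M (shift (a + i%:Z) E)) < N)%N ->
  exists ks, cost P S ks E /\
    forall k, (count_mem k ks <= dim (hom M (shift (- k) E)))%N.
Proof.
move=> tP PS; elim: N E => [//|N IH] E vE leN.
have [/van_zero E0|/existsNP[k0 nk0]] := pselect (forall k, van E k).
  by exists [::]; split=> //; exact: cost_zero.
have [|i ni imin] := @nat_min (fun i => ~ van E (a + i%:Z)).
  exists `|k0 - a|%N; suff -> : a + `|k0 - a|%N = k0 :> int by [].
  have : ~ (k0 < a) by move=> ka; apply: nk0; apply: vE; left.
  lia.
have im : (i < m)%N.
  by rewrite ltnNge; apply/negP => mi; apply: ni; apply: vE; right; lia.
(* [k1] is the lowest degree in which [E] has cohomology. *)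
set k1 := a + i%:Z in ni.
have [k kn||T [C [sT d leC ltC]]] := @peel_sub (shift k1 E).
- apply/van_shift; have [ka|ka] := ltP (k + k1) a; first by apply: vE; left.
  apply: contrapT; have -> : k + k1 = a + (absz (k + k1 - a)%R)%:Z by lia.
  by move=> /imin; lia.
- by move=> /van_shift; rewrite add0r.
have d' : dist (shift (- k1) T) E (shift (- k1) C).
  by apply: dist_isom (dist_shift (- k1) d); try exact: isom_refl; exact: shift_shKV.
have leE k : (dim (hom M (shift k (shift (- k1) C))) <= dim (hom M (shift k E)))%N.
  rewrite dim_hom_shift; apply: leq_trans (leC _) _.
  by rewrite dim_hom_shift subrK.
have ltE : (dim (hom M (shift k1 (shift (- k1) C))) < dim (hom M (shift k1 E)))%N.
  by rewrite dim_hom_shift subrr.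
have [||ks [c cks]] := IH (shift (- k1) C).
- move=> k /vE /van_dim vk; apply/van_dim/eqP.
  by rewrite -leqn0 -vk leE.
- rewrite -ltnS; apply: leq_trans leN.
  exact: (sum_lt_term (d := fun j => dim (hom M (shift (a + j%:Z) E)))
    im (fun j => leE (a + j%:Z)) ltE).
exists (- k1 :: ks); split.
  exact: (cost_cat tP d' (cost_simple _ tP PS sT) c).
(* The new factor raises the count of [- k1] by one, paid for by the strict drop in degree [k1]. *)
move=> k /=; have [<-|_] := eqVneq (- k1) k; last by rewrite (leq_trans (cks k)).
rewrite add1n; apply: leq_ltn_trans (cks _) _.
by rewrite opprK.
Qed.

Lemma finite_dim_hom_dist X Y Z T : dist X Y Z -> finite_dim (hom X T) ->
  finite_dim (hom Z T) -> finite_dim (hom Y T) /\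
  (dim (hom Y T) <= dim (hom X T) + dim (hom Z T))%N.
Proof.
move=> [f [g [h t]]] fX fZ; rewrite addnC.
apply: (dim_exact (comp_linr g (Z := T)) (comp_linr f (Z := T))) => //.
by move=> v; exact: tri_exact_cohom t.
Qed.

(** Induction on the number [n'] of degrees in which both objects may have cohomology, orthogonality
    being the case 0. Within a step, coning off a nonzero map from [M] to the top degree of [X]
    lowers dim Hom(M, X[b]) until that degree disappears. *)
Lemma finite_dim_hom X E : (exists b, forall k, b < k -> van X k) ->
  (exists a, forall k, k < a -> van E k) -> finite_dim (hom X E).
Proof.
move=> [b vX] [a vE].
have ind (n' : nat) : forall X b, (forall k, b < k -> van X k) ->
    (forall k, k < b + 1 - n'%:Z -> van E k) -> finite_dim (hom X E).
  elim: n' => [|m IHm] {b vX}X b.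
    move=> vX vE'; apply: (zero_dim _).1 => f; apply: (orth_hom (j := b + 1)).
      by move=> k bk; apply: vX; lia.
    by move=> k bk; apply: vE'; lia.
  move=> vX vE'; move: {2}(dim _).+1 (ltnSn (dim (hom M (shift b X)))) => N.
  elim: N X vX => [//|N IHN] X vX leN.
  have [X0|] := pselect (van X b).
    apply: (IHm X (b - 1)) => k kb; last by apply: vE'; lia.
    have [->//|kb'] := eqVneq k b; apply: vX; lia.
  move=> /existsNP[u un].
  have [C [g [h t]]] := tri_cone u; have d : dist M (shift b X) C by exists u, g, h.
  have d' : dist (shift (- b) M) X (shift (- b) C).
    by apply: dist_isom (dist_shift (- b) d); try exact: isom_refl; exact: shift_shKV.
  apply: (finite_dim_hom_dist d' _ _).1.
    apply: (lin_iso_dim (lin_iso_sym (hom_shift (- b) 0 M E)) _).1; exact: fdM.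
  apply: IHN => [k bk|].
    apply/van_shift; apply: (van_dist3 d); last by apply: silt; lia.
    by apply/van_shift; rewrite subrK; exact: vX.
  rewrite ltnS in leN; rewrite dim_hom_shift subrr; apply: leq_trans leN.
  apply: (dim_surj_lt (comp_linl g (X := M))) => //.
    by apply: (hom_surj_cone2 t); exact: silt.
  by exists u; [exact/eqP|exact: tri_comp0 t].
apply: (ind (absz (b + 1 - a)%R) X b vX) => k hk; apply: vE; lia.
Qed.

Hypothesis bM : basic M.

(** Some indecomposable summand of [M] maps nontrivially to [T], and the map lifts through [f]. The
    map [y] records that the generator of Hom(X, S) extends to [F], which is the minimality of the
    cover. *)
Lemma top_lift T F (f : hom F T) : simple_in H T -> hom_surj f ->
  exists X (p : hom X F) (y : hom F S),
    [/\ retract X M, y \oc p != 0 & forall h : hom X S, exists c, h = c *: (y \oc p)].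
Proof.
move=> sT surj; have [_ _ /(_ _ sT)[a [e [e' [e'e ee']]]]] := hS_.
have [i [pr [pri prj eS]]] := hS.
have [r [F_ [[iM [pM [piM _ eM]]] indF _]]] := bM.
have [u un] := simple_hom_neq0 sT.
have [b ub] : exists b, u \oc iM b != 0.
  apply: contrapT => /forallNP no; move/eqP: un; apply.
  pose G : {linear hom M M -> hom M T} :=
    HB.pack (fun g => u \oc g) (GRing.isLinear.Build _ _ _ _ _ (comp_linl u (X := M))).
  rewrite -[u]comp_idr -eM -[LHS]/(G _) linear_sum big1// => b _ /=.
  rewrite comp_assoc; have /negP := no b; rewrite negbK => /eqP ->.
  exact: comp0l.
have XM : retract (F_ b) M by exists (iM b), (pM b).
have [p pE] := retract_lift (u \oc iM b) XM surj.
have v0 : e \oc (u \oc iM b) != 0.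
  apply: contra_neq ub => e0.
  by rewrite -[LHS]comp_idl -e'e -comp_assoc e0 comp0r.
exists (F_ b), p, (i a \oc e \oc f).
have -> : i a \oc e \oc f \oc p = i a \oc (e \oc (u \oc iM b)).
  by rewrite -pE !comp_assoc.
split=> //; last exact: (top_dim1 pri eS XM (indF b) v0).
apply: contra_neq v0 => i0.
by rewrite -[LHS]comp_idl -(pri a) -comp_assoc i0 comp0r.
Qed.

Lemma peel_quotient F : (forall k, 0 < k -> van F k) -> ~ van F 0 ->
  (forall k, finite_dim (hom F (shift k S))) -> exists X C,
  [/\ retract X M, dist X F C, forall k, 0 < k -> van C k,
      forall k, finite_dim (hom C (shift k S)) /\
        (dim (hom C (shift k S)) <= dim (hom F (shift k S)))%N
    & (dim (hom C S) < dim (hom F S))%N].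
Proof.
move=> vF nF fd; have [T [f [sT surj]]] := simple_quotient vF nF.
have [X [p [y [XM yp span]]]] := top_lift sT surj.
have [C [g [h t]]] := tri_cone p; have d : dist X F C by exists p, g, h.
(* The kernel comes from Hom(sh X, shift k S), zero unless k = 1. There it is spanned by the shift
   of [y \oc p], which dies on [C] because it factors through [fmap sh p]. *)
have inj k : injective (fun v : hom C (shift k S) => v \oc g).
  move=> v v' e; apply/subr0_eq; set w := v - v'.
  have [|z zE] := tri_exact_cohom' (u := w) t; first by rewrite compBl e subrr.
  have [k1|k1] := eqVneq k 1; last first.
    rewrite -zE (_ : z = 0) ?comp0l//.
    apply: (hom_shift_vanish (j := 1)) => x.
    have [iX [pX pi]] := XM.
    have vS := sum_in_heart (k := k - 1).
    rewrite -[x]comp_idr -pi comp_assoc (vS _ (x \oc pX)) ?comp0l// subr_eq0//.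
  move: v v' e @w z zE; rewrite k1 => v v' e w z zE.
  have [z' z'E] := sh_full (z : hom (sh X) (sh S)).
  have [c cE] := span z'.
  rewrite -zE -z'E cE -compZl fmap_comp -comp_assoc.
  have := tri_comp0' ((tri_rot _ _ _).1 t); rewrite compNl.
  by move/eqP; rewrite oppr_eq0 => /eqP ->; rewrite comp0r.
exists X, C; split=> // [k k0|k|].
- apply: (van_dist3 d); first exact: vF.
  by apply: (van_retract XM); apply: silt; lia.
- exact: (dim_inj (comp_linr g (Z := shift k S)) (inj k) (fd k)).
- apply: (dim_inj_lt (comp_linr g (Z := S)) (inj 0) (fd 0)).
  (* [y] is nonzero on [X], so it does not factor through [C]. *)
  exists y => v e; move/eqP: yp; apply.
  by rewrite -e -comp_assoc (tri_comp0 t) comp0r.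
Qed.

(* A minimal silting resolution: an indecomposable summand of M covering a simple
   quotient of the highest cohomology of F is split off, which lowers one of the
   numbers dim Hom(F, shift k S) by one and does not raise the others. *)
Lemma resolve_silting (P : set D) N F (a b : int) m : thick P -> P M ->
  (forall k, b < k -> van F k) ->
  (forall k, finite_dim (hom F (shift k S))) ->
  (forall k, k < a \/ a + m%:Z <= k -> dim (hom F (shift k S)) = 0%N) ->
  (\sum_(i < m) dim (hom F (shift (a + i%:Z) S)) < N)%N ->
  exists ks, cost P M ks F /\
    forall k, (count_mem k ks <= dim (hom F (shift k S)))%N.
Proof.
move=> tP PM; elim: N F => [//|N IH] F vF fd sF leN.
have [/van_zero F0|/existsNP[k0 nk0]] := pselect (forall k, van F k).
  by exists [::]; split=> //; exact: cost_zero.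
have [|i ni imin] := @nat_min (fun i => ~ van F (b - i%:Z)).
  exists `|b - k0|%N; suff -> : b - `|b - k0|%N%:Z = k0 by [].
  have : ~ (b < k0) by move=> ka; apply: nk0; apply: vF.
  lia.
(* [k1] is the highest degree in which [F] has cohomology. *)
set k1 := b - i%:Z in ni.
have shift_dim E j k : finite_dim (hom E (shift (k - j) S)) ->
    finite_dim (hom (shift j E) (shift k S)) /\
    dim (hom (shift j E) (shift k S)) = dim (hom E (shift (k - j) S)).
  by apply: lin_iso_dim; exact/lin_iso_sym/hom_shift.
have [k kn||k|X [C [XM d vC leC ltC]]] := @peel_quotient (shift k1 F).
- apply/van_shift; have [bk|kb] := ltP b (k + k1); first exact: vF.
  apply: contrapT; have -> : k + k1 = b - (absz (b - (k + k1))%R)%:Z by lia.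
  by move=> /imin; lia.
- by move=> /van_shift; rewrite add0r.
- exact: (shift_dim F k1 k (fd _)).1.
have d' : dist (shift (- k1) X) F (shift (- k1) C).
  by apply: dist_isom (dist_shift (- k1) d); try exact: isom_refl; exact: shift_shKV.
have fdC k : finite_dim (hom (shift (- k1) C) (shift k S)).
  by apply: (shift_dim _ _ _ _).1; exact: (leC _).1.
have leF k : (dim (hom (shift (- k1) C) (shift k S)) <= dim (hom F (shift k S)))%N.
  rewrite (shift_dim _ _ _ (leC _).1).2 opprK; apply: leq_trans (leC _).2 _.
  by rewrite (shift_dim _ _ _ (fd _)).2 addrK.
have ltF : (dim (hom (shift (- k1) C) (shift (- k1) S)) < dim (hom F (shift (- k1) S)))%N.
  rewrite (shift_dim _ _ _ (leC _).1).2 opprK addNr; apply: leq_trans ltC _.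
  by rewrite (shift_dim F k1 0 (fd _)).2 sub0r.
(* Outside the range the dimension is 0 and cannot drop. *)
have [ak ka] : a <= - k1 /\ - k1 < a + m%:Z.
  split; [rewrite leNgt|rewrite ltNge]; apply/negP => ka; have := ltF; first by rewrite (sF _ (or_introl ka)).
  by rewrite (sF _ (or_intror ka)).
have kE : - k1 = a + (absz (- k1 - a)%R)%:Z by lia.
have [||||ks [c cks]] := IH (shift (- k1) C).
- move=> k bk; apply/van_shift/vC; lia.
- exact: fdC.
- by move=> k /sF sk; apply/eqP; rewrite -leqn0 -sk leF.
- rewrite -ltnS; apply: leq_trans leN.
  apply: (sum_lt_term (d := fun j => dim (hom F (shift (a + j%:Z) S)))
    (d' := fun j => dim (hom (shift (- k1) C) (shift (a + j%:Z) S)))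
    (i := absz (- k1 - a)%R)) => [|j|]; [lia|exact: leF|by rewrite -kE].
exists (- k1 :: ks); split.
  have cX : cost P M [:: - k1] (shift (- k1) X).
    by apply: cost_retract (cost_base _ tP PM); exact: retract_shift.
  exact: (cost_cat tP d' cX c).
move=> k /=; have [<-|_] := eqVneq (- k1) k; last by rewrite (leq_trans (cks k)).
by rewrite add1n; exact: leq_ltn_trans (cks _) ltF.
Qed.

End Heart.

(** * Weighted sums of graded dimensions *)

Section GradedSums.
Variable R : realType.
Implicit Types (t : R) (d : int -> nat).
Local Open Scope ereal_scope.

Definition graded_sum t d : \bar R :=
  \esum_(k in [set: int]) ((d k)%:R * expR (k%:~R * t))%R%:E.

Lemma graded_term_ge0 t d k : 0 <= ((d k)%:R * expR (k%:~R * t))%R%:E.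
Proof. by rewrite lee_fin mulr_ge0// expR_ge0. Qed.

Lemma graded_sum_ge0 t d : 0 <= graded_sum t d.
Proof. by apply: esum_ge0 => k _; exact: graded_term_ge0. Qed.

Lemma graded_sum_le t d d' : (forall k, d k <= d' k)%N ->
  graded_sum t d <= graded_sum t d'.
Proof.
move=> dd'; apply: le_esum => k _.
by rewrite lee_fin ler_wpM2r ?expR_ge0// ler_nat.
Qed.

Lemma graded_sum_leD t d d1 d2 : (forall k, d k <= d1 k + d2 k)%N ->
  graded_sum t d <= graded_sum t d1 + graded_sum t d2.
Proof.
move=> dd; rewrite /graded_sum -esumD; try by move=> k _; exact: graded_term_ge0.
apply: le_esum => k _; rewrite -EFinD lee_fin -mulrDl -natrD.
by rewrite ler_wpM2r ?expR_ge0// ler_nat.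
Qed.

Lemma graded_sum_eq0 t d : (forall k, d k = 0%N) -> graded_sum t d = 0.
Proof.
move=> d0; rewrite /graded_sum; apply: esum1 => k _.
by rewrite d0 mul0r.
Qed.

Lemma graded_sum_opp t d : graded_sum (- t)%R (fun k => d (- k)%R) = graded_sum t d.
Proof.
rewrite /graded_sum [RHS](reindex_esum [set: int] _ (fun k => - k)%R); last first.
  split=> [k _ //|k l _ _ /oppr_inj//|k _]; exists (- k)%R => //.
  by rewrite opprK.
by apply: eq_esum => k _; rewrite mulrNz mulrN mulNr.
Qed.

Lemma graded_sum_shift t d j :
  graded_sum t (fun k => d (k - j)%R) <= (expR (j%:~R * t))%:E * graded_sum t d.
Proof.
rewrite /graded_sum (reindex_esum [set: int] _ (fun k => k + j)%R); last first.
  split=> [k _ //|k l _ _ /addIr//|k _]; exists (k - j)%R => //.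
  by rewrite subrK.
apply: ub_ereal_sup => _ [X [fX sX] <-].
have -> : \sum_(k \in X) ((d (k + j - j)%R)%:R * expR ((k + j)%:~R * t))%R%:E =
    (expR (j%:~R * t))%:E * \sum_(k \in X) ((d k)%:R * expR (k%:~R * t))%R%:E.
  rewrite ge0_mule_fsumr; last by move=> k; exact: graded_term_ge0.
  apply: eq_fsbigr => k _.
  by rewrite addrK intrD mulrDl expRD -EFinM mulrA mulrC.
apply: lee_wpmul2l; first by rewrite lee_fin expR_ge0.
by apply: esum_ge; exists X.
Qed.

Lemma graded_sum_single t d : (forall k, k != 0%R -> d k = 0%N) ->
  graded_sum t d = ((d 0%R)%:R)%:E.
Proof.
move=> d0; rewrite /graded_sum.
have -> : ((d 0%R)%:R)%:E = \esum_(k in [set 0%R : int]) ((d k)%:R * expR (k%:~R * t))%R%:E.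
  by rewrite esum_set1 ?graded_term_ge0// mul0r expR0 mulr1.
rewrite [RHS]esum_mkcond; apply: eq_esum => k _.
case: ifPn => //; rewrite notin_setE/= => k0.
by rewrite d0 ?mul0r//; exact/eqP.
Qed.

(** Grouping equal entries of [ks] turns the weight into a finite sum whose coefficients are the
    multiplicities. *)
Lemma weight_le_graded_sum t d ks : (forall k, count_mem k ks <= d k)%N ->
  (weight t ks)%:E <= graded_sum t d.
Proof.
move=> cks; apply: esum_ge; exists [set` undup ks]; first by split=> //; exact: finite_seq.
rewrite -fsbig_seq ?undup_uniq//= sumEFin lee_fin /weight.
have -> : (\sum_(k <- ks) expR (k%:~R * t) =
    \sum_(k <- undup ks) (count_mem k ks)%:R * expR (k%:~R * t))%R.
  rewrite -big_undup_iterop_count; apply: eq_bigr => k _.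
  by rewrite Monoid.iteropE iter_addr_0 mulr_natl.
apply: ler_sum => k _.
by rewrite ler_wpM2r ?expR_ge0// ler_nat.
Qed.

End GradedSums.

(** * Eventual vanishing of Hom spaces and change of functor *)

Section Eventually.
Variables (K : closedFieldType) (D : tricat K).

(** The flag selects the end of the integers, so that boundedness above and below is treated
    once. *)
Definition eventually_int (up : bool) (p : int -> Prop) : Prop :=
  exists b, forall k, b <= (if up then k else - k) -> p k.

Lemma eventually_int2 up p q r : eventually_int up p -> eventually_int up q ->
  (forall k, p k -> q k -> r k) -> eventually_int up r.
Proof.
move=> [b bp] [c cq] pqr; exists (Num.max b c) => k.
by rewrite ge_max => /andP[/bp pk /cq qk]; exact: pqr.
Qed.

Lemma eventually_int_impl up (p q : int -> Prop) : (forall k, p k -> q k) ->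
  eventually_int up p -> eventually_int up q.
Proof. by move=> pq [b bp]; exists b => k /bp/pq. Qed.

Lemma eventually_int_shift up p j : eventually_int up p ->
  eventually_int up (fun k => p (k + j)).
Proof.
move=> [b bp]; exists (b + `|j|) => k bk; apply: bp.
by case: up bk; lia.
Qed.

(** Thickness lets the minimality of [B] carry a bound from [M] to every object of [B]. *)
Lemma thick_eventually_from up (E : D) :
  thick [set F | eventually_int up (fun k => forall f : hom F (shift k E), f = 0)].
Proof.
have shc j F : eventually_int up (fun k => forall f : hom F (shift k E), f = 0) ->
    eventually_int up (fun k => forall f : hom (shift j F) (shift k E), f = 0).
  move=> /(eventually_int_shift (- j)); apply: eventually_int_impl => k.
  exact: hom_shift_vanish.
split=> [X X0|X pX|X Y Z f g h t pX pY|X Y Z /is_sum2_retract[i [p pi]]] /=.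
- by exists 0 => k _ f; exact: zero_from.
- by split; [exact: (shc 1)|exact: (shc (-1))].
- apply: (eventually_int2 (shc 1 _ pX) pY) => k vX vY u.
  have [|v <-] := tri_exact_cohom' (u := u) t; first exact: vY.
  by rewrite (vX v) comp0l.
- apply: eventually_int_impl => k vZ f.
  by rewrite -[f]comp_idr -pi comp_assoc (vZ (f \oc p)) comp0l.
Qed.

Lemma thick_eventually_to up (M : D) : thick [set F | eventually_int up (van M F)].
Proof.
split=> [X X0|X pX|X Y Z f g h t pX pY|X Y Z s] /=.
- by exists 0 => k _ u; apply: zero_to; exact: shift_zero.
- split.
    have := eventually_int_shift 1 pX; apply: eventually_int_impl => k.
    by move/van_sh.
  have := eventually_int_shift (-1) pX; apply: eventually_int_impl => k.
  by move/van_shV.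
- apply: (eventually_int2 pY (eventually_int_shift 1 pX)) => k vY vX.
  by apply: (van_dist3 _ vY vX); exists f, g, h.
- apply: eventually_int_impl => k; apply: van_retract; exact: is_sum2_retract s.
Qed.

End Eventually.

(* F is only additive, so the bijection Hom(G Y, X) = Hom(Y, F X) need not be
   K-linear; it identifies the two sides as groups with two commuting
   K-structures. *)
Lemma dim_hom_quasi_inverse (K : closedFieldType) (C D : lincat K)
    (F : functor C D) (G : functor D C) (Y : D) (X : C) : quasi_inverse F G ->
  finite_dim (hom (G Y) X) -> finite_dim (hom Y (F X)) ->
  dim (hom (G Y) X) = dim (hom Y (F X)).
Proof.
move=> FG fd1 fd2.
have [e [e' [e'e ee']]] := isom_sym (quasi_inverse_isom Y (quasi_inverse_sym FG)).
pose th (f : hom (G Y) X) : hom Y (F X) := fmap F f \oc e.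
have thD f g : th (f + g) = th f + th g by rewrite /th fmapD compDl.
have ex (g : hom Y (F X)) : exists f, th f = g.
  have [f fE] := @quasi_inverse_full _ _ _ F G (G Y) X (g \oc e') FG; exists f.
  by rewrite /th fE -comp_assoc e'e comp_idr.
pose ht g := projT1 (cid (ex g)).
have htK : cancel ht th by move=> g; rewrite /ht; case: cid.
have thK : cancel th ht.
  move=> f; apply: (quasi_inverse_faithful FG).
  have /(congr1 (fun x => x \oc e')) := htK (th f).
  by rewrite /th -!comp_assoc ee' !comp_idr.
(* Scaling on the left-hand side becomes composition with [fmap F (b *: idm X)], which is linear for
   the scalars of Hom(Y, F X); hence the two structures commute. *)
have scal b f : th (b *: f) = fmap F (b *: idm X) \oc th f.
  by rewrite /th comp_assoc -fmap_comp compZl comp_idl.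
have comm a b f : th (b *: ht (a *: th f)) = a *: th (b *: f).
  by rewrite !scal htK compZr.
apply/eqP; rewrite eqn_leq; apply/andP; split.
  apply: (@dim_bimodule_leq _ (hom Y (F X)) (hom (G Y) X) ht th) => //.
    by move=> f g; apply: (can_inj thK); rewrite htK thD !htK.
  move=> a b g; apply: (can_inj thK); rewrite htK.
  by rewrite -{1}[g]htK -comm thK htK.
exact: (@dim_bimodule_leq _ (hom (G Y) X) (hom Y (F X)) th ht).
Qed.

Lemma range_bounds (p : int -> Prop) : eventually_int true p -> eventually_int false p ->
  exists (a : int) (m : nat), forall k, k < a \/ a + m%:Z <= k -> p k.
Proof.
move=> [b bp] [c cp]; exists (- c), (absz (b + c)%R) => k hk.
by case: hk => hk; [apply: cp|apply: bp]; lia.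
Qed.

(** * Entropy on the two sides of an ST-triple *)

Section STTriple.
Variables (R : realType) (K : closedFieldType) (D : tricat K).
Variables (A B : set D) (M : D) (n : nat) (S_ : 'I_n -> D) (S : D).
Hypothesis hD_idem : idempotent_complete D.
Hypothesis hST : ST_triple B A M.
Hypothesis hM : basic M.
Hypothesis hS_ : complete_simples (heart (aisle A M) (coaisle A M)) S_.
Hypothesis hS : is_sum S_ S.

Let tA : thick A. Proof. by have [[]] := hST. Qed.
Let tB : thick B. Proof. by have [[]] := hST. Qed.
Let gB : split_generator B M. Proof. by have [[_ _ []]] := hST. Qed.
Let BM : B M. Proof. by have [_] := (split_generatorP _ _).1 gB. Qed.
Let silt k : 0 < k -> van M M k.
Proof. by have [[_ _ [_ h]] _ _ _ _] := hST => k0 f; exact: h k0. Qed.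
Let fdM E : finite_dim (hom M E). Proof. by have [_ + _ _ _] := hST; apply. Qed.

Let orth X Y (f : hom X (shV Y)) : (forall k, 0 < k -> van M X k) ->
  (forall k, k < 0 -> van M Y k) -> f = 0.
Proof.
have [_ _ [_ _ _ o _] _ _] := hST => vX vY.
by apply: o; split=> // k g k0; [exact: vX|exact: vY].
Qed.

Let trunc E : exists X Y, [/\ forall k, 0 < k -> van M X k,
  forall k, k < 0 -> van M Y k & dist X E (shV Y)].
Proof.
have [_ _ [_ _ _ _ /(_ E I)[X [Y [f [g [h [[_ vX] [_ vY] t]]]]]]] _ _] := hST.
exists X, Y; split=> [k k0 u|k k0 u|]; [exact: vX k0|exact: vY k0|].
by exists f, g, h.
Qed.

Let coA E : (forall k, k < 0 -> van M E k) -> A E.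
Proof.
by have [_ _ _ + _] := hST => h vE; apply: h; split=> // k f k0; exact: vE.
Qed.

(** Membership in [A] follows from the Hom conditions because the coaisle of [D] lies in [A]. *)
Let HE E : heart (aisle A M) (coaisle A M) E <-> in_heart M E.
Proof.
split=> [[[_ vp] [_ vn]] k k0 f|hE].
  by have [kp|kn] := ltP 0 k; [exact: vp kp|apply: vn; lia].
have AE : A E by apply: coA => k k0; apply: hE; lia.
by split; split=> // k f k0; apply: hE; lia.
Qed.

Lemma van_bounded E : A E -> eventually_int true (van M E) /\ eventually_int false (van M E).
Proof.
have [_ _ _ _ [_ Ale Age]] := hST => AE; split.
  move: AE; rewrite {1}Ale => -[j _ [Y [_ vY] EY]].
  exists (1 - j) => k jk; apply: (van_isom (isom_sym EY)); apply/van_shift => f.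
  by apply: vY; lia.
move: AE; rewrite {1}Age => -[j _ [Y [_ vY] EY]].
exists (j + 1) => k jk; apply: (van_isom (isom_sym EY)); apply/van_shift => f.
by apply: vY; lia.
Qed.

Let hSh : in_heart M S. Proof. exact: (sum_in_heart HE hS_ hS). Qed.

Let AS : A S. Proof. by apply: coA => k k0; apply: hSh; lia. Qed.

Lemma simple_sum_cost E : A E -> exists ks, cost A S ks E /\
  forall k, (count_mem k ks <= dim (hom M (shift (- k) E)))%N.
Proof.
move=> /van_bounded[up dn]; have [a [m vE]] := range_bounds up dn.
exact: (resolve_simples fdM orth trunc HE hS_ hS tA AS vE (ltnSn _)).
Qed.

Lemma simple_sum_generator : split_generator A S.
Proof.
apply: cost_split_generator => // E /simple_sum_cost[ks [c _]].
by exists ks.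
Qed.

Let vanS_bounded up : eventually_int up (van M S).
Proof. by have [] := van_bounded AS; case: up. Qed.

Lemma finite_dim_hom_A F E : eventually_int true (van M F) -> A E ->
  finite_dim (hom F E).
Proof.
move=> [b vF] /van_bounded[_ [a vE]].
apply: (finite_dim_hom fdM orth silt).
  by exists b => k bk; apply: vF; exact: ltW.
by exists (- a) => k ka; apply: vE; lia.
Qed.

Lemma silting_cost F : eventually_int true (van M F) ->
  (forall up, eventually_int up (fun k => forall f : hom F (shift k S), f = 0)) ->
  exists ks, cost B M ks F /\
    forall k, (count_mem k ks <= dim (hom F (shift k S)))%N.
Proof.
move=> vF FS; have [a [m FS0]] := range_bounds (FS true) (FS false).
have fd k : finite_dim (hom F (shift k S)).
  by apply: finite_dim_hom_A => //; exact: thick_shift.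
have [b vF'] := vF.
apply: (resolve_silting fdM orth trunc HE silt hD_idem hS_ hS hM (a := a) (b := b)
  tB BM _ fd _ (ltnSn (\sum_(i < m) _))).
  by move=> k bk; apply: vF'; exact: ltW.
by move=> k /FS0 k0; exact: (zero_dim _).2.
Qed.

(** Both bounds hold for [M], by silting and by boundedness of [S], and thickness spreads them over
    [B]. *)
Lemma B_bounded F : B F -> eventually_int true (van M F) /\
  forall up, eventually_int up (fun k => forall f : hom F (shift k S), f = 0).
Proof.
have [_ _ minB] := (split_generatorP _ _).1 gB => BF; split=> [|up].
  apply: (minB _ (thick_eventually_to true M) _ F BF).
  by exists 1 => k k0; apply: silt; lia.
apply: (minB _ (thick_eventually_from up S) _ F BF).
exact: vanS_bounded.
Qed.

(** * Comparison of Hom sums with complexity *)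

Section Sums.
Variable t : R.

Lemma hom_sum_A_ge0 E : (0 <= hom_sum t M E)%E.
Proof. exact: graded_sum_ge0. Qed.

Lemma hom_sum_A_le ks E F : A E -> cost A E ks F ->
  (hom_sum t M F <= (weight t ks)%:E * hom_sum t M E)%E.
Proof.
move=> AE; apply: (cost_le (h := hom_sum t M) tA) => //.
- by move=> X; exact: graded_sum_ge0.
- move=> X X0; apply: graded_sum_eq0 => k.
  by apply: (zero_dim _).2 => f; apply: zero_to; exact: shift_zero.
- move=> X Y Z _ _ _ d; apply: graded_sum_leD => k.
  exact: dim_hom_dist.
- move=> X Y _ _ XY; apply: graded_sum_le => k.
  have [i [p pi]] := retract_shift (- k) XY.
  apply: (dim_inj (comp_linl i (X := M)) _ (fdM _)).2 => u v e.
  by rewrite -[u]comp_idl -[v]comp_idl -pi -!comp_assoc e.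
- move=> k; apply: le_trans (graded_sum_shift _ _ _); apply: graded_sum_le => j.
  by rewrite dim_hom_shift// opprB addrC.
Qed.

Lemma hom_sum_A_S : hom_sum t M S = ((dim (hom M S))%:R)%:E.
Proof.
rewrite /hom_sum -[LHS]/(graded_sum t (fun k => dim (hom M (shift (- k) S)))).
rewrite graded_sum_single// => k k0; apply: (zero_dim _).2.
by apply: hSh; rewrite oppr_eq0.
Qed.

Lemma hom_sum_A_dominated (X : nat -> D) : (forall N, A (X N)) ->
  dominated (fun N => hom_sum t M (X N)) (fun N => delta A t S (X N)) /\
  dominated (fun N => delta A t S (X N)) (fun N => hom_sum t M (X N)).
Proof.
move=> AX; split.
  (* The sum for [S] reduces to its degree 0 term, which gives the constant; adding 1 makes it
     positive. *)
  exists ((dim (hom M S))%:R + 1); first by rewrite ltr_wpDl.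
  move=> N; apply: (@le_trans _ _ (((dim (hom M S))%:R)%:E * delta A t S (X N))%E).
    apply: le_mul_delta => //.
      exact: split_generator_cost simple_sum_generator (AX N).
    move=> ks c; rewrite EFinM -hom_sum_A_S muleC; exact: hom_sum_A_le.
  by apply: lee_wpmul2r; [exact: delta_ge0|rewrite lee_fin lerDl].
apply: dominated_le => N; have [ks [c cks]] := simple_sum_cost (AX N).
apply: le_trans (delta_le t tA c) _.
exact: (weight_le_graded_sum t (d := fun k => dim (hom M (shift (- k) (X N))))).
Qed.

(** Substituting -k gives the indexing in which the degree is the shift of the factor of [M], as in
    [silting_cost]. *)
Lemma hom_sum_BE F : hom_sum (- t) F S = graded_sum t (fun k => dim (hom F (shift k S))).
Proof. exact: (graded_sum_opp t (fun k => dim (hom F (shift k S)))). Qed.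

Let fdB F k : B F -> finite_dim (hom F (shift k S)).
Proof. by move=> /B_bounded[vF _]; apply: finite_dim_hom_A => //; exact: thick_shift. Qed.

Lemma hom_sum_B_le ks E F : B E -> cost B E ks F ->
  (hom_sum (- t) F S <= (weight t ks)%:E * hom_sum (- t) E S)%E.
Proof.
move=> BE; apply: (cost_le (h := fun F => hom_sum (- t) F S) tB) => //.
- by move=> X; exact: graded_sum_ge0.
- move=> X X0; apply: graded_sum_eq0 => k.
  by apply: (zero_dim _).2 => f; exact: zero_from.
- move=> X Y Z BX BY BZ d; apply: graded_sum_leD => k.
  by apply: (finite_dim_hom_dist d _ _).2; exact: fdB.
- move=> X Y _ BY [i [p pi]]; apply: graded_sum_le => k.
  apply: (dim_inj (comp_linr p (Z := shift (- k) S)) _ (fdB _ BY)).2 => u v e.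
  by rewrite -[u]comp_idr -[v]comp_idr -pi !comp_assoc e.
- move=> k; rewrite !hom_sum_BE; apply: le_trans (graded_sum_shift _ _ _).
  apply: graded_sum_le => j.
  by have [_ ->] := lin_iso_dim (lin_iso_sym (hom_shift k j E S)) (fdB _ BE).
Qed.

Lemma hom_sum_B_dominated (X : nat -> D) : (forall N, B (X N)) ->
  dominated (fun N => hom_sum (- t) (X N) S) (fun N => delta B t M (X N)) /\
  dominated (fun N => delta B t M (X N)) (fun N => hom_sum (- t) (X N) S).
Proof.
move=> BX; split.
  exists ((dim (hom M S))%:R + 1); first by rewrite ltr_wpDl.
  move=> N; apply: (@le_trans _ _ (((dim (hom M S))%:R)%:E * delta B t M (X N))%E).
    apply: le_mul_delta => //; first exact: split_generator_cost gB (BX N).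
    move=> ks c; rewrite mulrC EFinM.
    have <- : hom_sum (- t) M S = ((dim (hom M S))%:R)%:E.
      rewrite hom_sum_BE graded_sum_single// => k k0; apply: (zero_dim _).2.
      exact: hSh.
    exact: hom_sum_B_le.
  by apply: lee_wpmul2r; [exact: delta_ge0|rewrite lee_fin lerDl].
apply: dominated_le => N; have [vF FS] := B_bounded (BX N).
have [ks [c cks]] := silting_cost vF FS.
apply: le_trans (delta_le t tB c) _.
by rewrite hom_sum_BE; exact: weight_le_graded_sum.
Qed.

End Sums.

(** * Entropies of the restrictions and of the inverse *)

Variables (Phi : exact_functor D D) (t : R).
Hypotheses (hA : preserves A Phi) (hB : preserves B Phi).

Let tPhi : tri_functor Phi. Proof. exact: exact_tri_functor. Qed.

Lemma entropy_A : exists h : \bar R, is_entropy A Phi t h /\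
  forall G, split_generator A G ->
    log_growth (fun N => hom_sum t M (iter N Phi G)) @ \oo --> h.
Proof.
have [h hP] := entropy_cvg t tPhi hA simple_sum_generator.
have ent := is_entropyP tPhi hA simple_sum_generator hP.
exists h; split=> // G gG; have [_ AG _] := (split_generatorP _ _).1 gG.
have [d1 d2] := hom_sum_A_dominated t (fun N => preserves_iter hA N AG).
by apply: (log_growth_entropy tPhi hA simple_sum_generator gG ent) => // N;
  exact: hom_sum_A_ge0.
Qed.

Lemma entropy_B : exists h : \bar R, is_entropy B Phi t h /\
  forall G, split_generator B G ->
    log_growth (fun N => hom_sum (- t) (iter N Phi G) S) @ \oo --> h.
Proof.
have [h hP] := entropy_cvg t tPhi hB gB.
have ent := is_entropyP tPhi hB gB hP.
exists h; split=> // G gG; have [_ BG _] := (split_generatorP _ _).1 gG.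
have [d1 d2] := hom_sum_B_dominated t (fun N => preserves_iter hB N BG).
apply: (log_growth_entropy tPhi hB gB gG ent) => // N.
exact: graded_sum_ge0.
Qed.

Variable Psi : functor D D.
Hypothesis hPsi : quasi_inverse Phi Psi.

Let tPsi : tri_functor Psi. Proof. exact: quasi_inverse_tri_functor tPhi hPsi. Qed.

(** The bounds needed by [silting_cost] are obtained by applying [Phi]: those on Hom(M, Psi M[k])
    from Hom(Phi M, M[k]), as Phi M is in [B], and those on Hom(Psi M, S[k]) from Hom(M, Phi S[k]),
    as Phi S is in [A]. *)
Lemma quasi_inverse_B_silting : B (Psi M).
Proof.
have PsiPhi := quasi_inverse_sym hPsi.
have MPsi : isom M (Phi (Psi M)) by exact/isom_sym/(quasi_inverse_isom M PsiPhi).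
have [_ _ minB] := (split_generatorP _ _).1 gB.
have [|up|ks [c _]] := @silting_cost (Psi M); last exact: cost_in tB c.
  have : eventually_int true (fun k => forall f : hom (Phi M) (shift k M), f = 0).
    apply: (minB _ (thick_eventually_from true M) _ _ (hB BM)).
    by exists 1 => k k0; apply: silt; lia.
  apply: eventually_int_impl => k v f.
  apply: (quasi_inverse_faithful hPsi); rewrite fmap0.
  apply: (hom_vanish_isom (isom_refl _) _ v).
  apply: isom_trans (shift_functor_isom k MPsi) _.
  exact/isom_sym/tri_functor_shift.
have : eventually_int up (van M (Phi S)) by have [] := van_bounded (hA AS); case: up.
apply: eventually_int_impl => k v f.
apply: (quasi_inverse_faithful hPsi); rewrite fmap0.
apply: (hom_vanish_isom MPsi _ v).
exact/isom_sym/tri_functor_shift.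
Qed.

(** The preimage of [B] under [Psi] is thick and contains the generator [M]. *)
Lemma quasi_inverse_preserves_B : preserves B Psi.
Proof.
move=> F BF; have [ks c] := split_generator_cost gB BF.
have [_ _ minB] := (split_generatorP _ _).1 gB.
suff tQ : thick [set F | B (Psi F)] by exact: (minB _ tQ quasi_inverse_B_silting F BF).
split=> [X X0|X BX|X Y Z f g h tr BX BY|X Y Z s] /=.
- by have [Bz _ _ _] := tB; apply: Bz; exact: functor_zero.
- split.
    by apply: (thick_isom tB (isom_sym (tri_functor_shift 1 X tPsi))); exact: thick_shift.
  by apply: (thick_isom tB (isom_sym (tri_functor_shift (-1) X tPsi))); exact: thick_shift.
- apply: (thick_dist3 tB _ BX BY); apply: tri_functor_dist => //.
  by exists f, g, h.
- by apply: thick_retract => //; apply: functor_retract; exact: is_sum2_retract s.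
Qed.

(** [Psi] is moved across one copy at a time; the sources stay in [B] and the targets in [A], which
    gives the finiteness that [dim_hom_quasi_inverse] requires. *)
Lemma dim_hom_iter N X : A X ->
  dim (hom (iter N Psi M) X) = dim (hom M (iter N Phi X)).
Proof.
elim: N X => [//|N IH] X AX; rewrite [iter N.+1 Phi X]iterSr -IH; last exact: hA.
have BN : B (iter N Psi M) by exact: (preserves_iter quasi_inverse_preserves_B).
have fd F : B F -> forall E, A E -> finite_dim (hom F E).
  by move=> /B_bounded[vF _] E; exact: finite_dim_hom_A.
apply: (dim_hom_quasi_inverse hPsi); apply: fd => //; last exact: hA.
exact: quasi_inverse_preserves_B.
Qed.

Lemma hom_sum_iter N : hom_sum t (iter N Psi M) S = hom_sum t M (iter N Phi S).
Proof.
apply: eq_esum => k _; rewrite dim_hom_iter; last exact: thick_shift.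
have e : isom (iter N Phi (shift (- k) S)) (shift (- k) (iter N Phi S)).
  elim: N => [|N IH]; first exact: isom_refl.
  exact: isom_trans (functor_isom Phi IH) (tri_functor_shift _ _ tPhi).
by have [_ ->] := lin_iso_dim (hom_isom (isom_refl M) e) (fdM _).
Qed.

(** At the parameter [- t] the comparison in [B] uses [hom_sum (- - t)], and [hom_sum_iter]
    identifies it with the sum already controlled on the side of [A]. *)
Lemma entropy_inverse (h : \bar R) :
  log_growth (fun N => hom_sum t M (iter N Phi S)) @ \oo --> h ->
  is_entropy B Psi (- t) h.
Proof.
move=> hP; have PsiB := quasi_inverse_preserves_B.
apply: (is_entropyP tPsi PsiB gB).
have [] := hom_sum_B_dominated (- t) (fun N => preserves_iter PsiB N BM).
have -> : (fun N => hom_sum (- - t) (iter N Psi M) S) =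
    (fun N => hom_sum t M (iter N Phi S)).
  by apply/funext => N; rewrite opprK hom_sum_iter.
move=> d1 d2; apply: (log_growth_cvg _ _ d2 d1 hP) => N; first exact: delta_ge0.
exact: hom_sum_A_ge0.
Qed.

End STTriple.

Theorem theorem1p5 (R : realType) (K : closedFieldType) (D : tricat K)
  (Phi : exact_functor D D) (A B : set D) (M : D)
  (n : nat) (S_ : 'I_n -> D) (S : D) (t : R)
  (hD_idem : idempotent_complete D)
  (hD_alg : algebraic D)
  (hST : ST_triple B A M)
  (hM : basic M)
  (hS_ : complete_simples (heart (aisle A M) (coaisle A M)) S_)
  (hS : is_sum S_ S)
  (hA : preserves A Phi)
  (hB : preserves B Phi)
  (hA0 : non_nilpotent A Phi)
  (hB0 : non_nilpotent B Phi) :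
  exists hPhiA hPhiB : \bar R,
    [/\ is_entropy A Phi t hPhiA,
        forall G, split_generator A G ->
          log_growth (fun N => hom_sum t M (iter N Phi G)) @ \oo --> hPhiA,
        is_entropy B Phi t hPhiB,
        forall G, split_generator B G ->
          log_growth (fun N => hom_sum (- t) (iter N Phi G) S) @ \oo --> hPhiB
      & (* the restriction of Phi to B has the restriction of Psi as inverse *)
        forall Psi : functor D D, quasi_inverse Phi Psi ->
          [/\ preserves B Psi,
              is_entropy B Psi (- t) hPhiA
            & log_growth (fun N => hom_sum t M (iter N Phi S)) @ \oo --> hPhiA]].
Proof.
have [a [entA growA]] := entropy_A hST hS_ hS t hA.
have [b [entB growB]] := entropy_B hD_idem hST hM hS_ hS t hB.
exists a, b; split=> // Psi hPsi.
have growS := growA S (simple_sum_generator hST hS_ hS).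
split=> //.
  exact: (quasi_inverse_preserves_B hD_idem hST hM hS_ hS hA hB hPsi).
exact: (entropy_inverse hD_idem hST hM hS_ hS hA hB hPsi growS).
Qed.
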